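(* Let $X_0$ be an element of the set $\mathcal{B}$. Then the semi-discrete system (S) stated in the context admits a unique global solution $X=(\zeta,U,H,\bar r,g,k,\gamma,\kappa)$ with initial datum $X(0)=X_0$, with $(\zeta,U,H,\bar r)\in \mathbf{C}^1([0,\infty),\mathbf{E}_{\Delta\xi})$ and with $X(t)\in\mathcal{B}$ for all times $t\ge0$. In particular, for $t>0$, the norm $\|X(t)\|_{\mathbf{E}_{\Delta\xi}}$ is bounded by $C\|X(0)\|_{\mathbf{E}_{\Delta\xi}}$ for a constant $C$ depending only on $t$, the total energy $H_\infty$, the asymptotic density $\rho_\infty$, and $\|\zeta(0)\|_{\boldsymbol{\ell}^\infty}$.
   Context: Grid and norms. Fix $\Delta\xi>0$, $\rho_\infty\ge0$, and $\xi_j=j\Delta\xi$, $j\in\mathbb{Z}$. For sequences, $\mathrm{D}_\pm v_j=\pm(v_{j\pm1}-v_j)/\Delta\xi$; for two-index objects, $\mathrm{D}_{j\pm}$ acts on the index $j$. Norms: $\|v\|_{\boldsymbol{\ell}^p}=(\Delta\xi\sum_j|v_j|^p)^{1/p}$ for $1\le p<\infty$, $\|v\|_{\boldsymbol{\ell}^\infty}=\sup_j|v_j|$, $\|v\|_{\mathbf{h}^1}^2=\|v\|_{\boldsymbol{\ell}^2}^2+\|\mathrm{D}_+v\|_{\boldsymbol{\ell}^2}^2$, and $\mathbf{V}_{\Delta\xi}=\{v\in\boldsymbol{\ell}^\infty:\mathrm{D}_+v\in\boldsymbol{\ell}^2\}$ with $\|v\|_{\mathbf{V}_{\Delta\xi}}=\|v\|_{\boldsymbol{\ell}^\infty}+\|\mathrm{D}_+v\|_{\boldsymbol{\ell}^2}$.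 Put $\mathbf{E}_{\Delta\xi}=\mathbf{V}_{\Delta\xi}\times\mathbf{h}^1\times\mathbf{V}_{\Delta\xi}\times\boldsymbol{\ell}^2$ with $\|(\zeta,U,H,\bar r)\|_{\mathbf{E}_{\Delta\xi}}=\|\zeta\|_{\mathbf{V}_{\Delta\xi}}+\|U\|_{\mathbf{h}^1}+\|H\|_{\mathbf{V}_{\Delta\xi}}+\|\bar r\|_{\boldsymbol{\ell}^2}$. For kernels $g=\{g_{i,j}\}_{i,j\in\mathbb{Z}}$: $\|g\|_{\boldsymbol{\ell}^p}=\sup_i(\Delta\xi\sum_j|g_{i,j}|^p)^{1/p}$, $\|g\|_{\boldsymbol{\ell}^\infty}=\sup_{i,j}|g_{i,j}|$, $\boldsymbol{\ell}^*=\boldsymbol{\ell}^1\cap\boldsymbol{\ell}^\infty$ with norm $\|\cdot\|_{\boldsymbol{\ell}^1}+\|\cdot\|_{\boldsymbol{\ell}^\infty}$. Put $\mathbf{E}^{\rm ker}_{\Delta\xi}=\mathbf{E}_{\Delta\xi}\times(\boldsymbol{\ell}^* )^4$. For $X=(\zeta,U,H,\bar r,g,k,\gamma,\kappa)$, $\|X\|_{\mathbf{E}_{\Delta\xi}}$ denotes the norm of the component $(\zeta,U,H,\bar r)$. System (S). With $y_j=\xi_j+\zeta_j$, $h_j=\mathrm{D}_+H_j$, $$R_j=\Delta\xi\sum_i\gamma_{i,j}U_i(\mathrm{D}_+U_i)+\Delta\xi\sum_ik_{i,j}(h_i+\rho_\infty\bar r_i),\qquad Q_j=\Delta\xi\sum_ig_{i,j}U_i(\mathrm{D}_+U_i)+\Delta\xi\sum_i\kappa_{i,j}(h_i+\rho_\infty\bar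 r_i),$$ the system is, for all $i,j\in\mathbb{Z}$, $$\dot\zeta_j=U_j,\quad \dot U_j=-Q_j,\quad \dot H_j=-U_jR_{j-1},\quad \dot{\bar r}_j=-\rho_\infty\mathrm{D}_+U_j,$$ $$\dot g_{i,j}=-\Delta\xi\sum_m(\mathrm{D}_+U_m)(g_{i,m}g_{m,j}+\gamma_{i,m}\kappa_{m,j}),\qquad \dot k_{i,j}=-\Delta\xi\sum_m(\mathrm{D}_+U_m)(k_{i,m}k_{m,j}+\kappa_{i,m}\gamma_{m,j}),$$ $$\dot\gamma_{i,j}=-\Delta\xi\sum_m(\mathrm{D}_+U_m)(\gamma_{i,m}k_{m,j}+g_{i,m}\gamma_{m,j}),\qquad \dot\kappa_{i,j}=-\Delta\xi\sum_m(\mathrm{D}_+U_m)(\kappa_{i,m}g_{m,j}+k_{i,m}\kappa_{m,j}).$$ Set $\mathcal{B}$: all $(\zeta,U,H,\bar r,g,k,\gamma,\kappa)\in\mathbf{E}^{\rm ker}_{\Delta\xi}$ such that (a) for all $i,j$: $(\mathrm{D}_+y_j)g_{i,j}-\mathrm{D}_{j-}\gamma_{i,j}=\delta_{i,j}/\Delta\xi$, $\ \mathrm{D}_{j+}g_{i,j}=(\mathrm{D}_+y_j)\gamma_{i,j}$, $\ (\mathrm{D}_+y_j)k_{i,j}-\mathrm{D}_{j+}\kappa_{i,j}=\delta_{i,j}/\Delta\xi$, $\ \mathrm{D}_{j-}k_{i,j}=(\mathrm{D}_+y_j)\kappa_{i,j}$, and $g_{j,i}=g_{i,j}$, $k_{j,i}=k_{i,j}$,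 $\gamma_{j,i}=-\kappa_{i,j}$; (b) $\mathrm{D}_+y,\mathrm{D}_+U,\mathrm{D}_+H,\bar r\in\boldsymbol{\ell}^\infty$; (c) $2(\mathrm{D}_+y_j)(\mathrm{D}_+H_j)=U_j^2(\mathrm{D}_+y_j)^2+(\mathrm{D}_+U_j)^2+\bar r_j^2$ for all $j$; (d) $\mathrm{D}_+y_j\ge0$, $\mathrm{D}_+H_j\ge0$, $\mathrm{D}_+y_j+\mathrm{D}_+H_j>0$ for all $j$. Convention: $H$ is the cumulative energy, i.e. $H_j=\Delta\xi\sum_{i=-\infty}^{j-1}h_i$ (so $H_j\to0$ as $j\to-\infty$). The total energy is $H_\infty=\lim_{n\to+\infty}H_n$, which is conserved in time. *)

(* Defs.v *)
From Stdlib Require Import Reals ZArith.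
From Coquelicot Require Import Coquelicot.
Open Scope R_scope.

(* Sums over Z, split into the halves j >= 0 and j < 0.  For nonnegative
   terms [ex_sumZ a] is plain finiteness of the sum, and for an absolutely
   summable family [sumZ a] does not depend on the order of summation. *)
Definition ex_sumZ (a : Z -> R) : Prop :=
  ex_series (fun n : nat => a (Z.of_nat n)) /\
  ex_series (fun n : nat => a (- Z.of_nat n - 1)%Z).

Definition sumZ (a : Z -> R) : R :=
  Series (fun n : nat => a (Z.of_nat n)) +
  Series (fun n : nat => a (- Z.of_nat n - 1)%Z).

Definition Dp (dx : R) (v : Z -> R) (j : Z) : R := (v (j + 1)%Z - v j) / dx.
Definition Dm (dx : R) (v : Z -> R) (j : Z) : R := (v j - v (j - 1)%Z) / dx.

Definition kron (i j : Z) : R := if Z.eq_dec i j then 1 else 0.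

Definition in_linf (v : Z -> R) : Prop :=
  exists M : R, forall j : Z, Rabs (v j) <= M.
Definition in_l2 (v : Z -> R) : Prop := ex_sumZ (fun j => Rabs (v j) ^ 2).
Definition in_h1 (dx : R) (v : Z -> R) : Prop := in_l2 v /\ in_l2 (Dp dx v).
Definition in_V (dx : R) (v : Z -> R) : Prop := in_linf v /\ in_l2 (Dp dx v).

(* Like [sumZ], the norms are total functions; they are meaningful on the
   corresponding space only. *)
Definition norm_linf (v : Z -> R) : R :=
  real (Lub_Rbar (fun x => exists j : Z, x = Rabs (v j))).
Definition norm_l2 (dx : R) (v : Z -> R) : R :=
  sqrt (dx * sumZ (fun j => Rabs (v j) ^ 2)).
Definition norm_h1 (dx : R) (v : Z -> R) : R :=
  sqrt (norm_l2 dx v ^ 2 + norm_l2 dx (Dp dx v) ^ 2).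
Definition norm_V (dx : R) (v : Z -> R) : R :=
  norm_linf v + norm_l2 dx (Dp dx v).

Definition kernel : Type := Z -> Z -> R.

(* The intersection of the kernel spaces l^1 and l^infinity: the l^1 norm is
   the supremum over the first index of sums over the second one. *)
Definition in_lstar (dx : R) (a : kernel) : Prop :=
  (exists M : R, forall i : Z,
     ex_sumZ (fun j => Rabs (a i j)) /\
     dx * sumZ (fun j => Rabs (a i j)) <= M) /\
  (exists M : R, forall i j : Z, Rabs (a i j) <= M).

Record evec : Type := EVec {
  zeta : Z -> R;
  U : Z -> R;
  H : Z -> R;
  rbar : Z -> R }.

Definition in_E (dx : R) (v : evec) : Prop :=
  in_V dx (zeta v) /\ in_h1 dx (U v) /\ in_V dx (H v) /\ in_l2 (rbar v).

Definition norm_E (dx : R) (v : evec) : R :=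
  norm_V dx (zeta v) + norm_h1 dx (U v) + norm_V dx (H v)
  + norm_l2 dx (rbar v).

Definition evec_sub (v w : evec) : evec :=
  EVec (fun j => zeta v j - zeta w j) (fun j => U v j - U w j)
       (fun j => H v j - H w j) (fun j => rbar v j - rbar w j).

Definition evec_scal (c : R) (v : evec) : evec :=
  EVec (fun j => c * zeta v j) (fun j => c * U v j)
       (fun j => c * H v j) (fun j => c * rbar v j).

Record state : Type := State {
  ev :> evec;
  ker_g : kernel;
  ker_k : kernel;
  ker_gamma : kernel;
  ker_kappa : kernel }.

Definition in_Eker (dx : R) (X : state) : Prop :=
  in_E dx X /\ in_lstar dx (ker_g X) /\ in_lstar dx (ker_k X) /\
  in_lstar dx (ker_gamma X) /\ in_lstar dx (ker_kappa X).

Definition ypos (dx : R) (v : evec) (j : Z) : R := IZR j * dx + zeta v j.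

Definition in_B (dx : R) (X : state) : Prop :=
  in_Eker dx X /\
  (forall i j : Z,
     Dp dx (ypos dx X) j * ker_g X i j - Dm dx (ker_gamma X i) j
       = kron i j / dx /\
     Dp dx (ker_g X i) j = Dp dx (ypos dx X) j * ker_gamma X i j /\
     Dp dx (ypos dx X) j * ker_k X i j - Dp dx (ker_kappa X i) j
       = kron i j / dx /\
     Dm dx (ker_k X i) j = Dp dx (ypos dx X) j * ker_kappa X i j /\
     ker_g X j i = ker_g X i j /\
     ker_k X j i = ker_k X i j /\
     ker_gamma X j i = - ker_kappa X i j) /\
  (in_linf (Dp dx (ypos dx X)) /\ in_linf (Dp dx (U X)) /\
   in_linf (Dp dx (H X)) /\ in_linf (rbar X)) /\
  (forall j : Z,
     2 * Dp dx (ypos dx X) j * Dp dx (H X) j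
       = U X j ^ 2 * Dp dx (ypos dx X) j ^ 2 + Dp dx (U X) j ^ 2
         + rbar X j ^ 2) /\
  (forall j : Z,
     0 <= Dp dx (ypos dx X) j /\ 0 <= Dp dx (H X) j /\
     0 < Dp dx (ypos dx X) j + Dp dx (H X) j).

(* In R and Q the kernels are summed over their first index. *)
Definition Rfun (dx rho : R) (X : state) (j : Z) : R :=
  dx * sumZ (fun i => ker_gamma X i j * U X i * Dp dx (U X) i)
  + dx * sumZ (fun i => ker_k X i j * (Dp dx (H X) i + rho * rbar X i)).

Definition Qfun (dx rho : R) (X : state) (j : Z) : R :=
  dx * sumZ (fun i => ker_g X i j * U X i * Dp dx (U X) i)
  + dx * sumZ (fun i => ker_kappa X i j * (Dp dx (H X) i + rho * rbar X i)).

Definition ker_rhs (dx : R) (X : state) (a b c d : kernel) (i j : Z) : R :=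
  - (dx * sumZ (fun m => Dp dx (U X) m * (a i m * b m j + c i m * d m j))).

(* Punctured neighbourhoods of t relative to [0, infinity); at t = 0 the
   derivative below is the right derivative. *)
Definition halfline' (t : R) : (R -> Prop) -> Prop :=
  within (fun s => 0 <= s) (locally' t).

Definition deriv_at (f : R -> R) (t l : R) : Prop :=
  filterlim (fun s => (f s - f t) / (s - t)) (halfline' t) (locally l).

Definition solves_S (dx rho : R) (X : R -> state) : Prop :=
  forall t : R, 0 <= t -> forall i j : Z,
    deriv_at (fun s => zeta (X s) j) t (U (X t) j) /\
    deriv_at (fun s => U (X s) j) t (- Qfun dx rho (X t) j) /\
    deriv_at (fun s => H (X s) j) t
      (- (U (X t) j * Rfun dx rho (X t) (j - 1)%Z)) /\
    deriv_at (fun s => rbar (X s) j) t (- (rho * Dp dx (U (X t)) j)) /\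
    deriv_at (fun s => ker_g (X s) i j) t
      (ker_rhs dx (X t) (ker_g (X t)) (ker_g (X t))
                        (ker_gamma (X t)) (ker_kappa (X t)) i j) /\
    deriv_at (fun s => ker_k (X s) i j) t
      (ker_rhs dx (X t) (ker_k (X t)) (ker_k (X t))
                        (ker_kappa (X t)) (ker_gamma (X t)) i j) /\
    deriv_at (fun s => ker_gamma (X s) i j) t
      (ker_rhs dx (X t) (ker_gamma (X t)) (ker_k (X t))
                        (ker_g (X t)) (ker_gamma (X t)) i j) /\
    deriv_at (fun s => ker_kappa (X s) i j) t
      (ker_rhs dx (X t) (ker_kappa (X t)) (ker_g (X t))
                        (ker_k (X t)) (ker_kappa (X t)) i j).

(* C^1([0, infinity), E): strong derivative in the norm of E at every t >= 0,
   with values in E and continuous for the norm of E. *)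
Definition C1_E (dx : R) (v : R -> evec) : Prop :=
  (forall t : R, 0 <= t -> in_E dx (v t)) /\
  exists v' : R -> evec,
    (forall t : R, 0 <= t -> in_E dx (v' t)) /\
    (forall t : R, 0 <= t ->
       filterlim
         (fun s => norm_E dx
            (evec_sub (evec_scal (/ (s - t)) (evec_sub (v s) (v t))) (v' t)))
         (halfline' t) (locally 0)) /\
    (forall t : R, 0 <= t ->
       filterlim (fun s => norm_E dx (evec_sub (v' s) (v' t)))
         (halfline' t) (locally 0)).

Definition global_solution (dx rho : R) (X0 : state) (X : R -> state) : Prop :=
  solves_S dx rho X /\ X 0 = X0 /\ C1_E dx X /\
  (forall t : R, 0 <= t -> in_B dx (X t)).

(* H_j is dx times the sum of D_+ H_i over i < j. *)
Definition cumulative_energy (dx : R) (v : evec) : Prop :=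
  forall j : Z,
    is_series (fun n : nat => dx * Dp dx (H v) (j - 1 - Z.of_nat n)%Z) (H v j).

Definition Hinfty (v : evec) : R :=
  real (Lim_seq (fun n : nat => H v (Z.of_nat n))).

(* Main.v *)
Require Import Defs.
From Stdlib Require Import Reals ZArith Lra Lia Psatz ClassicalEpsilon
  FunctionalExtensionality.
From Coquelicot Require Import Coquelicot.
Open Scope R_scope.

(* The right-hand side is a polynomial map, locally Lipschitz in the norm of
   the kernel space, so Picard iteration gives local solutions; the work lies
   in the a priori bounds.

   The relations between D_+ y and the kernels say that the kernels invert a
   first order difference operator that is linear in D_+ y, and the kernel
   equations are the derivative of this inversion: the defects of (a) solve a
   homogeneous linear equation and stay zero.  Then D_- R = (D_+ y) Q - U D_+ U
   and D_+ Q = (D_+ y) R - D_+ H - rho rbar, which makes (c) a constant of the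
   motion; (c) bounds the derivative of D_+ y + D_+ H by a multiple of itself,
   and (d) follows.

   By (c), |U D_+ U| <= D_+ H, hence U^2 <= 2 E with E the conserved energy, and
   zeta grows at most linearly.  For fixed i the product g_{i,j+1} gamma_{i,j} is
   monotone in j off the diagonal and vanishes at infinity; this gives the signs
   of g and gamma, |gamma| <= 1, and g_{i,i} <= 2 + 4 sup |zeta| for every grid
   size, so that R and Q are bounded.  Summing Q D_- R + R D_+ Q by parts bounds
   R and Q in l^2 by (D_+ zeta, D_+ U, D_+ H, rbar), and Gronwall's inequality
   bounds the growth of the norm by a rate that is independent of the grid size. *)

(** Two kinds of bounds are kept apart. [nrm], with a constant [M], bounds all components on a fixed
    grid, where [D_+] is a bounded operator and constants may contain powers of [1 / dx]. Such
    bounds only justify manipulations: they select Lipschitz constants, make boundary terms vanish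
    and start Gronwall iterations. The constants of the final estimate, [rate] and [growth], contain
    neither [M] nor [dx].

    The obstacle is that [D_+ y] may vanish, so that no positive lower bound for it is available.
    Three facts replace one: [y] stays within sup |zeta| of the grid and must therefore grow over a
    long enough window; [D_+ y - 1 = D_+ zeta] is square summable; and (c) gives
    [|U D_+ U| <= D_+ H] and [rbar^2 <= 2 (D_+ y) (D_+ H)].

    The order of the invariance proof is forced: (a) is linear in its defects and needs no sign, (c)
    uses (a) through the differences of [R] and [Q], and (d) uses (c). Only then are the
    monotonicity arguments for the kernels available, which assume [D_+ y >= 0], and with them the
    bounds that allow continuation. *)

(** * Sums over the integers *)

(* Sums over the integer interval [-n, n). *)
Fixpoint psum (f : Z -> R) (n : nat) : R :=
  match n with
  | O => 0
  | S k => psum f k + (f (Z.of_nat k) + f (- Z.of_nat k - 1)%Z)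
  end.

Lemma psum_ext f g n : (forall j, f j = g j) -> psum f n = psum g n.
Proof. intros E; induction n; simpl; [easy|now rewrite IHn, !E]. Qed.

Lemma psum_plus f g n : psum (fun j => f j + g j) n = psum f n + psum g n.
Proof. induction n; simpl; lra. Qed.

Lemma psum_minus f g n : psum (fun j => f j - g j) n = psum f n - psum g n.
Proof. induction n; simpl; lra. Qed.

Lemma psum_scal c f n : psum (fun j => c * f j) n = c * psum f n.
Proof. induction n; simpl; lra. Qed.

Lemma psum_le f g n : (forall j, f j <= g j) -> psum f n <= psum g n.
Proof.
intros E; induction n; simpl; [lra|].
generalize (E (Z.of_nat n)) (E (- Z.of_nat n - 1)%Z); lra.
Qed.

Lemma psum_ge0 f n : (forall j, 0 <= f j) -> 0 <= psum f n.
Proof.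
intros E; induction n; simpl; [lra|].
generalize (E (Z.of_nat n)) (E (- Z.of_nat n - 1)%Z); lra.
Qed.

Lemma psum_abs f n : Rabs (psum f n) <= psum (fun j => Rabs (f j)) n.
Proof.
induction n; simpl.
- rewrite Rabs_R0; lra.
- eapply Rle_trans; [apply Rabs_triang|].
  apply Rplus_le_compat; [easy|apply Rabs_triang].
Qed.

Lemma psum_mono f n m :
  (forall j, 0 <= f j) -> (n <= m)%nat -> psum f n <= psum f m.
Proof.
intros E L; induction L; simpl; [lra|].
generalize (E (Z.of_nat m)) (E (- Z.of_nat m - 1)%Z); lra.
Qed.

Lemma psum_term f j n : (forall i, 0 <= f i) ->
  (- Z.of_nat n <= j < Z.of_nat n)%Z -> f j <= psum f n.
Proof.
intros E; induction n as [|n IHn]; intros Hj; [simpl in Hj; lia|].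
assert (P := psum_ge0 f n E); cbn [psum].
generalize (E (Z.of_nat n)) (E (- Z.of_nat n - 1)%Z); intros E1 E2.
destruct (Z.eq_dec j (Z.of_nat n)) as [->|N1]; [lra|].
destruct (Z.eq_dec j (- Z.of_nat n - 1)) as [->|N2]; [lra|].
assert (f j <= psum f n) by (apply IHn; lia); lra.
Qed.

Lemma psum_telescope G n :
  psum (fun j => G (j + 1)%Z - G j) n = G (Z.of_nat n) - G (- Z.of_nat n)%Z.
Proof.
induction n as [|n IHn]; [simpl; lra|]; cbn [psum]; rewrite IHn.
replace (Z.of_nat (S n)) with (Z.of_nat n + 1)%Z by lia.
replace (- Z.of_nat n - 1 + 1)%Z with (- Z.of_nat n)%Z by lia.
replace (- (Z.of_nat n + 1))%Z with (- Z.of_nat n - 1)%Z by lia.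
lra.
Qed.

Lemma kron_same i : kron i i = 1.
Proof. unfold kron; destruct (Z.eq_dec i i); [lra|lia]. Qed.

Lemma kron_diff i j : i <> j -> kron i j = 0.
Proof. unfold kron; destruct (Z.eq_dec i j); [lia|lra]. Qed.

Lemma psum_kron i f n :
  psum (fun j => kron i j * f j) n =
  if Z_le_dec (- Z.of_nat n) i then
    if Z_lt_dec i (Z.of_nat n) then f i else 0 else 0.
Proof.
induction n as [|n IHn].
- simpl; destruct (Z_le_dec 0 i); destruct (Z_lt_dec i 0); lia || lra.
- cbn [psum]; rewrite IHn.
  destruct (Z.eq_dec i (Z.of_nat n)) as [->|N1];
  [|destruct (Z.eq_dec i (- Z.of_nat n - 1)) as [->|N2]];
  rewrite ?kron_same, ?kron_diff by lia;
  repeat destruct Z_le_dec; repeat destruct Z_lt_dec; lia || lra.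
Qed.

Lemma psum_reflect f n : psum (fun j => f (- j - 1)%Z) n = psum f n.
Proof.
induction n as [|n IHn]; simpl; [easy|]; rewrite IHn.
replace (- (- Z.of_nat n - 1) - 1)%Z with (Z.of_nat n) by lia; lra.
Qed.

(** The shifted window [[-n + 1, n + 1)] is contained in [[-n - 1, n + 1)]. *)
Lemma psum_shift_pos f n : (forall j, 0 <= f j) ->
  psum (fun j => f (j + 1)%Z) n <= psum f (S n).
Proof.
intros E.
assert (K : forall G : Z -> R, psum (fun j => G (j+1)%Z) n - psum G n
              = G (Z.of_nat n) - G (- Z.of_nat n)%Z).
{ intros G; rewrite <- psum_minus; apply psum_telescope. }
specialize (K f); cbn [psum].
generalize (E (- Z.of_nat n)%Z) (E (- Z.of_nat n - 1)%Z); lra.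
Qed.

Lemma psum_shift_neg f n : (forall j, 0 <= f j) ->
  psum (fun j => f (j - 1)%Z) n <= psum f (S n).
Proof.
intros E.
rewrite <- psum_reflect, <- (psum_reflect f).
rewrite (psum_ext _ (fun j => f (- (j + 1) - 1)%Z)) by (intros j; f_equal; lia).
apply (psum_shift_pos (fun j => f (- j - 1)%Z)); intros; apply E.
Qed.

(** Absolute summability with an explicit constant, stated on finite sums: constants pass through
    sums, products and limits by finite estimates, and [asum_ex] supplies convergence when it is
    wanted. *)
Definition asum (f : Z -> R) (B : R) : Prop :=
  forall n, psum (fun j => Rabs (f j)) n <= B.

Lemma asum_ge0 f B : asum f B -> 0 <= B.
Proof. intros A; exact (A O). Qed.

Lemma asum_le f g B : (forall j, Rabs (f j) <= Rabs (g j)) ->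
  asum g B -> asum f B.
Proof.
intros E A n; eapply Rle_trans; [|apply (A n)]; apply psum_le; easy.
Qed.

Lemma asum_ext f g B : (forall j, f j = g j) -> asum g B -> asum f B.
Proof. intros E; apply asum_le; intros; rewrite E; lra. Qed.

Lemma asum_weak f B C : asum f B -> B <= C -> asum f C.
Proof. intros A L n; generalize (A n); lra. Qed.

Lemma asum_abs f B : asum f B -> asum (fun j => Rabs (f j)) B.
Proof. apply asum_le; intros; rewrite Rabs_Rabsolu; lra. Qed.

Lemma asum_plus f g B C : asum f B -> asum g C ->
  asum (fun j => f j + g j) (B + C).
Proof.
intros A A' n; generalize (A n) (A' n); intros.
assert (psum (fun j => Rabs (f j + g j)) n <=
        psum (fun j => Rabs (f j) + Rabs (g j)) n)
  by (apply psum_le; intros; apply Rabs_triang).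
rewrite psum_plus in *; lra.
Qed.

Lemma asum_opp f B : asum f B -> asum (fun j => - f j) B.
Proof. apply asum_le; intros; rewrite Rabs_Ropp; lra. Qed.

Lemma asum_minus f g B C : asum f B -> asum g C ->
  asum (fun j => f j - g j) (B + C).
Proof. intros; apply asum_plus; [|apply asum_opp]; easy. Qed.

Lemma asum_scal c f B : asum f B -> asum (fun j => c * f j) (Rabs c * B).
Proof.
intros A n.
rewrite (psum_ext _ (fun j => Rabs c * Rabs (f j))) by (intros; apply Rabs_mult).
rewrite psum_scal; apply Rmult_le_compat_l; [apply Rabs_pos|apply A].
Qed.

Lemma asum_mult_bd f g B M : (forall j, Rabs (g j) <= M) -> asum f B ->
  asum (fun j => g j * f j) (M * B).
Proof.
intros E A.
assert (0 <= M) by (generalize (E 0%Z) (Rabs_pos (g 0%Z)); lra).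
eapply asum_le with (g := fun j => M * f j).
- intros j; rewrite !Rabs_mult; apply Rmult_le_compat_r; [apply Rabs_pos|].
  rewrite (Rabs_pos_eq M); easy.
- replace (M * B) with (Rabs M * B) by (rewrite (Rabs_pos_eq M); easy).
  now apply asum_scal.
Qed.

Lemma asum_kron i f : asum (fun j => kron i j * f j) (Rabs (f i)).
Proof.
intros n.
rewrite (psum_ext _ (fun j => kron i j * Rabs (f j))).
- rewrite psum_kron; generalize (Rabs_pos (f i)); intros.
  destruct Z_le_dec; [destruct Z_lt_dec|]; lra.
- intros j; rewrite Rabs_mult; f_equal; apply Rabs_pos_eq.
  unfold kron; destruct Z.eq_dec; lra.
Qed.

Lemma asum_term f B j : asum f B -> Rabs (f j) <= B.
Proof.
intros A; eapply Rle_trans; [|apply (A (S (Z.abs_nat j)))].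
apply (psum_term (fun j => Rabs (f j))); [intros; apply Rabs_pos|lia].
Qed.

Lemma psum_sum_n f n : psum f (S n) =
  sum_n (fun k => f (Z.of_nat k)) n + sum_n (fun k => f (- Z.of_nat k - 1)%Z) n.
Proof.
induction n as [|n IHn].
- rewrite !sum_O; simpl; lra.
- rewrite !sum_Sn; unfold plus; cbn -[psum sum_n Z.of_nat] in *.
  change (psum f (S (S n))) with
    (psum f (S n) + (f (Z.of_nat (S n)) + f (- Z.of_nat (S n) - 1)%Z)).
  rewrite IHn; lra.
Qed.

Lemma ex_series_bounded (a : nat -> R) B :
  (forall n, sum_n (fun k => Rabs (a k)) n <= B) -> ex_series a.
Proof.
intros HB; apply ex_series_Rabs.
destruct (ex_finite_lim_seq_incr (sum_n (fun k => Rabs (a k))) B) as [l Hl].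
- intros n; rewrite sum_Sn; unfold plus; simpl.
  generalize (Rabs_pos (a (S n))); lra.
- easy.
- now exists l.
Qed.

Lemma sum_n_ge0 (a : nat -> R) n : (forall k, 0 <= a k) -> 0 <= sum_n a n.
Proof.
intros E; induction n; [rewrite sum_O; apply E|].
rewrite sum_Sn; unfold plus; simpl; generalize (E (S n)); lra.
Qed.

Lemma asum_ex f B : asum f B -> ex_sumZ f.
Proof.
intros A; split; apply (ex_series_bounded _ B); intros n;
generalize (A (S n)); rewrite psum_sum_n;
generalize (sum_n_ge0 (fun k => Rabs (f (Z.of_nat k))) n (fun k => Rabs_pos _))
  (sum_n_ge0 (fun k => Rabs (f (- Z.of_nat k - 1)%Z)) n (fun k => Rabs_pos _));
lra.
Qed.

Lemma sumZ_correct f : ex_sumZ f -> is_lim_seq (psum f) (sumZ f).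
Proof.
intros [E1 E2]; apply is_lim_seq_incr_1.
apply is_lim_seq_ext with (2 := is_lim_seq_plus' _ _ _ _
   (Series_correct _ E1) (Series_correct _ E2)).
intros n; symmetry; apply psum_sum_n.
Qed.

Lemma sumZ_lim f B : asum f B -> is_lim_seq (psum f) (sumZ f).
Proof. intros A; apply sumZ_correct, (asum_ex _ _ A). Qed.

Lemma sumZ_unique f B (s : R) : asum f B -> is_lim_seq (psum f) s -> sumZ f = s.
Proof.
intros A L.
assert (E := is_lim_seq_unique _ _ (sumZ_lim _ _ A)).
rewrite (is_lim_seq_unique _ _ L) in E.
apply (f_equal real) in E; simpl in E; now symmetry.
Qed.

Lemma sumZ_ext f g : (forall j, f j = g j) -> sumZ f = sumZ g.
Proof.
intros E; unfold sumZ; f_equal; apply Series_ext; intros; apply E.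
Qed.

Lemma sumZ_plus f g B C : asum f B -> asum g C ->
  sumZ (fun j => f j + g j) = sumZ f + sumZ g.
Proof.
intros A A'; apply (sumZ_unique _ (B + C)); [now apply asum_plus|].
eapply is_lim_seq_ext; [intros; symmetry; apply psum_plus|].
apply (is_lim_seq_plus' _ _ _ _ (sumZ_lim _ _ A) (sumZ_lim _ _ A')).
Qed.

Lemma sumZ_scal c f B : asum f B -> sumZ (fun j => c * f j) = c * sumZ f.
Proof.
intros A; apply (sumZ_unique _ (Rabs c * B)); [now apply asum_scal|].
eapply is_lim_seq_ext; [intros; symmetry; apply psum_scal|].
apply (is_lim_seq_scal_l _ c (Finite _) (sumZ_lim _ _ A)).
Qed.

Lemma sumZ_minus f g B C : asum f B -> asum g C ->
  sumZ (fun j => f j - g j) = sumZ f - sumZ g.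
Proof.
intros A A'.
rewrite (sumZ_ext _ (fun j => f j + (-1) * g j)) by (intros; lra).
rewrite (sumZ_plus _ _ B (Rabs (-1) * C)), (sumZ_scal _ _ C); try lra; try easy.
now apply asum_scal.
Qed.

Lemma sumZ_kron i f : sumZ (fun j => kron i j * f j) = f i.
Proof.
apply (sumZ_unique _ _ _ (asum_kron i f)).
apply is_lim_seq_ext_loc with (fun _ => f i); [|apply is_lim_seq_const].
exists (S (Z.abs_nat i)); intros n Hn; rewrite psum_kron.
destruct Z_le_dec; [destruct Z_lt_dec|]; lia || lra.
Qed.

Lemma sumZ_bound f B : asum f B -> Rabs (sumZ f) <= B.
Proof.
intros A.
apply (is_lim_seq_le (fun n => Rabs (psum f n)) (fun _ => B)
        (Rabs (sumZ f)) B).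
- intros n; eapply Rle_trans; [apply psum_abs|apply A].
- apply (is_lim_seq_abs _ (sumZ f)), (sumZ_lim _ _ A).
- apply is_lim_seq_const.
Qed.

Lemma sumZ_abs f B : asum f B -> Rabs (sumZ f) <= sumZ (fun j => Rabs (f j)).
Proof.
intros A.
apply (is_lim_seq_le (fun n => Rabs (psum f n)) (psum (fun j => Rabs (f j)))
        (Rabs (sumZ f)) (sumZ (fun j => Rabs (f j)))).
- intros n; apply psum_abs.
- apply (is_lim_seq_abs _ (sumZ f)), (sumZ_lim _ _ A).
- apply (sumZ_lim _ B); now apply asum_abs.
Qed.

Lemma sumZ_abs_bound f B : asum f B -> sumZ (fun j => Rabs (f j)) <= B.
Proof.
intros A; apply asum_abs in A; apply sumZ_bound in A.
now apply Rle_trans with (2 := A), Rle_abs.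
Qed.

Lemma psum_le_sumZ f n : ex_sumZ f -> (forall j, 0 <= f j) ->
  psum f n <= sumZ f.
Proof.
intros X E.
apply (is_lim_seq_le_loc (fun _ => psum f n) (psum f) (psum f n) (sumZ f)).
- exists n; intros m Hm; now apply psum_mono.
- apply is_lim_seq_const.
- now apply sumZ_correct.
Qed.

Lemma asum_of_ex f : ex_sumZ (fun j => Rabs (f j)) ->
  asum f (sumZ (fun j => Rabs (f j))).
Proof.
intros X n; apply (psum_le_sumZ (fun j => Rabs (f j))); [easy|].
intros; apply Rabs_pos.
Qed.

(** Exchanging a finite with an infinite sum is only linearity of [sumZ]. This takes the place of
    Tonelli's theorem in Schur's test and in the bounds for kernel products. *)
Lemma psum_sumZ (f : Z -> Z -> R) n : (forall j, exists B, asum (fun i => f i j) B) ->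
  (exists B, asum (fun i => psum (f i) n) B) /\
  psum (fun j => sumZ (fun i => f i j)) n = sumZ (fun i => psum (f i) n).
Proof.
intros A; induction n as [|n [[B IA] IE]]; simpl.
- split.
  + exists 0; intros n; rewrite (psum_ext _ (fun _ => 0 * 0)).
    rewrite psum_scal; lra. intros; rewrite Rabs_R0; lra.
  + symmetry; apply (sumZ_unique _ 0).
    * intros n; rewrite (psum_ext _ (fun _ => 0 * 0)).
      rewrite psum_scal; lra. intros; rewrite Rabs_R0; lra.
    * apply is_lim_seq_ext with (fun _ => 0); [|apply is_lim_seq_const].
      intros n; induction n; simpl; lra.
- destruct (A (Z.of_nat n)) as [B1 A1], (A (- Z.of_nat n - 1)%Z) as [B2 A2].
  assert (A3 := asum_plus _ _ _ _ A1 A2).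
  split; [eexists; apply (asum_plus _ _ _ _ IA A3)|].
  rewrite IE, (sumZ_plus _ _ _ _ IA A3), (sumZ_plus _ _ _ _ A1 A2); lra.
Qed.

Lemma asum_lim f B :
  asum f B -> is_lim_seq (fun n => f (Z.of_nat n)) 0 /\
              is_lim_seq (fun n => f (- Z.of_nat n)%Z) 0.
Proof.
intros A; destruct (asum_ex _ _ A) as [E1 E2]; split.
- apply (ex_series_lim_0 _ E1).
- apply is_lim_seq_incr_1.
  apply is_lim_seq_ext with (2 := ex_series_lim_0 _ E2).
  intros n; f_equal; lia.
Qed.

(** * One-sided derivatives and Gronwall's inequality *)

(** The form without division also holds at [s = t], so that the puncture need not be carried
    along. *)
Lemma deriv_at_eps f t l : deriv_at f t l <->
  forall eps, 0 < eps -> exists del, 0 < del /\ forall s, 0 <= s ->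
    Rabs (s - t) < del -> Rabs (f s - f t - l * (s - t)) <= eps * Rabs (s - t).
Proof.
split.
- intros D eps He.
  assert (P : locally l (fun z => Rabs (z - l) < eps)).
  { exists (mkposreal eps He); intros z Hz; exact Hz. }
  destruct (D _ P) as [d Hd]; exists d; split; [apply cond_pos|].
  intros s Hs Hsd; destruct (Req_dec s t) as [->|N].
  + rewrite !Rminus_diag, Rmult_0_r, Rminus_0_r, Rabs_R0; lra.
  + assert (K := Hd s Hsd N Hs); cbv beta in K.
    replace (f s - f t - l * (s - t)) with (((f s - f t) / (s - t) - l) * (s - t))
      by (field; lra).
    rewrite Rabs_mult; apply Rmult_le_compat_r; [apply Rabs_pos|lra].
- intros E P [eps HP]; destruct (E (eps / 2)) as [d [Hd K]].
  { generalize (cond_pos eps); lra. }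
  exists (mkposreal d Hd); intros s Hs N H0; apply HP.
  change (Rabs ((f s - f t) / (s - t) - l) < eps).
  assert (Hp : 0 < Rabs (s - t)) by (apply Rabs_pos_lt; lra).
  specialize (K s H0 Hs).
  replace (f s - f t - l * (s - t)) with (((f s - f t) / (s - t) - l) * (s - t)) in K
    by (field; lra).
  rewrite Rabs_mult in K; apply Rmult_le_reg_r in K; [|easy].
  generalize (cond_pos eps); lra.
Qed.

Lemma deriv_at_ext_loc f g t l : 0 <= t ->
  (exists d, 0 < d /\ forall s, 0 <= s -> Rabs (s - t) < d -> f s = g s) ->
  deriv_at f t l -> deriv_at g t l.
Proof.
intros Ht [d [Hd E]] D; rewrite deriv_at_eps in *; intros eps He.
destruct (D eps He) as [d' [Hd' K]]; exists (Rmin d d'); split.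
- now apply Rmin_glb_lt.
- intros s Hs L; assert (L1 := Rlt_le_trans _ _ _ L (Rmin_l _ _)).
  assert (L2 := Rlt_le_trans _ _ _ L (Rmin_r _ _)).
  rewrite <- (E s), <- (E t); auto.
  rewrite Rminus_diag, Rabs_R0; easy.
Qed.

Lemma deriv_at_ext f g t l :
  (forall s, f s = g s) -> deriv_at f t l -> deriv_at g t l.
Proof.
intros E D; rewrite deriv_at_eps in *; intros eps He.
destruct (D eps He) as [d [Hd K]]; exists d; split; [easy|].
intros; rewrite <- !E; auto.
Qed.

Lemma deriv_at_const c t : deriv_at (fun _ => c) t 0.
Proof.
apply deriv_at_eps; intros eps He; exists 1; split; [lra|].
intros s _ _; replace (c - c - 0 * (s - t)) with 0 by ring.
rewrite Rabs_R0; apply Rmult_le_pos; [lra|apply Rabs_pos].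
Qed.

Lemma deriv_at_plus f g t l m :
  deriv_at f t l -> deriv_at g t m -> deriv_at (fun s => f s + g s) t (l + m).
Proof.
rewrite !deriv_at_eps; intros D1 D2 eps He.
destruct (D1 (eps / 2)) as [d1 [H1 K1]]; [lra|].
destruct (D2 (eps / 2)) as [d2 [H2 K2]]; [lra|].
exists (Rmin d1 d2); split; [now apply Rmin_glb_lt|]; intros s Hs L.
specialize (K1 s Hs (Rlt_le_trans _ _ _ L (Rmin_l _ _))).
specialize (K2 s Hs (Rlt_le_trans _ _ _ L (Rmin_r _ _))).
replace (f s + g s - (f t + g t) - (l + m) * (s - t)) with
  ((f s - f t - l * (s - t)) + (g s - g t - m * (s - t))) by ring.
eapply Rle_trans; [apply Rabs_triang|lra].
Qed.

Lemma deriv_at_lim f t l : deriv_at f t l ->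
  filterlim f (halfline' t) (locally (f t)).
Proof.
intros D P [eps HP]; rewrite deriv_at_eps in D.
destruct (D 1 Rlt_0_1) as [d [Hd K]].
assert (He := cond_pos eps); assert (Hl := Rabs_pos l).
assert (Hm : 0 < Rmin d (eps / (2 + Rabs l))).
{ apply Rmin_glb_lt; [easy|apply Rdiv_lt_0_compat; lra]. }
exists (mkposreal _ Hm); intros s Hs N H0; apply HP.
change (Rabs (f s - f t) < eps).
change (Rabs (s - t) < Rmin d (eps / (2 + Rabs l))) in Hs.
specialize (K s H0 (Rlt_le_trans _ _ _ Hs (Rmin_l _ _))).
assert (L2 := Rlt_le_trans _ _ _ Hs (Rmin_r _ _)).
replace (f s - f t) with ((f s - f t - l * (s - t)) + l * (s - t)) by ring.
eapply Rle_lt_trans; [apply Rabs_triang|]; rewrite (Rabs_mult l).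
apply (Rmult_lt_compat_r (2 + Rabs l)) in L2; [|lra].
replace (eps / (2 + Rabs l) * (2 + Rabs l)) with (pos eps) in L2 by (field; lra).
generalize (Rabs_pos (s - t)); nra.
Qed.

Lemma deriv_at_mult f g t l m :
  deriv_at f t l -> deriv_at g t m ->
  deriv_at (fun s => f s * g s) t (l * g t + f t * m).
Proof.
intros D1 D2; unfold deriv_at.
apply filterlim_ext_loc with
  (fun s => plus (mult ((f s - f t) / (s - t)) (g s))
                 (mult (f t) ((g s - g t) / (s - t)))).
- exists (mkposreal 1 Rlt_0_1); intros s _ N _; unfold plus, mult; simpl.
  field; lra.
- assert (FF : Filter (halfline' t))
    by (apply within_filter, within_filter, locally_filter).
  eapply filterlim_comp_2; [| |apply (filterlim_plus (l * g t) (f t * m))].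
  + eapply filterlim_comp_2; [apply D1|apply (deriv_at_lim _ _ _ D2)|].
    apply (filterlim_mult l (g t)).
  + eapply filterlim_comp_2; [apply filterlim_const|apply D2|].
    apply (filterlim_mult (f t) m).
Qed.

Lemma deriv_at_scal c f t l :
  deriv_at f t l -> deriv_at (fun s => c * f s) t (c * l).
Proof.
intros D; replace (c * l) with (0 * f t + c * l) by ring.
apply (deriv_at_mult (fun _ => c)); [apply deriv_at_const|easy].
Qed.

Lemma deriv_at_opp f t l : deriv_at f t l -> deriv_at (fun s => - f s) t (- l).
Proof.
intros D; apply (deriv_at_ext (fun s => (-1) * f s)); [intros; ring|].
replace (- l) with ((-1) * l) by ring; now apply deriv_at_scal.
Qed.

Lemma deriv_at_minus f g t l m :
  deriv_at f t l -> deriv_at g t m -> deriv_at (fun s => f s - g s) t (l - m).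
Proof. intros D1 D2; apply deriv_at_plus, deriv_at_opp; easy. Qed.

Lemma deriv_at_sqr f t l :
  deriv_at f t l -> deriv_at (fun s => f s ^ 2) t (2 * f t * l).
Proof.
intros D; apply (deriv_at_ext (fun s => f s * f s)); [intros; ring|].
replace (2 * f t * l) with (l * f t + f t * l) by ring.
now apply deriv_at_mult.
Qed.

Lemma deriv_at_psum (f f' : R -> Z -> R) t n :
  (forall j, deriv_at (fun s => f s j) t (f' t j)) ->
  deriv_at (fun s => psum (f s) n) t (psum (f' t) n).
Proof.
intros D; induction n; simpl; [apply deriv_at_const|].
apply deriv_at_plus; [easy|apply deriv_at_plus; apply D].
Qed.

Lemma deriv_at_Dp dx (f : R -> Z -> R) f' t j :
  (forall j, deriv_at (fun s => f s j) t (f' j)) ->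
  deriv_at (fun s => Dp dx (f s) j) t (Dp dx f' j).
Proof.
intros D; unfold Dp, Rdiv; rewrite (Rmult_comm _ (/ dx)).
apply (deriv_at_ext (fun s => / dx * (f s (j + 1)%Z - f s j))); [intros; ring|].
apply deriv_at_scal, deriv_at_minus; apply D.
Qed.

Lemma deriv_at_Dm dx (f : R -> Z -> R) f' t j :
  (forall j, deriv_at (fun s => f s j) t (f' j)) ->
  deriv_at (fun s => Dm dx (f s) j) t (Dm dx f' j).
Proof.
intros D; unfold Dm, Rdiv; rewrite (Rmult_comm _ (/ dx)).
apply (deriv_at_ext (fun s => / dx * (f s j - f s (j - 1)%Z))); [intros; ring|].
apply deriv_at_scal, deriv_at_minus; apply D.
Qed.

Lemma is_derive_deriv_at f t l : is_derive f t l -> deriv_at f t l.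
Proof.
intros D; apply deriv_at_eps; intros eps He.
apply is_derive_Reals in D; destruct (D eps He) as [d K].
exists d; split; [apply cond_pos|]; intros s _ L.
destruct (Req_dec s t) as [->|N].
- rewrite !Rminus_diag, Rmult_0_r, Rminus_0_r, Rabs_R0; lra.
- specialize (K (s - t) ltac:(lra) L).
  replace (t + (s - t)) with s in K by ring.
  replace (f s - f t - l * (s - t)) with (((f s - f t) / (s - t) - l) * (s - t))
    by (field; lra).
  rewrite Rabs_mult; apply Rmult_le_compat_r; [apply Rabs_pos|lra].
Qed.

Lemma deriv_at_is_derive f t l : 0 < t -> deriv_at f t l -> is_derive f t l.
Proof.
intros Ht D; apply is_derive_Reals; intros eps He.
rewrite deriv_at_eps in D; destruct (D (eps / 2)) as [d [Hd K]]; [lra|].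
assert (Hm : 0 < Rmin d t) by now apply Rmin_glb_lt.
exists (mkposreal _ Hm); intros h N L; simpl in L.
assert (L1 := Rlt_le_trans _ _ _ L (Rmin_l _ _)).
assert (L2 := Rlt_le_trans _ _ _ L (Rmin_r _ _)).
apply Rabs_def2 in L2; specialize (K (t + h) ltac:(lra)).
replace (t + h - t) with h in K by ring; specialize (K L1).
assert (Hp : 0 < Rabs h) by now apply Rabs_pos_lt.
replace (f (t + h) - f t - l * h) with (((f (t + h) - f t) / h - l) * h) in K
  by (field; lra).
rewrite Rabs_mult in K; apply Rmult_le_reg_r in K; lra.
Qed.

Lemma mean_value_le f f' G G' s t : 0 <= s <= t ->
  (forall r, s <= r <= t -> deriv_at f r (f' r)) ->
  (forall r, is_derive G r (G' r)) ->
  (forall r, s <= r <= t -> f' r <= G' r) ->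
  f t - f s <= G t - G s.
Proof.
intros [H0 Hst] D DG Hle.
(* Nothing is known of [f] at negative times. Freezing it there gives the two-sided continuity at 0
   that the mean value theorem asks for. *)
pose (phi r := f (Rmax 0 r) - G (Rmax 0 r)).
destruct (MVT_gen phi s t (fun r => f' r - G' r)) as [c [Hc Ec]].
- rewrite Rmin_left, Rmax_right by easy; intros r Hr.
  apply (is_derive_ext_loc (fun r => f r - G r)).
  + assert (Hp : 0 < r) by lra.
    exists (mkposreal r Hp); intros z Hz; unfold phi.
    change (Rabs (z - r) < r) in Hz; apply Rabs_def2 in Hz.
    rewrite Rmax_right by lra; easy.
  + apply (is_derive_minus f G); [|apply DG].
    apply deriv_at_is_derive; [lra|apply D; lra].
- rewrite Rmin_left, Rmax_right by easy; intros r Hr.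
  assert (DD := deriv_at_minus _ _ _ _ _ (D r Hr) (is_derive_deriv_at _ _ _ (DG r))).
  apply deriv_at_lim in DD; intros eps He.
  destruct (DD (fun z => Rabs (z - (f r - G r)) < eps)) as [d Hd].
  { exists (mkposreal eps He); intros z Hz; exact Hz. }
  exists d; split; [apply cond_pos|]; intros z [[_ Nz] Hz].
  unfold Rdist, phi in *; simpl in *; unfold R_dist in *.
  rewrite (Rmax_right 0 r) by lra.
  destruct (Req_dec (Rmax 0 z) r) as [->|N].
  + rewrite Rminus_diag, Rabs_R0; easy.
  + apply Hd; [|easy|apply Rmax_l].
    change (Rabs (Rmax 0 z - r) < d); eapply Rle_lt_trans; [|exact Hz].
    unfold Rmax; destruct Rle_dec; [lra|]; unfold Rabs.
    destruct Rcase_abs; destruct Rcase_abs; lra.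
- rewrite Rmin_left, Rmax_right in Hc by easy.
  unfold phi in Ec; rewrite !Rmax_right in Ec by lra.
  specialize (Hle c Hc); nra.
Qed.

Lemma mean_value_bound f f' s t K : 0 <= s -> 0 <= t ->
  (forall r, Rmin s t <= r <= Rmax s t -> deriv_at f r (f' r)) ->
  (forall r, Rmin s t <= r <= Rmax s t -> Rabs (f' r) <= K) ->
  Rabs (f t - f s) <= K * Rabs (t - s).
Proof.
assert (W : forall s t, 0 <= s <= t ->
  (forall r, s <= r <= t -> deriv_at f r (f' r)) ->
  (forall r, s <= r <= t -> Rabs (f' r) <= K) ->
  Rabs (f t - f s) <= K * (t - s)).
{ clear; intros s t Hst D B.
  assert (DG : forall r, is_derive (fun r => K * r) r K).
  { intros r; auto_derive; [easy|ring]. }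
  assert (K1 := mean_value_le f f' (fun r => K * r) (fun _ => K) s t Hst D DG).
  assert (K2 := mean_value_le (fun r => - f r) (fun r => - f' r)
            (fun r => K * r) (fun _ => K) s t Hst
            (fun r Hr => deriv_at_opp _ _ _ (D r Hr)) DG).
  apply Rabs_le; split.
  - assert (forall r, s <= r <= t -> - f' r <= K); [|specialize (K2 H); lra].
    intros r Hr; specialize (B r Hr); apply Rabs_le_between in B; lra.
  - assert (forall r, s <= r <= t -> f' r <= K); [|specialize (K1 H); lra].
    intros r Hr; specialize (B r Hr); apply Rabs_le_between in B; lra. }
intros Hs Ht D B; destruct (Rle_dec s t) as [L|L].
- rewrite Rmin_left, Rmax_right in D, B by lra.
  rewrite (Rabs_pos_eq (t - s)) by lra; now apply W.
- rewrite Rmin_right, Rmax_left in D, B by lra.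
  rewrite Rabs_minus_sym, (Rabs_minus_sym t), (Rabs_pos_eq (s - t)) by lra.
  apply W; [lra|easy|easy].
Qed.

(* Iterating the integral inequality from a crude bound [B] gives the bound
   [A e^(Ct) + B (Ct)^k / k!] for every k. *)
Lemma gronwall_family (J : Type) (f f' : J -> R -> R) T C A B :
  0 <= C -> 0 <= A -> 0 <= B ->
  (forall a t, 0 <= t < T -> deriv_at (f a) t (f' a t)) ->
  (forall a, f a 0 <= A) ->
  (forall a t, 0 <= t < T -> f a t <= B) ->
  (forall t D, 0 <= t < T -> 0 <= D -> (forall a, f a t <= D) ->
     forall a, f' a t <= C * D) ->
  forall a t, 0 <= t < T -> f a t <= A * exp (C * t).
Proof.
intros HC HA HB Df Hf0 HfB Hf'.
assert (Pk : forall k t a, 0 <= t < T ->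
   f a t <= A * exp (C * t) + B * ((C * t) ^ k / INR (fact k))).
{ induction k as [|k IHk]; intros t a Ht.
  - simpl; assert (0 <= A * exp (C * t)) by
      (apply Rmult_le_pos; [easy|left; apply exp_pos]).
    specialize (HfB a t Ht); lra.
  (* [G] is the bound for [S k], and its derivative [G'] is [C] times the bound for [k]; one use of
     the hypothesis on [f'] thus advances the induction. *)
  - pose (G r := A * exp (C * r) + B * ((C * r) ^ S k / INR (fact (S k)))).
    pose (G' r := C * (A * exp (C * r) + B * ((C * r) ^ k / INR (fact k)))).
    assert (HI := INR_fact_neq_0 k).
    assert (HI' : INR (fact (S k)) = INR (S k) * INR (fact k)).
    { rewrite <- mult_INR; reflexivity. }
    assert (HS : INR (S k) <> 0) by (apply not_0_INR; lia).
    assert (DG : forall r, is_derive G r (G' r)).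
    { intros r; unfold G, G'; rewrite HI'; auto_derive; [easy|].
      change (match k with O => 1 | S _ => INR k + 1 end) with (INR (S k)).
      simpl pred.
      field; repeat split; easy. }
    assert (Q : f a t - f a 0 <= G t - G 0).
    { apply (mean_value_le (f a) (f' a) G G'); [lra| |easy|].
      - intros r Hr; apply Df; lra.
      - intros r Hr; unfold G'; apply Hf'; [lra| |intros; apply IHk; lra].
        apply Rplus_le_le_0_compat; apply Rmult_le_pos; try easy.
        + left; apply exp_pos.
        + apply Rle_div_r; [apply INR_fact_lt_0|rewrite Rmult_0_l].
          apply pow_le, Rmult_le_pos; lra. }
    unfold G in Q; rewrite !Rmult_0_r, exp_0 in Q.
    rewrite (pow_i (S k)) in Q by lia.
    specialize (Hf0 a); fold (G t) in Q |- *; unfold Rdiv in *; lra. }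
intros a t Ht.
apply (is_lim_seq_le (fun _ => f a t)
  (fun k => A * exp (C * t) + B * ((C * t) ^ k / INR (fact k)))
  (f a t) (A * exp (C * t))).
- intros k; now apply Pk.
- apply is_lim_seq_const.
- replace (Finite (A * exp (C * t))) with (Finite (A * exp (C * t) + B * 0))
    by (f_equal; ring).
  apply is_lim_seq_plus'; [apply is_lim_seq_const|].
  apply (is_lim_seq_scal_l _ B 0), is_lim_seq_Reals.
  intros eps He; destruct (cv_speed_pow_fact (C * t) eps He) as [n Hn].
  exists n; intros m Hm; apply Hn, Hm.
Qed.

Lemma gronwall_zero (J : Type) (f f' : J -> R -> R) T C B :
  0 <= C ->
  (forall a t, 0 <= t < T -> deriv_at (f a) t (f' a t)) ->
  (forall a, f a 0 = 0) ->
  (forall a t, 0 <= t < T -> Rabs (f a t) <= B) ->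
  (forall t D, 0 <= t < T -> 0 <= D -> (forall a, Rabs (f a t) <= D) ->
     forall a, Rabs (f' a t) <= C * D) ->
  forall a t, 0 <= t < T -> f a t = 0.
Proof.
intros HC Df Hf0 HfB Hf' a t Ht.
assert (HB : 0 <= B) by (specialize (HfB a t Ht); generalize (Rabs_pos (f a t)); lra).
(* The family is doubled by signs, so that the one-sided inequality controls absolute values. *)
pose (sg (b : bool) := if b then 1 else -1).
assert (G : forall (p : J * bool) s, 0 <= s < T ->
   sg (snd p) * f (fst p) s <= 0 * exp (C * s)).
{ apply (gronwall_family (J * bool) (fun p s => sg (snd p) * f (fst p) s)
    (fun p s => sg (snd p) * f' (fst p) s) T C 0 B); try lra.
  - intros [b s] r Hr; apply deriv_at_scal; auto.
  - intros [b s]; simpl; rewrite Hf0; lra.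
  - intros [b s] r Hr; simpl; specialize (HfB b r Hr).
    apply Rabs_le_between in HfB; unfold sg; destruct s; lra.
  - intros r D Hr HD HfD [b s]; simpl.
    assert (A : forall b, Rabs (f b r) <= D).
    { intros c; generalize (HfD (c, true)) (HfD (c, false)); unfold sg; simpl.
      intros; apply Rabs_le; lra. }
    specialize (Hf' r D Hr HD A b); apply Rabs_le_between in Hf'.
    unfold sg; destruct s; lra. }
generalize (G (a, true) t Ht) (G (a, false) t Ht); unfold sg; simpl; lra.
Qed.

(** * Ordinary differential equations in spaces normed by finite functionals *)

(* A norm that is a supremum of finite linear functionals of the coordinates is
   lower semicontinuous for pointwise convergence, and mean value inequalities
   for it reduce to scalar ones; no completeness of the space is needed. *)
Section AbstractODE.

Variable I : Type.

(** [fl_ext] closes the class under pointwise equality, so that difference quotients can be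
    recognised as functionals after rearrangement. *)
Inductive finlin : ((I -> R) -> R) -> Prop :=
| fl_zero : finlin (fun _ => 0)
| fl_ev i : finlin (fun x => x i)
| fl_scal c f : finlin f -> finlin (fun x => c * f x)
| fl_plus f g : finlin f -> finlin g -> finlin (fun x => f x + g x)
| fl_ext f g : (forall x, f x = g x) -> finlin f -> finlin g.

Lemma finlin_comb w : finlin w -> forall a b x y,
  w (fun i => a * x i + b * y i) = a * w x + b * w y.
Proof.
induction 1; intros a b x y.
- ring.
- ring.
- rewrite IHfinlin; ring.
- rewrite IHfinlin1, IHfinlin2; ring.
- rewrite <- !H; apply IHfinlin.
Qed.

Lemma finlin_pointwise w : finlin w -> forall x y,
  (forall i, x i = y i) -> w x = w y.
Proof.
induction 1; intros x y E; auto.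
- now rewrite (IHfinlin x y).
- now rewrite (IHfinlin1 x y), (IHfinlin2 x y).
- rewrite <- !H; auto.
Qed.

Lemma finlin_minus w : finlin w -> forall x y,
  w (fun i => x i - y i) = w x - w y.
Proof.
intros F x y.
rewrite (finlin_pointwise w F _ (fun i => 1 * x i + (-1) * y i)) by (intros; ring).
rewrite finlin_comb by easy; ring.
Qed.

Lemma finlin_limit w : finlin w -> forall (x : nat -> I -> R) (y : I -> R),
  (forall i, is_lim_seq (fun n => x n i) (y i)) ->
  is_lim_seq (fun n => w (x n)) (w y).
Proof.
induction 1; intros x y L.
- apply is_lim_seq_const.
- apply L.
- apply (is_lim_seq_scal_l _ c (Finite (f y))); auto.
- apply is_lim_seq_plus'; auto.
- rewrite <- H; apply is_lim_seq_ext with (fun n => f (x n)); auto.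
Qed.

Lemma finlin_deriv w : finlin w -> forall (x : R -> I -> R) x' t,
  (forall i, deriv_at (fun s => x s i) t (x' i)) ->
  deriv_at (fun s => w (x s)) t (w x').
Proof.
induction 1; intros x x' t D.
- apply deriv_at_const.
- apply D.
- apply deriv_at_scal; auto.
- apply deriv_at_plus; auto.
- rewrite <- H; apply deriv_at_ext with (fun s => f (x s)); auto.
Qed.

Lemma finlin_RInt w : finlin w -> forall (x : R -> I -> R) (v : I -> R) a b,
  (forall i, is_RInt (fun s => x s i) a b (v i)) ->
  is_RInt (fun s => w (x s)) a b (w v).
Proof.
induction 1; intros x v a b D.
- assert (Q := is_RInt_const (V := R_NormedModule) a b 0).
  now rewrite (scal_zero_r (V := R_NormedModule)) in Q.
- apply D.
- apply (is_RInt_scal (fun s => f (x s)) a b c); auto.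
- apply (is_RInt_plus (V := R_NormedModule)); auto.
- rewrite <- H; apply is_RInt_ext with (fun s => f (x s)); auto.
Qed.

Variable W : ((I -> R) -> R) -> Prop.

Definition bnd (x : I -> R) (M : R) : Prop := forall w, W w -> Rabs (w x) <= M.

Hypothesis W_fin : forall w, W w -> finlin w.
Hypothesis W_ev :
  forall i, exists c, 0 <= c /\ forall x M, bnd x M -> Rabs (x i) <= c * M.

Lemma bnd_ext x y M : (forall i, x i = y i) -> bnd x M -> bnd y M.
Proof.
intros E B w Hw; rewrite <- (finlin_pointwise w (W_fin w Hw) x y E); auto.
Qed.

Lemma bnd_weak x M M' : M <= M' -> bnd x M -> bnd x M'.
Proof. intros L B w Hw; specialize (B w Hw); lra. Qed.

Lemma bnd_plus x y M M' : bnd x M -> bnd y M' ->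
  bnd (fun i => x i + y i) (M + M').
Proof.
intros B B' w Hw.
rewrite (finlin_pointwise w (W_fin w Hw) _ (fun i => 1 * x i + 1 * y i))
  by (intros; ring).
rewrite finlin_comb by auto; rewrite !Rmult_1_l.
specialize (B w Hw); specialize (B' w Hw).
eapply Rle_trans; [apply Rabs_triang|lra].
Qed.

Lemma bnd_scal c x M : bnd x M -> bnd (fun i => c * x i) (Rabs c * M).
Proof.
intros B w Hw.
rewrite (finlin_pointwise w (W_fin w Hw) _ (fun i => c * x i + 0 * x i))
  by (intros; ring).
rewrite finlin_comb by auto; rewrite Rmult_0_l, Rplus_0_r, Rabs_mult.
apply Rmult_le_compat_l; [apply Rabs_pos|auto].
Qed.

Lemma bnd_minus x y M M' : bnd x M -> bnd y M' ->
  bnd (fun i => x i - y i) (M + M').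
Proof.
intros B B'; apply (bnd_ext (fun i => x i + (-1) * y i)); [intros; ring|].
apply bnd_plus; [easy|].
replace M' with (Rabs (-1) * M'); [now apply bnd_scal|].
rewrite Rabs_left by lra; ring.
Qed.

Lemma bnd_limit (x : nat -> I -> R) (y : I -> R) M :
  (forall i, is_lim_seq (fun n => x n i) (y i)) ->
  (forall n, bnd (x n) M) -> bnd y M.
Proof.
intros L B w Hw.
apply (is_lim_seq_le (fun n => Rabs (w (x n))) (fun _ => M) (Rabs (w y)) M).
- intros n; now apply B.
- apply (is_lim_seq_abs _ (w y)), finlin_limit; auto.
- apply is_lim_seq_const.
Qed.

Variable F : (I -> R) -> I -> R.
Hypothesis F_bnd :
  forall M, exists K, 0 <= K /\ forall x, bnd x M -> bnd (F x) K.
Hypothesis F_lip : forall M, exists L, 0 <= L /\ forall x y d,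
  0 <= d -> bnd x M -> bnd y M -> bnd (fun i => x i - y i) d ->
  bnd (fun i => F x i - F y i) (L * d).

(** Differentiability is asked for coordinate by coordinate only. The uniform bound makes [F]
    Lipschitz along the solution, and [sol_taylor] deduces from it a derivative in norm. *)
Definition sol (x : R -> I -> R) (T : R) : Prop :=
  (exists M, forall t, 0 <= t < T -> bnd (x t) M) /\
  (forall t, 0 <= t < T -> forall i, deriv_at (fun s => x s i) t (F (x t) i)).

Lemma bnd_deriv (x : R -> I -> R) (x' : R -> I -> R) s t K : 0 <= s -> 0 <= t ->
  (forall r, Rmin s t <= r <= Rmax s t ->
     (forall i, deriv_at (fun r => x r i) r (x' r i)) /\ bnd (x' r) K) ->
  bnd (fun i => x t i - x s i) (K * Rabs (t - s)).
Proof.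
intros Hs Ht D w Hw; rewrite finlin_minus by auto.
apply (mean_value_bound (fun r => w (x r)) (fun r => w (x' r))); auto.
- intros r Hr; apply finlin_deriv; [auto|now apply D].
- intros r Hr; apply D; easy.
Qed.

Lemma sol_unique x y T : sol x T -> sol y T -> (forall i, x 0 i = y 0 i) ->
  forall t, 0 <= t < T -> forall i, x t i = y t i.
Proof.
intros [[M BM] Dx] [[M' BM'] Dy] E0 t Ht i.
pose (M1 := Rmax M M').
assert (BX : forall t, 0 <= t < T -> bnd (x t) M1).
{ intros r Hr; apply (bnd_weak _ M); [apply Rmax_l|auto]. }
assert (BY : forall t, 0 <= t < T -> bnd (y t) M1).
{ intros r Hr; apply (bnd_weak _ M'); [apply Rmax_r|auto]. }
destruct (F_lip M1) as [L [HL HF]].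
(* The family is indexed by [W] itself: the derivative of each scalar difference is at most [L]
   times the supremum over all functionals. *)
assert (G : forall (a : {w | W w}) t, 0 <= t < T ->
  proj1_sig a (fun i => x t i - y t i) = 0).
{ apply (gronwall_zero _ _ (fun a t => proj1_sig a (fun i => F (x t) i - F (y t) i))
    T L (M1 + M1) HL).
  - intros [w Hw] r Hr; simpl; apply finlin_deriv; [auto|].
    intros k; apply deriv_at_minus; auto.
  - intros [w Hw]; simpl; rewrite finlin_minus by auto.
    rewrite (finlin_pointwise w (W_fin w Hw) _ _ E0); ring.
  - intros [w Hw] r Hr; now apply (bnd_minus _ _ _ _ (BX r Hr) (BY r Hr) w).
  - intros r D Hr HD HfD [w Hw]; apply (HF _ _ _ HD (BX r Hr) (BY r Hr)); [|easy].
    intros v Hv; apply (HfD (exist _ v Hv)). }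
assert (B : bnd (fun i => x t i - y t i) 0).
{ intros v Hv; rewrite (G (exist _ v Hv) t Ht : v _ = 0), Rabs_R0; lra. }
destruct (W_ev i) as [c [_ Hc]]; specialize (Hc _ _ B); cbv beta in Hc.
rewrite Rmult_0_r in Hc; generalize (Rabs_pos (x t i - y t i)); intros.
assert (x t i - y t i = 0); [|lra].
destruct (Req_dec (x t i - y t i) 0) as [|N]; [easy|].
apply Rabs_pos_lt in N; lra.
Qed.

Lemma sol_restrict x T T' : T' <= T -> sol x T -> sol x T'.
Proof.
intros L [[M B] D]; split; [exists M|]; intros; [apply B|apply D]; lra.
Qed.

Lemma lipschitz_continuous (f : R -> R) tau K t : Rabs t < tau ->
  (forall s, Rabs s < tau -> Rabs (f s - f t) <= K * Rabs (s - t)) ->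
  continuous f t.
Proof.
intros Ht HK P [eps HP].
assert (H1 : 0 < Rmin (tau - Rabs t) (eps / (Rabs K + 1))).
{ apply Rmin_glb_lt; [lra|]; apply Rdiv_lt_0_compat; [apply cond_pos|].
  generalize (Rabs_pos K); lra. }
exists (mkposreal _ H1); intros s Hs; apply HP.
change (Rabs (s - t) < Rmin (tau - Rabs t) (eps / (Rabs K + 1))) in Hs.
change (Rabs (f s - f t) < eps).
assert (L1 := Rlt_le_trans _ _ _ Hs (Rmin_l _ _)).
assert (L2 := Rlt_le_trans _ _ _ Hs (Rmin_r _ _)).
assert (Hk := Rabs_pos K); assert (He := cond_pos eps).
apply (Rmult_lt_compat_r (Rabs K + 1)) in L2; [|lra].
replace (eps / (Rabs K + 1) * (Rabs K + 1)) with (pos eps) in L2 by (field; lra).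
assert (Rabs s < tau).
{ replace s with ((s - t) + t) by ring.
  eapply Rle_lt_trans; [apply Rabs_triang|lra]. }
specialize (HK s H); generalize (Rle_abs K) (Rabs_pos (s - t)); intros; nra.
Qed.

(** * Picard iteration on a short symmetric time interval *)

Section LocalExistence.

Variables (M K L tau : R) (x0 : I -> R).
Hypothesis HK : 0 <= K.
Hypothesis HL : 0 <= L.
Hypothesis Htau : 0 < tau.
Hypothesis HtK : tau * K <= 1.
Hypothesis HtL : tau * L <= / 2.
Hypothesis FK : forall x, bnd x (M + 1) -> bnd (F x) K.
Hypothesis FL : forall x y d, 0 <= d -> bnd x (M + 1) -> bnd y (M + 1) ->
  bnd (fun i => x i - y i) d -> bnd (fun i => F x i - F y i) (L * d).
Hypothesis Hx0 : bnd x0 M.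

(** The Lipschitz condition in time makes [F] along [y] continuous in each coordinate, hence
    integrable. On the symmetric interval [(-tau, tau)] the time 0 is interior, and the integral can
    be differentiated there by the two-sided theorem. [HtK] keeps Picard iterates within the bound
    [M + 1], and [HtL] makes the map a contraction of ratio 1/2. *)
Definition admissible (y : R -> I -> R) : Prop :=
  (forall t, Rabs t < tau -> bnd (y t) (M + 1)) /\
  (forall s t, Rabs s < tau -> Rabs t < tau ->
     bnd (fun i => y t i - y s i) (K * Rabs (t - s))).

Definition picard (y : R -> I -> R) (t : R) (i : I) : R :=
  x0 i + RInt (fun s => F (y s) i) 0 t.

Lemma between_abs a b r : Rabs a < tau -> Rabs b < tau ->
  Rmin a b <= r <= Rmax a b -> Rabs r < tau.
Proof.
intros Ha Hb; apply Rabs_def2 in Ha; apply Rabs_def2 in Hb.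
unfold Rmin, Rmax; destruct Rle_dec; intros; apply Rabs_def1; lra.
Qed.

Lemma admissible_F_lip y : admissible y -> forall s t,
  Rabs s < tau -> Rabs t < tau ->
  bnd (fun i => F (y t) i - F (y s) i) (L * (K * Rabs (t - s))).
Proof.
intros [A1 A2] s t Hs Ht; apply FL; auto.
apply Rmult_le_pos; [easy|apply Rabs_pos].
Qed.

Lemma admissible_cont y : admissible y -> forall i t, Rabs t < tau ->
  continuous (fun s => F (y s) i) t.
Proof.
intros A i t Ht; destruct (W_ev i) as [c [Hc Hi]].
apply (lipschitz_continuous _ tau (c * (L * K))); [easy|]; intros s Hs.
replace (c * (L * K) * Rabs (s - t)) with (c * (L * (K * Rabs (s - t)))) by ring.
apply (Hi _ _ (admissible_F_lip y A t s Ht Hs)).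
Qed.

Lemma admissible_RInt y : admissible y -> forall i s t,
  Rabs s < tau -> Rabs t < tau ->
  is_RInt (fun r => F (y r) i) s t (RInt (fun r => F (y r) i) s t).
Proof.
intros A i s t Hs Ht; apply (RInt_correct (V := R_CompleteNormedModule)).
apply (ex_RInt_continuous (V := R_CompleteNormedModule)); intros z Hz.
apply admissible_cont; [easy|apply (between_abs s t); easy].
Qed.

Lemma zero_lt_tau : Rabs 0 < tau.
Proof. now rewrite Rabs_R0. Qed.

Lemma picard_incr y : admissible y -> forall i s t,
  Rabs s < tau -> Rabs t < tau ->
  is_RInt (fun r => F (y r) i) s t (picard y t i - picard y s i).
Proof.
intros A i s t Hs Ht; unfold picard.
replace (x0 i + RInt (fun s => F (y s) i) 0 t
         - (x0 i + RInt (fun s => F (y s) i) 0 s))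
  with (plus (opp (RInt (fun s => F (y s) i) 0 s)) (RInt (fun s => F (y s) i) 0 t))
  by (unfold plus, opp; simpl; ring).
apply (is_RInt_Chasles (V := R_NormedModule) _ s 0 t).
- apply (is_RInt_swap (V := R_NormedModule)), admissible_RInt;
    auto using zero_lt_tau.
- apply admissible_RInt; auto using zero_lt_tau.
Qed.

Lemma picard_0 y i : picard y 0 i = x0 i.
Proof.
unfold picard; rewrite (RInt_point (V := R_CompleteNormedModule)).
unfold zero; simpl; ring.
Qed.

Lemma bnd_RInt (f : R -> I -> R) (v : I -> R) s t C :
  (forall i, is_RInt (fun r => f r i) s t (v i)) ->
  (forall r, Rmin s t <= r <= Rmax s t -> bnd (f r) C) ->
  bnd v (C * Rabs (t - s)).
Proof.
intros HR HC w Hw; rewrite (Rmult_comm C).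
apply (norm_RInt_le_const_abs (V := R_NormedModule) (fun r => w (f r)) s t (w v)).
- intros r Hr; now apply HC.
- apply finlin_RInt; auto.
Qed.

Lemma picard_admissible y : admissible y -> admissible (picard y).
Proof.
intros A; assert (Inc : forall s t, Rabs s < tau -> Rabs t < tau ->
     bnd (fun i => picard y t i - picard y s i) (K * Rabs (t - s))).
{ intros s t Hs Ht; apply (bnd_RInt (fun r => F (y r))).
  - intros i; now apply picard_incr.
  - intros r Hr; apply FK, A, (between_abs s t); easy. }
split; [|easy]; intros t Ht.
apply (bnd_ext (fun i => x0 i + (picard y t i - picard y 0 i))).
- intros i; rewrite picard_0; ring.
- apply bnd_plus; [easy|]; apply (bnd_weak _ (K * Rabs (t - 0))).
  + rewrite Rminus_0_r; generalize (Rabs_pos t); nra.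
  + apply Inc; auto using zero_lt_tau.
Qed.

Lemma picard_contract y z C : 0 <= C -> admissible y -> admissible z ->
  (forall t, Rabs t < tau -> bnd (fun i => y t i - z t i) C) ->
  forall t, Rabs t < tau ->
    bnd (fun i => picard y t i - picard z t i) (C * / 2).
Proof.
intros HC A A' B t Ht.
apply (bnd_weak _ (L * C * Rabs (t - 0))).
- rewrite Rminus_0_r; generalize (Rabs_pos t); intros.
  assert (L * Rabs t <= / 2) by nra; nra.
- apply (bnd_RInt (fun r i => F (y r) i - F (z r) i)).
  + intros i; apply (is_RInt_ext (V := R_NormedModule)
      (fun r => minus (F (y r) i) (F (z r) i))); [easy|].
    replace (picard y t i - picard z t i) with
      (minus (picard y t i - picard y 0 i) (picard z t i - picard z 0 i))
      by (rewrite !picard_0; unfold minus, plus, opp; simpl; ring).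
    apply (is_RInt_minus (V := R_NormedModule)); apply picard_incr;
      auto using zero_lt_tau.
  + intros r Hr; assert (Rabs r < tau)
      by (apply (between_abs 0 t); auto using zero_lt_tau).
    apply FL; auto; [apply A|apply A']; easy.
Qed.

Fixpoint iterates (n : nat) : R -> I -> R :=
  match n with O => fun _ => x0 | S k => picard (iterates k) end.

Lemma iterates_admissible n : admissible (iterates n).
Proof.
induction n; simpl; [|now apply picard_admissible].
split.
- intros t _; apply (bnd_weak _ M); [lra|easy].
- intros s t _ _ w Hw; rewrite finlin_minus, Rminus_diag, Rabs_R0 by auto.
  apply Rmult_le_pos; [easy|apply Rabs_pos].
Qed.

Lemma iterates_step n t : Rabs t < tau ->
  bnd (fun i => iterates (S n) t i - iterates n t i) ((/ 2) ^ n).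
Proof.
revert t; induction n as [|n IHn]; intros t Ht.
- apply (bnd_weak _ (K * Rabs (t - 0))).
  + simpl; rewrite Rminus_0_r; generalize (Rabs_pos t); nra.
  + apply (bnd_ext (fun i => iterates 1 t i - iterates 1 0 i)).
    * intros i; simpl; rewrite picard_0; ring.
    * apply (iterates_admissible 1); auto using zero_lt_tau.
- change ((/ 2) ^ S n) with (/ 2 * (/ 2) ^ n); rewrite Rmult_comm.
  apply (picard_contract (iterates (S n)) (iterates n));
    auto using iterates_admissible.
  apply pow_le; lra.
Qed.

(** The constant is the exact sum of [(/ 2) ^ m] over [n <= m < n + k], so that the constants match
    by an identity in the induction. *)
Lemma iterates_diff n k t : Rabs t < tau ->
  bnd (fun i => iterates (n + k) t i - iterates n t i)
      (2 * (/ 2) ^ n * (1 - (/ 2) ^ k)).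
Proof.
intros Ht; induction k as [|k IHk].
- rewrite Nat.add_0_r; intros w Hw.
  rewrite finlin_minus, Rminus_diag, Rabs_R0 by auto; simpl; lra.
- apply (bnd_ext (fun i =>
    (iterates (S (n + k)) t i - iterates (n + k) t i)
    + (iterates (n + k) t i - iterates n t i))).
  + intros i; replace (n + S k)%nat with (S (n + k)) by lia; ring.
  + eapply bnd_weak; [|apply bnd_plus; [now apply iterates_step|apply IHk]].
    rewrite pow_add; simpl; right; field.
Qed.

Definition limit_sol (t : R) (i : I) : R := real (Lim_seq (fun n => iterates n t i)).

Lemma iterates_lim t i : Rabs t < tau ->
  is_lim_seq (fun n => iterates n t i) (limit_sol t i).
Proof.
intros Ht; apply Lim_seq_correct', ex_lim_seq_cauchy_corr.
destruct (W_ev i) as [c [Hc Hi]]; intros eps.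
assert (P : forall n k, Rabs (iterates (n + k) t i - iterates n t i)
             <= c * 2 * (/ 2) ^ n).
{ intros n k; specialize (Hi _ _ (iterates_diff n k t Ht)); cbv beta in Hi.
  assert (0 < (/ 2) ^ n) by (apply pow_lt; lra).
  assert (0 < (/ 2) ^ k) by (apply pow_lt; lra).
  assert (0 <= c * 2 * (/ 2) ^ n) by (apply Rmult_le_pos; lra); nra. }
assert (Q : is_lim_seq (fun n => c * 2 * (/ 2) ^ n) 0).
{ replace (Finite 0) with (Rbar_mult (c * 2) 0) by (simpl; f_equal; ring).
  apply (is_lim_seq_scal_l _ (c * 2) 0), is_lim_seq_geom.
  rewrite Rabs_pos_eq; lra. }
apply is_lim_seq_spec in Q; destruct (Q (pos_div_2 eps)) as [N HN].
exists N; intros n m Hn Hm.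
assert (E1 := P N (n - N)%nat); assert (E2 := P N (m - N)%nat).
replace (N + (n - N))%nat with n in E1 by lia.
replace (N + (m - N))%nat with m in E2 by lia.
specialize (HN N (le_n N)); simpl in HN; rewrite Rminus_0_r in HN.
apply Rabs_def2 in HN.
apply Rabs_le_between in E1; apply Rabs_le_between in E2; apply Rabs_def1; lra.
Qed.

Lemma limit_admissible : admissible limit_sol.
Proof.
split.
- intros t Ht; apply (bnd_limit (fun n => iterates n t)).
  + intros i; now apply iterates_lim.
  + intros n; now apply iterates_admissible.
- intros s t Hs Ht; apply (bnd_limit (fun n i => iterates n t i - iterates n s i)).
  + intros i; apply is_lim_seq_minus'; now apply iterates_lim.
  + intros n; now apply iterates_admissible.
Qed.

Lemma limit_diff n t : Rabs t < tau ->
  bnd (fun i => limit_sol t i - iterates n t i) (2 * (/ 2) ^ n).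
Proof.
intros Ht; apply (bnd_limit (fun k i => iterates (n + k) t i - iterates n t i)).
- intros i; apply is_lim_seq_minus'; [|apply is_lim_seq_const].
  apply (is_lim_seq_ext (fun k => iterates (k + n) t i));
    [intros; f_equal; lia|].
  apply (is_lim_seq_incr_n (fun k => iterates k t i)); now apply iterates_lim.
- intros k; eapply bnd_weak; [|now apply iterates_diff].
  assert (0 < (/ 2) ^ n) by (apply pow_lt; lra).
  assert (0 < (/ 2) ^ k) by (apply pow_lt; lra); nra.
Qed.

Lemma limit_fixpoint t i : Rabs t < tau -> limit_sol t i = picard limit_sol t i.
Proof.
intros Ht; destruct (W_ev i) as [c [Hc Hi]].
assert (Z : is_lim_seq (fun n => c * (2 * (/ 2) ^ n * / 2)) 0).
{ replace (Finite 0) with (Finite (c * (2 * 0 * / 2))) by (f_equal; ring).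
  repeat apply is_lim_seq_mult'; try apply is_lim_seq_const.
  apply is_lim_seq_geom; rewrite Rabs_pos_eq; lra. }
assert (Q : is_lim_seq (fun n => iterates (S n) t i) (picard limit_sol t i)).
{ apply (is_lim_seq_le_le (fun n => picard limit_sol t i - c * (2 * (/ 2) ^ n * / 2))
    _ (fun n => picard limit_sol t i + c * (2 * (/ 2) ^ n * / 2))).
  - intros n; assert (P := Hi _ _ (picard_contract limit_sol (iterates n)
       (2 * (/ 2) ^ n) ltac:(apply Rmult_le_pos; [lra|apply pow_le; lra])
       limit_admissible (iterates_admissible n) (limit_diff n) t Ht)).
    simpl iterates; cbv beta in P; apply Rabs_le_between in P; lra.
  - rewrite <- (Rminus_0_r (picard limit_sol t i)) at 1.
    apply is_lim_seq_minus'; [apply is_lim_seq_const|exact Z].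
  - rewrite <- (Rplus_0_r (picard limit_sol t i)) at 1.
    apply is_lim_seq_plus'; [apply is_lim_seq_const|exact Z]. }
assert (Q' := proj1 (is_lim_seq_incr_1 _ _) (iterates_lim t i Ht)).
apply is_lim_seq_unique in Q; apply is_lim_seq_unique in Q'.
rewrite Q in Q'; apply (f_equal real) in Q'; simpl in Q'; now symmetry.
Qed.

Lemma limit_is_sol : sol limit_sol tau /\ forall i, limit_sol 0 i = x0 i.
Proof.
split; [split|].
- exists (M + 1); intros t Ht; apply limit_admissible, Rabs_def1; lra.
- intros t Ht i; assert (Ha : Rabs t < tau) by (apply Rabs_def1; lra).
  apply is_derive_deriv_at.
  assert (Hp : 0 < tau - Rabs t) by lra.
  assert (Nb : forall s, ball t (mkposreal _ Hp) s -> Rabs s < tau).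
  { intros s Hs; change (Rabs (s - t) < tau - Rabs t) in Hs.
    replace s with ((s - t) + t) by ring.
    eapply Rle_lt_trans; [apply Rabs_triang|lra]. }
  apply (is_derive_ext_loc (fun s => picard limit_sol s i)).
  + exists (mkposreal _ Hp); intros s Hs; symmetry; apply limit_fixpoint; auto.
  + unfold picard.
    replace (F (limit_sol t) i) with (plus 0 (F (limit_sol t) i))
      by (unfold plus; simpl; ring).
    apply (is_derive_plus (fun _ => x0 i)); [apply (is_derive_const (x0 i))|].
    apply (is_derive_RInt (V := R_NormedModule) (fun s => F (limit_sol s) i) _ 0).
    * exists (mkposreal _ Hp); intros s Hs.
      apply admissible_RInt; auto using limit_admissible, zero_lt_tau.
    * apply admissible_cont; auto using limit_admissible.
- intros i; rewrite limit_fixpoint by apply zero_lt_tau; apply picard_0.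
Qed.

End LocalExistence.

(** [tau] is chosen before [x0] and depends on [M] only; this lets [sol_up_to] advance by steps of
    fixed length. *)
Lemma local_existence M : exists tau, 0 < tau /\ forall x0, bnd x0 M ->
  exists x, sol x tau /\ forall i, x 0 i = x0 i.
Proof.
destruct (F_bnd (M + 1)) as [K [HK FK]]; destruct (F_lip (M + 1)) as [L [HL FL]].
pose (tau := Rmin (/ (K + 1)) (/ (2 * (L + 1)))).
assert (P1 : 0 < / (K + 1)) by (apply Rinv_0_lt_compat; lra).
assert (P2 : 0 < / (2 * (L + 1))) by (apply Rinv_0_lt_compat; lra).
assert (H0 : 0 < tau) by now apply Rmin_glb_lt.
exists tau; split; [easy|]; intros x0 Hx0.
exists (limit_sol x0); apply (limit_is_sol M K L tau x0); auto.
- assert (tau <= / (K + 1)) by apply Rmin_l.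
  assert (/ (K + 1) * (K + 1) = 1) by (field; lra); nra.
- assert (tau <= / (2 * (L + 1))) by apply Rmin_r.
  assert (/ (2 * (L + 1)) * (L + 1) = / 2) by (field; lra); nra.
Qed.

(** The restart time [c] lies strictly inside, since a solution on [[0, T)] says nothing at [T]. At
    [c] the left and right difference quotients come from [x] and [y], and they have the same limit
    because [F] is evaluated at the same point. *)
Lemma sol_extend x y T c tau : 0 < c < T -> 0 < tau -> sol x T -> sol y tau ->
  (forall i, y 0 i = x c i) ->
  exists z, sol z (c + tau) /\ forall i, z 0 i = x 0 i.
Proof.
intros Hc Htau [[M B] D] [[M' B'] D'] E.
exists (fun t => if Rlt_dec t c then x t else y (t - c)); split; [split|].
- exists (Rmax M M'); intros t Ht; destruct Rlt_dec.
  + apply (bnd_weak _ M); [apply Rmax_l|apply B; lra].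
  + apply (bnd_weak _ M'); [apply Rmax_r|apply B'; lra].
- intros t Ht i.
  destruct (Rtotal_order t c) as [L|[->|L]].
  + apply (deriv_at_ext_loc (fun s => x s i)); [lra| |].
    * exists (c - t); split; [lra|]; intros s Hs Hst; apply Rabs_def2 in Hst.
      destruct Rlt_dec; [easy|lra].
    * destruct Rlt_dec; [apply D; lra|lra].
  + destruct (Rlt_dec c c) as [|_]; [lra|]; rewrite Rminus_diag.
    assert (D1 := D c ltac:(lra) i); assert (D2 := D' 0 ltac:(lra) i).
    assert (Ey : y 0 = x c) by now apply functional_extensionality.
    rewrite Ey in D2 |- *.
    rewrite deriv_at_eps in *; intros eps He.
    destruct (D1 eps He) as [d1 [Hd1 K1]]; destruct (D2 eps He) as [d2 [Hd2 K2]].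
    exists (Rmin d1 d2); split; [now apply Rmin_glb_lt|]; intros s Hs Ls.
    destruct (Rlt_dec c c) as [|_]; [lra|]; rewrite Rminus_diag, E.
    destruct Rlt_dec.
    * apply K1; [easy|exact (Rlt_le_trans _ _ _ Ls (Rmin_l _ _))].
    * assert (K3 := K2 (s - c) ltac:(lra)); rewrite Rminus_0_r, E in K3.
      apply K3, (Rlt_le_trans _ _ _ Ls (Rmin_r _ _)).
  + destruct Rlt_dec; [lra|].
    apply (deriv_at_ext_loc (fun s => y (s - c) i)); [lra| |].
    * exists (t - c); split; [lra|]; intros s Hs Hst; apply Rabs_def2 in Hst.
      destruct Rlt_dec; [lra|easy].
    * assert (D2 := D' (t - c) ltac:(lra) i).
      rewrite deriv_at_eps in *; intros eps He.
      destruct (D2 eps He) as [d2 [Hd2 K2]].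
      exists (Rmin d2 (t - c)); split; [apply Rmin_glb_lt; lra|]; intros s Hs Ls.
      assert (L1 := Rlt_le_trans _ _ _ Ls (Rmin_l _ _)).
      assert (L2 := Rlt_le_trans _ _ _ Ls (Rmin_r _ _)).
      apply Rabs_def2 in L2; specialize (K2 (s - c) ltac:(lra)).
      replace (s - c - (t - c)) with (s - t) in K2 by ring; auto.
- intros i; destruct Rlt_dec; [easy|lra].
Qed.

Lemma sol_up_to x0 T Mb : 0 < T -> bnd x0 Mb ->
  (forall x T', T' <= T -> sol x T' -> (forall i, x 0 i = x0 i) ->
     forall t, 0 <= t < T' -> bnd (x t) Mb) ->
  exists x, sol x T /\ forall i, x 0 i = x0 i.
Proof.
intros HT B0 AP; destruct (local_existence Mb) as [tau [Ht LE]].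
assert (P : forall k, exists x, sol x (Rmin T (tau + INR k * (tau / 2)))
                     /\ forall i, x 0 i = x0 i).
{ induction k as [|k [x [Sx Ex]]].
  - destruct (LE x0 B0) as [x [Sx Ex]]; exists x; split; [|easy].
    apply (sol_restrict x tau); [|easy]; simpl; rewrite Rmult_0_l, Rplus_0_r.
    apply Rmin_r.
  - assert (Hk : 0 <= INR k * (tau / 2)) by (apply Rmult_le_pos; [apply pos_INR|lra]).
    destruct (Rle_dec T (tau + INR k * (tau / 2))) as [L|L].
    + exists x; split; [|easy].
      apply (sol_restrict x (Rmin T (tau + INR k * (tau / 2)))); [|easy].
      rewrite (Rmin_left T) at 1; [|rewrite S_INR; lra].
      rewrite Rmin_left; lra.
    + rewrite Rmin_right in Sx by lra.
      (* Restarting [tau / 2] before the end keeps [c] inside the interval and still gains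
         [tau / 2]. *)
      pose (c := tau / 2 + INR k * (tau / 2)).
      assert (Bc : bnd (x c) Mb).
      { apply (AP x (tau + INR k * (tau / 2))); auto; [lra|unfold c; lra]. }
      destruct (LE (x c) Bc) as [y [Sy Ey]].
      destruct (sol_extend x y (tau + INR k * (tau / 2)) c tau) as [z [Sz Ez]];
        auto; [unfold c; lra|].
      exists z; split; [|intros i; rewrite Ez; auto].
      apply (sol_restrict z (c + tau)); [|easy].
      eapply Rle_trans; [apply Rmin_r|]; rewrite S_INR; unfold c; lra. }
destruct (archimed (T / (tau / 2))) as [A _].
destruct (P (Z.to_nat (up (T / (tau / 2))))) as [x [Sx Ex]].
exists x; split; [|easy].
eapply sol_restrict; [|exact Sx]; apply Rmin_glb; [lra|].
assert (0 < T / (tau / 2)) by (apply Rdiv_lt_0_compat; lra).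
assert (0 < up (T / (tau / 2)))%Z by (apply lt_IZR; simpl; lra).
rewrite INR_IZR_INZ, Z2Nat.id by lia.
apply (Rmult_gt_compat_r (tau / 2)) in A; [|lra].
replace (T / (tau / 2) * (tau / 2)) with T in A by (field; lra); lra.
Qed.

(** Solutions on the intervals [[0, n + 1)] are selected by choice and agree by uniqueness; at time
    [t] the one with index [ix t] is read, which lives beyond [t] because [up t] exceeds [t]. *)
Lemma sol_global x0 :
  (forall T, 0 < T -> exists x, sol x T /\ forall i, x 0 i = x0 i) ->
  exists x, (forall T, sol x T) /\ forall i, x 0 i = x0 i.
Proof.
intros E.
assert (En : forall n, exists x, sol x (INR n + 1) /\ forall i, x 0 i = x0 i).
{ intros n; apply E; generalize (pos_INR n); lra. }
pose (f n := proj1_sig (constructive_indefinite_description _ (En n))).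
assert (Hf : forall n, sol (f n) (INR n + 1) /\ forall i, f n 0 i = x0 i)
  by (intros n; apply proj2_sig).
clearbody f; clear En.
pose (ix t := Z.to_nat (up t)).
assert (Hix : forall t, 0 <= t -> t < INR (ix t) + 1).
{ intros t Ht; destruct (archimed t) as [A _]; unfold ix.
  assert (0 < up t)%Z by (apply lt_IZR; simpl; lra).
  rewrite INR_IZR_INZ, Z2Nat.id by lia; lra. }
assert (Eq : forall n m t, 0 <= t < INR n + 1 -> t < INR m + 1 ->
           forall i, f n t i = f m t i).
{ intros n m t H1 H2 i.
  destruct (Hf n) as [Sn En]; destruct (Hf m) as [Sm Em].
  apply (sol_unique _ _ (Rmin (INR n + 1) (INR m + 1))).
  - eapply sol_restrict; [apply Rmin_l|easy].
  - eapply sol_restrict; [apply Rmin_r|easy].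
  - intros k; now rewrite En, Em.
  - split; [lra|apply Rmin_glb_lt; lra]. }
exists (fun t => f (ix t) t); split.
- intros T; destruct (Rle_dec T 0) as [L|L].
  { split; [exists 0|]; intros; lra. }
  pose (n := ix T); destruct (Hf n) as [[[M BM] D] _].
  assert (HT : T < INR n + 1) by (apply Hix; lra).
  split.
  + exists M; intros t Ht; apply (bnd_ext (f n t)); [|apply BM; lra].
    intros i; apply Eq; [lra|apply Hix; lra].
  + intros t Ht i.
    apply (deriv_at_ext_loc (fun s => f n s i)); [lra| |].
    * exists (T - t); split; [lra|]; intros s Hs Ls; apply Rabs_def2 in Ls.
      apply Eq; [lra|apply Hix; lra].
    * replace (f (ix t) t) with (f n t); [apply D; lra|].
      apply functional_extensionality; intros j; apply Eq; [lra|apply Hix; lra].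
- intros i; apply Hf.
Qed.

(** The remainder has derivative [F (x r) - F (x t)], of norm at most [L * K * |r - t|], so it is
    quadratic in norm. This is the passage from coordinatewise derivatives to derivatives in the
    norm. *)
Lemma sol_taylor x T : sol x T -> exists C, 0 <= C /\ forall s t,
  0 <= s < T -> 0 <= t < T ->
  bnd (fun i => x s i - x t i - (s - t) * F (x t) i) (C * (s - t) ^ 2) /\
  bnd (fun i => F (x s) i - F (x t) i) (C * Rabs (s - t)).
Proof.
intros [[M B] D].
destruct (F_bnd M) as [K [HK FK]]; destruct (F_lip M) as [L [HL FL]].
assert (P : forall s t, 0 <= s < T -> 0 <= t < T ->
   bnd (fun i => x s i - x t i) (K * Rabs (s - t))).
{ intros s t Hs Ht; apply (bnd_deriv x (fun r => F (x r))); [lra|lra|].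
  intros r Hr; assert (0 <= r < T).
  { unfold Rmin, Rmax in Hr; destruct Rle_dec; lra. }
  split; [now apply D|apply FK; auto]. }
assert (Q : forall s t, 0 <= s < T -> 0 <= t < T ->
   bnd (fun i => F (x s) i - F (x t) i) (L * K * Rabs (s - t))).
{ intros s t Hs Ht; rewrite Rmult_assoc; apply FL; auto.
  apply Rmult_le_pos; [easy|apply Rabs_pos]. }
exists (L * K); split; [now apply Rmult_le_pos|]; intros s t Hs Ht.
split; [|auto].
apply (bnd_ext (fun i => (x s i - s * F (x t) i) - (x t i - t * F (x t) i)));
  [intros; ring|].
replace (L * K * (s - t) ^ 2) with (L * K * Rabs (s - t) * Rabs (s - t))
  by (rewrite <- (pow2_abs (s - t)); ring).
apply (bnd_deriv (fun r i => x r i - r * F (x t) i)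
                 (fun r i => F (x r) i - F (x t) i)); [lra|lra|].
intros r Hr; assert (0 <= r < T).
{ unfold Rmin, Rmax in Hr; destruct Rle_dec; lra. }
split.
- intros i; apply deriv_at_minus; [now apply D|].
  apply is_derive_deriv_at; auto_derive; [easy|ring].
- apply (bnd_weak _ (L * K * Rabs (r - t))); [|auto].
  apply Rmult_le_compat_l; [now apply Rmult_le_pos|].
  unfold Rmin, Rmax in Hr; destruct Rle_dec; unfold Rabs;
    repeat destruct Rcase_abs; lra.
Qed.

End AbstractODE.

(** * Square-summable sequences and kernels *)

(* The l^2 bound, in dual form so that it is a family of bounds on finite
   linear functionals. *)
Definition l2b (v : Z -> R) (M : R) : Prop :=
  forall n c, psum (fun j => c j ^ 2) n <= 1 ->
    Rabs (psum (fun j => c j * v j) n) <= M.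

Lemma psum_cauchy_schwarz c v n :
  psum (fun j => c j * v j) n ^ 2
    <= psum (fun j => c j ^ 2) n * psum (fun j => v j ^ 2) n.
Proof.
induction n as [|n IHn]; cbn [psum]; [lra|].
pose (p := psum (fun j => c j ^ 2) n); pose (q := psum (fun j => v j ^ 2) n).
pose (s := psum (fun j => c j * v j) n); fold p q s in IHn |- *.
assert (Hp : 0 <= p) by (apply psum_ge0; intros; nra).
assert (Hq : 0 <= q) by (apply psum_ge0; intros; nra).
clearbody p q s.
(* The cross terms with a new entry: [s^2 <= p q] and the inequality between geometric and
   arithmetic means. *)
assert (K : forall a b, 2 * s * (a * b) <= p * b ^ 2 + q * a ^ 2).
{ intros a b; assert (0 <= a ^ 2) by apply pow2_ge_0.
  assert (0 <= b ^ 2) by apply pow2_ge_0.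
  apply Rsqr_incr_0_var; [unfold Rsqr|apply Rplus_le_le_0_compat; now apply Rmult_le_pos].
  assert (s ^ 2 * (a * b) ^ 2 <= (p * q) * (a * b) ^ 2)
    by (apply Rmult_le_compat_r; [apply pow2_ge_0|lra]).
  assert (0 <= (p * b ^ 2 - q * a ^ 2) ^ 2) by apply pow2_ge_0; nra. }
set (a := c _); set (b := v _); set (a' := c _); set (b' := v _).
assert (K1 := K a b); assert (K2 := K a' b').
assert (K3 := pow2_ge_0 (a * b' - a' * b)); nra.
Qed.

Lemma abs_le_of_sqr x M : 0 <= M -> x ^ 2 <= M ^ 2 -> Rabs x <= M.
Proof.
intros HM E; apply Rsqr_incr_0_var; [|easy].
rewrite !Rsqr_pow2, pow2_abs; easy.
Qed.

Lemma l2b_ge0 v M : l2b v M -> 0 <= M.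
Proof.
intros B; specialize (B O (fun _ => 0)); simpl in B; rewrite Rabs_R0 in B; lra.
Qed.

Lemma l2b_intro v M : 0 <= M -> (forall n, psum (fun j => v j ^ 2) n <= M ^ 2) ->
  l2b v M.
Proof.
intros HM B n c Hc; apply abs_le_of_sqr; [easy|].
eapply Rle_trans; [apply psum_cauchy_schwarz|].
assert (0 <= psum (fun j => v j ^ 2) n) by (apply psum_ge0; intros; nra).
specialize (B n); nra.
Qed.

Lemma l2b_elim v M : l2b v M -> forall n, psum (fun j => v j ^ 2) n <= M ^ 2.
Proof.
intros B n; assert (HM := l2b_ge0 _ _ B).
pose (q := psum (fun j => v j ^ 2) n).
assert (Hq : 0 <= q) by (apply psum_ge0; intros; nra).
destruct (Req_dec q 0) as [E|N]; [fold q; rewrite E; nra|].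
assert (Hs : 0 < sqrt q) by (apply sqrt_lt_R0; lra).
assert (Es : sqrt q * sqrt q = q) by now apply sqrt_sqrt.
(* The extremal test sequence is [v] itself, normalised on the window. *)
assert (P := B n (fun j => / sqrt q * v j)).
cbv beta in P.
rewrite (psum_ext (fun j => (/ sqrt q * v j) ^ 2)
  (fun j => (/ sqrt q) ^ 2 * v j ^ 2)) in P by (intros; ring).
rewrite (psum_ext (fun j => / sqrt q * v j * v j)
  (fun j => / sqrt q * v j ^ 2)) in P by (intros; ring).
rewrite !psum_scal in P; fold q in P |- *.
replace ((/ sqrt q) ^ 2 * q) with 1 in P.
2:{ rewrite <- Es at 2; field; lra. }
replace (/ sqrt q * q) with (sqrt q) in P.
2:{ rewrite <- Es at 3; field; lra. }
rewrite Rabs_pos_eq in P by lra; specialize (P ltac:(lra)); nra.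
Qed.

Lemma l2b_weak v M M' : M <= M' -> l2b v M -> l2b v M'.
Proof. intros L B n c Hc; specialize (B n c Hc); lra. Qed.

Lemma l2b_ext v w M : (forall j, v j = w j) -> l2b v M -> l2b w M.
Proof.
intros E B n c Hc; rewrite <- (psum_ext (fun j => c j * v j)); [now apply B|].
intros; now rewrite E.
Qed.

Lemma l2b_le v w M : (forall j, Rabs (v j) <= Rabs (w j)) -> l2b w M -> l2b v M.
Proof.
intros E B; apply l2b_intro; [now apply (l2b_ge0 w)|]; intros n.
eapply Rle_trans; [|apply (l2b_elim _ _ B n)]; apply psum_le; intros j.
rewrite <- (pow2_abs (v j)), <- (pow2_abs (w j)).
apply pow_incr; split; [apply Rabs_pos|easy].
Qed.

Lemma l2b_plus v w M N : l2b v M -> l2b w N -> l2b (fun j => v j + w j) (M + N).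
Proof.
intros A B n c Hc; specialize (A n c Hc); specialize (B n c Hc).
rewrite (psum_ext _ (fun j => c j * v j + c j * w j)) by (intros; ring).
rewrite psum_plus; eapply Rle_trans; [apply Rabs_triang|lra].
Qed.

Lemma l2b_scal a v M : l2b v M -> l2b (fun j => a * v j) (Rabs a * M).
Proof.
intros B n c Hc; specialize (B n c Hc).
rewrite (psum_ext _ (fun j => a * (c j * v j))) by (intros; ring).
rewrite psum_scal, Rabs_mult; apply Rmult_le_compat_l; [apply Rabs_pos|easy].
Qed.

Lemma l2b_opp v M : l2b v M -> l2b (fun j => - v j) M.
Proof. apply l2b_le; intros; rewrite Rabs_Ropp; lra. Qed.

Lemma l2b_minus v w M N : l2b v M -> l2b w N -> l2b (fun j => v j - w j) (M + N).
Proof. intros A B; apply (l2b_plus v _ M N A), l2b_opp, B. Qed.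

Lemma l2b_mult_bd s v M N : (forall j, Rabs (s j) <= M) -> l2b v N ->
  l2b (fun j => s j * v j) (M * N).
Proof.
intros E A; assert (0 <= M) by (generalize (E 0%Z) (Rabs_pos (s 0%Z)); lra).
apply (l2b_le _ (fun j => M * v j)).
- intros j; rewrite !Rabs_mult; apply Rmult_le_compat_r; [apply Rabs_pos|].
  rewrite (Rabs_pos_eq M); easy.
- replace (M * N) with (Rabs M * N) by (rewrite (Rabs_pos_eq M); easy).
  now apply l2b_scal.
Qed.

Lemma l2b_term v M j : l2b v M -> Rabs (v j) <= M.
Proof.
intros B; apply abs_le_of_sqr; [now apply (l2b_ge0 v)|].
eapply Rle_trans; [|apply (l2b_elim _ _ B (S (Z.abs_nat j)))].
apply (psum_term (fun j => v j ^ 2)); [intros; nra|lia].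
Qed.

Lemma l2b_next v M : l2b v M -> l2b (fun j => v (j + 1)%Z) M.
Proof.
intros B; apply l2b_intro; [now apply (l2b_ge0 v)|]; intros n.
eapply Rle_trans; [|apply (l2b_elim _ _ B (S n))].
apply (psum_shift_pos (fun j => v j ^ 2)); intros; nra.
Qed.

Lemma l2b_prev v M : l2b v M -> l2b (fun j => v (j - 1)%Z) M.
Proof.
intros B; apply l2b_intro; [now apply (l2b_ge0 v)|]; intros n.
eapply Rle_trans; [|apply (l2b_elim _ _ B (S n))].
apply (psum_shift_neg (fun j => v j ^ 2)); intros; nra.
Qed.

(** On a fixed grid the difference operator is bounded on l^2. The constant grows like [1 / dx], so
    it may enter crude bounds but no grid-independent one. *)
Lemma l2b_Dp dx v M : l2b v M -> l2b (Dp dx v) (Rabs (/ dx) * (M + M)).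
Proof.
intros B; apply (l2b_ext (fun j => / dx * (v (j + 1)%Z - v j))).
- intros j; unfold Dp, Rdiv; ring.
- apply l2b_scal, l2b_minus; [now apply l2b_next|easy].
Qed.

Lemma l2b_lim v M : l2b v M -> is_lim_seq (fun n => v (Z.of_nat n)) 0 /\
  is_lim_seq (fun n => v (- Z.of_nat n)%Z) 0.
Proof.
intros B.
assert (A : asum (fun j => v j ^ 2) (M ^ 2)).
{ intros n; rewrite (psum_ext _ (fun j => v j ^ 2)); [now apply l2b_elim|].
  intros; apply Rabs_pos_eq; nra. }
assert (S : forall u : nat -> R, is_lim_seq (fun n => u n ^ 2) 0 -> is_lim_seq u 0).
{ intros u L; apply is_lim_seq_spec; intros eps; apply is_lim_seq_spec in L.
  assert (He := cond_pos eps); assert (H2 : 0 < eps ^ 2) by nra.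
  destruct (L (mkposreal _ H2)) as [N HN]; exists N; intros n Hn.
  specialize (HN n Hn); simpl pos in HN; rewrite Rminus_0_r in *.
  rewrite <- (pow2_abs (u n)), Rabs_pos_eq in HN by nra.
  generalize (Rabs_pos (u n)); nra. }
destruct (asum_lim _ _ A); split; now apply S.
Qed.

(** Rows and columns are both recorded: kernel products sum along rows, [R] and [Q] along columns,
    and the symmetry that identifies the two is known only on [in_B]. *)
Definition kb (a : kernel) (M : R) : Prop :=
  (forall i, asum (a i) M) /\ (forall j, asum (fun i => a i j) M).

Lemma kb_ge0 a M : kb a M -> 0 <= M.
Proof. intros [B _]; exact (asum_ge0 _ _ (B 0%Z)). Qed.

Lemma kb_weak a M M' : M <= M' -> kb a M -> kb a M'.
Proof.
intros L [B1 B2]; split; intros; (eapply asum_weak; [|exact L]); auto.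
Qed.

Lemma kb_ext a b M : (forall i j, a i j = b i j) -> kb b M -> kb a M.
Proof.
intros E [B1 B2]; split.
- intros i; apply (asum_ext _ (b i)); auto.
- intros j; apply (asum_ext _ (fun i => b i j)); auto.
Qed.

Lemma kb_plus a b M N : kb a M -> kb b N -> kb (fun i j => a i j + b i j) (M + N).
Proof.
intros [A1 A2] [B1 B2]; split.
- intros i; apply (asum_plus (a i) (b i)); auto.
- intros j; apply (asum_plus (fun i => a i j) (fun i => b i j)); auto.
Qed.

Lemma kb_scal c a M : kb a M -> kb (fun i j => c * a i j) (Rabs c * M).
Proof.
intros [A1 A2]; split.
- intros i; apply (asum_scal c (a i)); auto.
- intros j; apply (asum_scal c (fun i => a i j)); auto.
Qed.

Lemma kb_minus a b M N : kb a M -> kb b N -> kb (fun i j => a i j - b i j) (M + N).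
Proof.
intros [A1 A2] [B1 B2]; split.
- intros i; apply (asum_minus (a i) (b i)); auto.
- intros j; apply (asum_minus (fun i => a i j) (fun i => b i j)); auto.
Qed.

Lemma kb_term a M i j : kb a M -> Rabs (a i j) <= M.
Proof. intros [A _]; apply (asum_term (a i)); auto. Qed.

Definition kv (a : kernel) (v : Z -> R) (j : Z) : R := sumZ (fun i => a i j * v i).

Lemma kv_asum a v A V j : kb a A -> (forall i, Rabs (v i) <= V) ->
  asum (fun i => a i j * v i) (V * A).
Proof.
intros [_ B] E; apply (asum_ext _ (fun i => v i * a i j)); [intros; ring|].
now apply asum_mult_bd.
Qed.

(* Schur's test. *)
Lemma l2b_kv a v A V : kb a A -> l2b v V -> l2b (kv a v) (A * V).
Proof.
intros Ka Lv; assert (HA := kb_ge0 _ _ Ka); assert (HV := l2b_ge0 _ _ Lv).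
assert (Ev : forall i, Rabs (v i) <= V) by (intros; now apply l2b_term).
assert (E2 : forall i, Rabs (v i ^ 2) <= V ^ 2).
{ intros i; rewrite <- RPow_abs; apply pow_incr; split; [apply Rabs_pos|easy]. }
assert (Kabs : kb (fun i j => Rabs (a i j)) A).
{ destruct Ka; split; intros; apply asum_abs; auto. }
apply l2b_intro; [now apply Rmult_le_pos|]; intros n.
assert (CS : forall j, kv a v j ^ 2 <= A * sumZ (fun i => Rabs (a i j) * v i ^ 2)).
{ intros j.
  apply (is_lim_seq_le (fun m => psum (fun i => a i j * v i) m ^ 2)
     (fun m => A * psum (fun i => Rabs (a i j) * v i ^ 2) m)
     (kv a v j ^ 2) (A * sumZ (fun i => Rabs (a i j) * v i ^ 2))).
  - intros m.
    (* The weight [|a i j|] is split into two square roots: one carries the mass of the column [j],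
       the other the values of [v]. *)
    pose (c i := sqrt (Rabs (a i j))).
    assert (Ec : forall i, c i ^ 2 = Rabs (a i j)).
    { intros i; unfold c; rewrite pow2_sqrt; [easy|apply Rabs_pos]. }
    assert (Q := psum_cauchy_schwarz c (fun i => c i * Rabs (v i)) m).
    rewrite (psum_ext (fun j => c j * (c j * Rabs (v j)))
               (fun i => Rabs (a i j * v i))) in Q
      by (intros i; rewrite Rabs_mult, <- Ec; ring).
    rewrite (psum_ext (fun j => c j ^ 2) (fun i => Rabs (a i j))) in Q by easy.
    rewrite (psum_ext (fun j => (c j * Rabs (v j)) ^ 2)
               (fun i => Rabs (a i j) * v i ^ 2)) in Q
      by (intros i; rewrite Rpow_mult_distr, Ec, pow2_abs; ring).
    assert (P1 := psum_abs (fun i => a i j * v i) m).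
    assert (P2 := proj2 Ka j m).
    assert (0 <= psum (fun i => Rabs (a i j) * v i ^ 2) m).
    { apply psum_ge0; intros; apply Rmult_le_pos; [apply Rabs_pos|nra]. }
    rewrite <- (pow2_abs (psum (fun i => a i j * v i) m)).
    generalize (Rabs_pos (psum (fun i => a i j * v i) m)); nra.
  - simpl; repeat apply is_lim_seq_mult'; try apply is_lim_seq_const;
      apply (sumZ_lim _ (V * A)); now apply kv_asum.
  - apply (is_lim_seq_scal_l _ A
      (Finite (sumZ (fun i => Rabs (a i j) * v i ^ 2)))).
    apply (sumZ_lim _ (V ^ 2 * A)), (kv_asum (fun i j => Rabs (a i j))); easy. }
eapply Rle_trans; [apply psum_le, CS|]; rewrite psum_scal.
destruct (psum_sumZ (fun i j => Rabs (a i j) * v i ^ 2) n) as [_ ->].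
{ intros j; exists (V ^ 2 * A).
  apply (kv_asum (fun i j => Rabs (a i j))); easy. }
assert (S2 : asum (fun i => v i ^ 2) (V ^ 2)).
{ intros m; rewrite (psum_ext _ (fun j => v j ^ 2)); [now apply l2b_elim|].
  intros; apply Rabs_pos_eq; nra. }
assert (S1 : asum (fun i => psum (fun j => Rabs (a i j) * v i ^ 2) n) (A * V ^ 2)).
{ apply (asum_ext _ (fun i => psum (fun j => Rabs (a i j)) n * v i ^ 2)).
  - intros i; rewrite (psum_ext _ (fun j => v i ^ 2 * Rabs (a i j)))
      by (intros; ring); rewrite psum_scal; ring.
  - apply asum_mult_bd; [|easy]; intros i.
    rewrite Rabs_pos_eq by (apply psum_ge0; intros; apply Rabs_pos).
    apply Ka. }
assert (Q := sumZ_bound _ _ S1); apply Rabs_le_between in Q; nra.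
Qed.

Lemma kv_minus a a' v v' A V j : kb a A -> kb a' A ->
  (forall i, Rabs (v i) <= V) -> (forall i, Rabs (v' i) <= V) ->
  kv a v j - kv a' v' j =
  kv (fun i j => a i j - a' i j) v j + kv a' (fun i => v i - v' i) j.
Proof.
intros Ka Ka' Ev Ev'; unfold kv.
assert (Kd := kb_minus _ _ _ _ Ka Ka').
assert (Evd : forall i, Rabs (v i - v' i) <= V + V).
{ intros i; unfold Rminus; eapply Rle_trans; [apply Rabs_triang|].
  rewrite Rabs_Ropp; generalize (Ev i) (Ev' i); lra. }
rewrite <- (sumZ_minus _ _ (V * A) (V * A)) by now apply kv_asum.
rewrite <- (sumZ_plus _ _ (V * (A + A)) ((V + V) * A)).
- apply sumZ_ext; intros; ring.
- now apply (kv_asum (fun i j => a i j - a' i j)).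
- now apply (kv_asum a' (fun i => v i - v' i)).
Qed.

Definition ktri (d : Z -> R) (a b : kernel) (i j : Z) : R :=
  sumZ (fun m => d m * (a i m * b m j)).

Lemma ktri_asum d (a b : kernel) D A B i j :
  (forall m, Rabs (d m) <= D) -> kb a A -> (forall i j, Rabs (b i j) <= B) ->
  asum (fun m => d m * (a i m * b m j)) (D * (B * A)).
Proof.
intros Hd [Ka _] Hb; apply asum_mult_bd; [easy|].
apply (asum_ext _ (fun m => b m j * a i m)); [intros; ring|].
now apply asum_mult_bd.
Qed.

Lemma kb_ktri_rows d (a b : kernel) D A B : (forall m, Rabs (d m) <= D) -> 
  (forall i, asum (a i) A) -> (forall i, asum (b i) B) ->
  forall i, asum (fun j => sumZ (fun m => d m * (a i m * b m j))) (D * (A * B)).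
Proof.
intros Hd Ka Kb i n.
assert (Hb : forall i j, Rabs (b i j) <= B) by (intros; apply (asum_term (b i0)); auto).
assert (HD : 0 <= D) by (generalize (Hd 0%Z) (Rabs_pos (d 0%Z)); lra).
assert (HB := asum_ge0 _ _ (Kb i)).
assert (S0 : forall j, asum (fun m => d m * (a i m * b m j)) (D * (B * A))).
{ intros j; apply asum_mult_bd; [easy|].
  apply (asum_ext _ (fun m => b m j * a i m)); [intros; ring|].
  now apply asum_mult_bd. }
eapply Rle_trans; [apply psum_le; intros j; apply (sumZ_abs _ _ (S0 j))|].
cbv beta; rewrite (proj2 (psum_sumZ (fun m j => Rabs (d m * (a i m * b m j))) n
   (fun j => ex_intro _ _ (asum_abs _ _ (S0 j))))).
rewrite (sumZ_ext _ (fun m => (Rabs (d m) * psum (fun j => Rabs (b m j)) n) * Rabs (a i m))).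
2:{ intros m; rewrite (psum_ext _ (fun j => (Rabs (d m) * Rabs (a i m)) * Rabs (b m j))).
    - rewrite psum_scal; ring.
    - intros j; rewrite !Rabs_mult; ring. }
assert (S1 : asum (fun m => (Rabs (d m) * psum (fun j => Rabs (b m j)) n) * Rabs (a i m))
               (D * B * A)).
{ apply asum_mult_bd; [|now apply asum_abs]; intros m.
  assert (P := Kb m n); assert (0 <= psum (fun j => Rabs (b m j)) n)
    by (apply psum_ge0; intros; apply Rabs_pos).
  rewrite Rabs_pos_eq by (apply Rmult_le_pos; [apply Rabs_pos|easy]).
  apply Rmult_le_compat; auto; apply Rabs_pos. }
assert (Q := sumZ_bound _ _ S1); apply Rabs_le_between in Q; lra.
Qed.

Lemma kb_ktri d a b D A B : (forall m, Rabs (d m) <= D) -> kb a A -> kb b B ->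
  kb (ktri d a b) (D * (A * B)).
Proof.
intros Hd [A1 A2] [B1 B2]; split; [now apply kb_ktri_rows|]; intros j.
apply (asum_ext _ (fun i => sumZ (fun m => d m * (b m j * a i m)))).
- intros i; apply sumZ_ext; intros; ring.
- rewrite (Rmult_comm A).
  apply (kb_ktri_rows d (fun i j => b j i) (fun i j => a j i)); easy.
Qed.

Lemma ktri_minus d d' a a' b b' D A B i j :
  (forall m, Rabs (d m) <= D) -> (forall m, Rabs (d' m) <= D) ->
  kb a A -> kb a' A -> kb b B -> kb b' B ->
  ktri d a b i j - ktri d' a' b' i j =
  ktri (fun m => d m - d' m) a b i j +
  (ktri d' (fun i j => a i j - a' i j) b i j +
   ktri d' a' (fun i j => b i j - b' i j) i j).
Proof.
intros Hd Hd' Ka Ka' Kb Kb'; unfold ktri.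
assert (Hb : forall i j, Rabs (b i j) <= B) by (intros; now apply kb_term).
assert (Hb' : forall i j, Rabs (b' i j) <= B) by (intros; now apply kb_term).
assert (Hdd : forall m, Rabs (d m - d' m) <= D + D).
{ intros m; unfold Rminus; eapply Rle_trans; [apply Rabs_triang|].
  rewrite Rabs_Ropp; generalize (Hd m) (Hd' m); lra. }
assert (Hbb : forall i j, Rabs (b i j - b' i j) <= B + B).
{ intros; unfold Rminus; eapply Rle_trans; [apply Rabs_triang|].
  rewrite Rabs_Ropp; generalize (Hb i0 j0) (Hb' i0 j0); lra. }
assert (Kaa := kb_minus _ _ _ _ Ka Ka').
assert (T1 := ktri_asum _ _ _ _ _ _ i j Hdd Ka Hb).
assert (T2 := ktri_asum _ _ _ _ _ _ i j Hd' Kaa Hb).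
assert (T3 := ktri_asum _ _ _ _ _ _ i j Hd' Ka' Hbb).
rewrite <- (sumZ_minus _ _ _ _ (ktri_asum _ _ _ _ _ _ i j Hd Ka Hb)
                              (ktri_asum _ _ _ _ _ _ i j Hd' Ka' Hb')).
rewrite <- (sumZ_plus _ _ _ _ T2 T3).
rewrite <- (sumZ_plus _ _ _ _ T1 (asum_plus _ _ _ _ T2 T3)).
apply sumZ_ext; intros; ring.
Qed.

(** * The system as a locally Lipschitz vector field *)

Inductive idx : Type :=
| Iz (j : Z) | Iu (j : Z) | Ih (j : Z) | Ir (j : Z)
| Ig (i j : Z) | Ik (i j : Z) | Ia (i j : Z) | Ip (i j : Z).

Definition flat (X : state) (a : idx) : R :=
  match a with
  | Iz j => zeta X j | Iu j => U X j | Ih j => H X j | Ir j => rbar X j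
  | Ig i j => ker_g X i j | Ik i j => ker_k X i j
  | Ia i j => ker_gamma X i j | Ip i j => ker_kappa X i j
  end.

Definition unflat (x : idx -> R) : state :=
  State (EVec (fun j => x (Iz j)) (fun j => x (Iu j)) (fun j => x (Ih j))
              (fun j => x (Ir j)))
        (fun i j => x (Ig i j)) (fun i j => x (Ik i j))
        (fun i j => x (Ia i j)) (fun i j => x (Ip i j)).

Lemma unflat_flat X : unflat (flat X) = X.
Proof. now destruct X as [[] ]. Qed.

(** The norm of the kernel space up to factors depending on [dx], with the column sums added. A
    bound of [D_+ U] follows by [l2b_Dp] and the sup bounds of the kernels by [kb_term]. *)
Definition nrm (dx : R) (X : state) (M : R) : Prop :=
  (forall j, Rabs (zeta X j) <= M) /\ l2b (Dp dx (zeta X)) M /\ l2b (U X) M /\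
  (forall j, Rabs (H X j) <= M) /\ l2b (Dp dx (H X)) M /\ l2b (rbar X) M /\
  kb (ker_g X) M /\ kb (ker_k X) M /\ kb (ker_gamma X) M /\ kb (ker_kappa X) M.

Inductive is_ker : (Z -> Z -> idx) -> Prop :=
| ker_Ig : is_ker Ig | ker_Ik : is_ker Ik | ker_Ia : is_ker Ia | ker_Ip : is_ker Ip.

Inductive is_vec (dx : R) : ((idx -> R) -> Z -> R) -> Prop :=
| vec_dz : is_vec dx (fun x => Dp dx (fun j => x (Iz j)))
| vec_u : is_vec dx (fun x j => x (Iu j))
| vec_dh : is_vec dx (fun x => Dp dx (fun j => x (Ih j)))
| vec_r : is_vec dx (fun x j => x (Ir j)).

(** Testing against finite sequences in the dual unit balls of l^2 and l^1 makes [nrm] a supremum of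
    finite linear functionals, see [bnd_nrm]. *)
Inductive functionals (dx : R) : ((idx -> R) -> R) -> Prop :=
| fn_zeta j : functionals dx (fun x => x (Iz j))
| fn_H j : functionals dx (fun x => x (Ih j))
| fn_l2 V n c : is_vec dx V -> psum (fun j => c j ^ 2) n <= 1 ->
    functionals dx (fun x => psum (fun j => c j * V x j) n)
| fn_row K i n c : is_ker K -> (forall j, Rabs (c j) <= 1) ->
    functionals dx (fun x => psum (fun j => c j * x (K i j)) n)
| fn_col K j n c : is_ker K -> (forall i, Rabs (c i) <= 1) ->
    functionals dx (fun x => psum (fun i => c i * x (K i j)) n).

Lemma finlin_psum (J : (idx -> R) -> Z -> R) c n :
  (forall j, finlin idx (fun x => J x j)) ->
  finlin idx (fun x => psum (fun j => c j * J x j) n).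
Proof.
intros E; induction n as [|n IHn]; cbn [psum]; [apply fl_zero|].
apply (fl_plus _ (fun x => psum (fun j => c j * J x j) n)
   (fun x => c (Z.of_nat n) * J x (Z.of_nat n)
             + c (- Z.of_nat n - 1)%Z * J x (- Z.of_nat n - 1)%Z)); [easy|].
apply (fl_plus _ (fun x => c (Z.of_nat n) * J x (Z.of_nat n))
   (fun x => c (- Z.of_nat n - 1)%Z * J x (- Z.of_nat n - 1)%Z)).
- apply (fl_scal _ _ (fun x => J x (Z.of_nat n))); auto.
- apply (fl_scal _ _ (fun x => J x (- Z.of_nat n - 1)%Z)); auto.
Qed.

Lemma finlin_Dp dx (J : Z -> idx) j :
  finlin idx (fun x => Dp dx (fun j => x (J j)) j).
Proof.
apply (fl_ext _ (fun x => / dx * x (J (j + 1)%Z) + (- / dx) * x (J j))).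
- intros x; unfold Dp, Rdiv; ring.
- apply (fl_plus _ (fun x => / dx * x (J (j + 1)%Z)) (fun x => (- / dx) * x (J j)));
  apply (fl_scal _ _ (fun x : idx -> R => x _)), fl_ev.
Qed.

Lemma functionals_finlin dx w : functionals dx w -> finlin idx w.
Proof.
intros [j|j|V n c HV Hc|K i n c HK Hc|K j n c HK Hc].
- apply fl_ev.
- apply fl_ev.
- apply finlin_psum; intros j; destruct HV; try apply finlin_Dp; apply fl_ev.
- apply (finlin_psum (fun x j => x (K i j))); intros; apply fl_ev.
- apply (finlin_psum (fun x i => x (K i j))); intros; apply fl_ev.
Qed.

Lemma asum_dual v M : asum v M <->
  forall n c, (forall j, Rabs (c j) <= 1) -> Rabs (psum (fun j => c j * v j) n) <= M.
Proof.
split.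
- intros A n c Hc; eapply Rle_trans; [apply psum_abs|].
  apply (asum_mult_bd v c M 1 Hc) in A; specialize (A n); lra.
- intros B n; specialize (B n (fun j => if Rle_dec 0 (v j) then 1 else -1)).
  rewrite (psum_ext _ (fun j => Rabs (v j))) in B.
  + eapply Rle_trans; [apply Rle_abs|apply B]; intros j.
    destruct Rle_dec; [rewrite Rabs_R1|rewrite Rabs_left]; lra.
  + intros j; destruct Rle_dec; [rewrite Rabs_pos_eq|rewrite Rabs_left]; lra.
Qed.

Notation bndX dx := (bnd idx (functionals dx)).

Lemma bnd_nrm dx x M : bndX dx x M <-> nrm dx (unflat x) M.
Proof.
split.
- intros B; unfold nrm; simpl.
  repeat match goal with |- _ /\ _ => split end.
  + intros j; apply (B _ (fn_zeta dx j)).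
  + intros n c Hc; apply (B _ (fn_l2 dx _ n c (vec_dz dx) Hc)).
  + intros n c Hc; apply (B _ (fn_l2 dx _ n c (vec_u dx) Hc)).
  + intros j; apply (B _ (fn_H dx j)).
  + intros n c Hc; apply (B _ (fn_l2 dx _ n c (vec_dh dx) Hc)).
  + intros n c Hc; apply (B _ (fn_l2 dx _ n c (vec_r dx) Hc)).
  + split; intros; apply asum_dual; intros n c Hc.
    * apply (B _ (fn_row dx _ i n c ker_Ig Hc)).
    * apply (B _ (fn_col dx _ j n c ker_Ig Hc)).
  + split; intros; apply asum_dual; intros n c Hc.
    * apply (B _ (fn_row dx _ i n c ker_Ik Hc)).
    * apply (B _ (fn_col dx _ j n c ker_Ik Hc)).
  + split; intros; apply asum_dual; intros n c Hc.
    * apply (B _ (fn_row dx _ i n c ker_Ia Hc)).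
    * apply (B _ (fn_col dx _ j n c ker_Ia Hc)).
  + split; intros; apply asum_dual; intros n c Hc.
    * apply (B _ (fn_row dx _ i n c ker_Ip Hc)).
    * apply (B _ (fn_col dx _ j n c ker_Ip Hc)).
- intros (Bz & Bdz & Bu & Bh & Bdh & Br & Kg & Kk & Ka & Kp); simpl in *.
  assert (HK : forall K, is_ker K -> kb (fun i j => x (K i j)) M).
  { now intros K []. }
  intros w [j|j|V n c HV Hc|K i n c HV Hc|K j n c HV Hc]; auto.
  + destruct HV; [apply Bdz|apply Bu|apply Bdh|apply Br]; auto.
  + apply (proj1 (asum_dual (fun j => x (K i j)) M)); [apply HK|]; auto.
  + apply (proj1 (asum_dual (fun i => x (K i j)) M)); [apply HK|]; auto.
Qed.

Lemma functionals_ev dx i :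
  exists c, 0 <= c /\ forall x M, bndX dx x M -> Rabs (x i) <= c * M.
Proof.
exists 1; split; [lra|]; intros x M B; rewrite Rmult_1_l.
apply bnd_nrm in B.
destruct B as (Bz & Bdz & Bu & Bh & Bdh & Br & Kg & Kk & Ka & Kp); simpl in *.
destruct i; auto.
- apply (l2b_term (fun j => x (Iu j))); easy.
- apply (l2b_term (fun j => x (Ir j))); easy.
- apply (kb_term (fun i j => x (Ig i j))); easy.
- apply (kb_term (fun i j => x (Ik i j))); easy.
- apply (kb_term (fun i j => x (Ia i j))); easy.
- apply (kb_term (fun i j => x (Ip i j))); easy.
Qed.

Definition state_rhs (dx rho : R) (X : state) : state :=
  State (EVec (U X) (fun j => - Qfun dx rho X j)
              (fun j => - (U X j * Rfun dx rho X (j - 1)%Z))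
              (fun j => - (rho * Dp dx (U X) j)))
    (ker_rhs dx X (ker_g X) (ker_g X) (ker_gamma X) (ker_kappa X))
    (ker_rhs dx X (ker_k X) (ker_k X) (ker_kappa X) (ker_gamma X))
    (ker_rhs dx X (ker_gamma X) (ker_k X) (ker_g X) (ker_gamma X))
    (ker_rhs dx X (ker_kappa X) (ker_g X) (ker_k X) (ker_kappa X)).

Definition rhs (dx rho : R) (x : idx -> R) : idx -> R :=
  flat (state_rhs dx rho (unflat x)).

(* [p? v v' M L]: both arguments are bounded by [M] and their difference by
   [L * d]; these rules compute a Lipschitz constant along the structure of an
   expression. *)
Section Lipschitz.

Variable d : R.
Hypothesis Hd : 0 <= d.

Definition pS (v v' : Z -> R) (M L : R) : Prop :=
  (forall j, Rabs (v j) <= M) /\ (forall j, Rabs (v' j) <= M) /\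
  (forall j, Rabs (v j - v' j) <= L * d).
Definition p2 (v v' : Z -> R) (M L : R) : Prop :=
  l2b v M /\ l2b v' M /\ l2b (fun j => v j - v' j) (L * d).
Definition pK (a a' : kernel) (M L : R) : Prop :=
  kb a M /\ kb a' M /\ kb (fun i j => a i j - a' i j) (L * d).

Lemma p2_pS v v' M L : p2 v v' M L -> pS v v' M L.
Proof.
intros (A & B & C); split; [|split]; intros j; [now apply (l2b_term v)
  |now apply (l2b_term v')|now apply (l2b_term (fun j => v j - v' j))].
Qed.

Lemma p2_ext v v' w w' M L : (forall j, v j = w j) -> (forall j, v' j = w' j) ->
  p2 v v' M L -> p2 w w' M L.
Proof.
intros E E' (A & B & C); split; [|split].
- now apply (l2b_ext v).
- now apply (l2b_ext v').
- apply (l2b_ext (fun j => v j - v' j)); [|easy]; intros; now rewrite E, E'.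
Qed.

Lemma p2_plus v v' w w' M L N K : p2 v v' M L -> p2 w w' N K ->
  p2 (fun j => v j + w j) (fun j => v' j + w' j) (M + N) (L + K).
Proof.
intros (A & B & C) (A' & B' & C'); split; [|split].
- now apply l2b_plus.
- now apply l2b_plus.
- apply (l2b_ext (fun j => (v j - v' j) + (w j - w' j))); [intros; ring|].
  rewrite Rmult_plus_distr_r; now apply (l2b_plus (fun j => v j - v' j)
    (fun j => w j - w' j)).
Qed.

Lemma p2_scal c v v' M L : p2 v v' M L ->
  p2 (fun j => c * v j) (fun j => c * v' j) (Rabs c * M) (Rabs c * L).
Proof.
intros (A & B & C); split; [|split].
- now apply l2b_scal.
- now apply l2b_scal.
- apply (l2b_ext (fun j => c * (v j - v' j))); [intros; ring|].
  rewrite Rmult_assoc; now apply (l2b_scal c (fun j => v j - v' j)).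
Qed.

Lemma p2_opp v v' M L : p2 v v' M L ->
  p2 (fun j => - v j) (fun j => - v' j) (Rabs (-1) * M) (Rabs (-1) * L).
Proof.
intros A; apply (p2_ext (fun j => (-1) * v j) (fun j => (-1) * v' j));
  [intros; ring|intros; ring|now apply p2_scal].
Qed.

Lemma p2_mult s s' v v' M L N K : pS s s' M L -> p2 v v' N K ->
  p2 (fun j => s j * v j) (fun j => s' j * v' j) (M * N) (L * N + M * K).
Proof.
intros (A & B & C) (A' & B' & C'); split; [|split].
- now apply l2b_mult_bd.
- now apply l2b_mult_bd.
- apply (l2b_ext (fun j => (s j - s' j) * v j + s' j * (v j - v' j)));
    [intros; ring|].
  replace ((L * N + M * K) * d) with ((L * d) * N + M * (K * d)) by ring.
  apply l2b_plus; [now apply (l2b_mult_bd (fun j => s j - s' j))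
                  |now apply (l2b_mult_bd s' (fun j => v j - v' j))].
Qed.

Lemma p2_prev v v' M L : p2 v v' M L ->
  p2 (fun j => v (j - 1)%Z) (fun j => v' (j - 1)%Z) M L.
Proof.
intros (A & B & C); split; [|split]; [now apply l2b_prev|now apply l2b_prev|].
now apply (l2b_prev (fun j => v j - v' j)).
Qed.

Lemma p2_next v v' M L : p2 v v' M L ->
  p2 (fun j => v (j + 1)%Z) (fun j => v' (j + 1)%Z) M L.
Proof.
intros (A & B & C); split; [|split]; [now apply l2b_next|now apply l2b_next|].
now apply (l2b_next (fun j => v j - v' j)).
Qed.

Lemma p2_Dp dx v v' M L : p2 v v' M L ->
  p2 (Dp dx v) (Dp dx v') (Rabs (/ dx) * (M + Rabs (-1) * M))
     (Rabs (/ dx) * (L + Rabs (-1) * L)).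
Proof.
intros A; apply (p2_ext (fun j => / dx * (v (j + 1)%Z + - v j))
                        (fun j => / dx * (v' (j + 1)%Z + - v' j))).
- intros j; unfold Dp, Rdiv; ring.
- intros j; unfold Dp, Rdiv; ring.
- apply p2_scal, p2_plus; [now apply p2_next|now apply p2_opp].
Qed.

Lemma p2_kv a a' v v' M L N K : pK a a' M L -> p2 v v' N K ->
  p2 (kv a v) (kv a' v') (M * N) (L * N + M * K).
Proof.
intros (A & B & C) (A' & B' & C'); split; [|split].
- now apply l2b_kv.
- now apply l2b_kv.
- apply (l2b_ext (fun j => kv (fun i j => a i j - a' i j) v j
                           + kv a' (fun i => v i - v' i) j)).
  + intros j; symmetry; apply (kv_minus a a' v v' M N); auto;
      intros; now apply l2b_term.
  + replace ((L * N + M * K) * d) with ((L * d) * N + M * (K * d)) by ring.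
    apply l2b_plus; now apply l2b_kv.
Qed.

Lemma pK_ext a a' b b' M L : (forall i j, a i j = b i j) ->
  (forall i j, a' i j = b' i j) -> pK b b' M L -> pK a a' M L.
Proof.
intros E E' (A & B & C); split; [|split].
- now apply (kb_ext a b).
- now apply (kb_ext a' b').
- apply (kb_ext _ (fun i j => b i j - b' i j)); [|easy].
  intros; now rewrite E, E'.
Qed.

Lemma pK_plus a a' b b' M L N K : pK a a' M L -> pK b b' N K ->
  pK (fun i j => a i j + b i j) (fun i j => a' i j + b' i j) (M + N) (L + K).
Proof.
intros (A & B & C) (A' & B' & C'); split; [|split].
- now apply kb_plus.
- now apply kb_plus.
- apply (kb_ext _ (fun i j => (a i j - a' i j) + (b i j - b' i j)));
    [intros; ring|].
  rewrite Rmult_plus_distr_r; now apply (kb_plus (fun i j => a i j - a' i j)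
    (fun i j => b i j - b' i j)).
Qed.

Lemma pK_scal c a a' M L : pK a a' M L ->
  pK (fun i j => c * a i j) (fun i j => c * a' i j) (Rabs c * M) (Rabs c * L).
Proof.
intros (A & B & C); split; [|split].
- now apply kb_scal.
- now apply kb_scal.
- apply (kb_ext _ (fun i j => c * (a i j - a' i j))); [intros; ring|].
  rewrite Rmult_assoc; now apply (kb_scal c (fun i j => a i j - a' i j)).
Qed.

Lemma pK_ktri s s' a a' b b' S T M L N K :
  pS s s' S T -> pK a a' M L -> pK b b' N K ->
  pK (ktri s a b) (ktri s' a' b') (S * (M * N))
     (T * (M * N) + (S * (L * N) + S * (M * K))).
Proof.
intros (A & B & C) (A' & B' & C') (A'' & B'' & C''); split; [|split].
- now apply kb_ktri.
- now apply kb_ktri.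
- apply (kb_ext _ (fun i j => ktri (fun m => s m - s' m) a b i j +
     (ktri s' (fun i j => a i j - a' i j) b i j +
      ktri s' a' (fun i j => b i j - b' i j) i j))).
  + intros i j; now apply (ktri_minus s s' a a' b b' S M N).
  + replace ((T * (M * N) + (S * (L * N) + S * (M * K))) * d)
      with ((T * d) * (M * N) + (S * ((L * d) * N) + S * (M * (K * d)))) by ring.
    apply kb_plus; [|apply kb_plus]; apply kb_ktri; auto.
Qed.

End Lipschitz.

(** * Lipschitz constants of the right-hand side *)

Lemma Rfun_kv dx rho X j :
  Rfun dx rho X j = dx * kv (ker_gamma X) (fun i => U X i * Dp dx (U X) i) j +
    dx * kv (ker_k X) (fun i => Dp dx (H X) i + rho * rbar X i) j.
Proof.
unfold Rfun, kv; f_equal; f_equal; apply sumZ_ext; intros; ring.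
Qed.

Lemma Qfun_kv dx rho X j :
  Qfun dx rho X j = dx * kv (ker_g X) (fun i => U X i * Dp dx (U X) i) j +
    dx * kv (ker_kappa X) (fun i => Dp dx (H X) i + rho * rbar X i) j.
Proof.
unfold Qfun, kv; f_equal; f_equal; apply sumZ_ext; intros; ring.
Qed.

Lemma ker_rhs_ktri dx (X : state) a b c e D M i j : (forall m, Rabs (Dp dx (U X) m) <= D) ->
  kb a M -> kb b M -> kb c M -> kb e M ->
  ker_rhs dx X a b c e i j =
  - dx * (ktri (Dp dx (U X)) a b i j + ktri (Dp dx (U X)) c e i j).
Proof.
intros HD Ka Kb Kc Ke; unfold ker_rhs, ktri.
assert (T1 := ktri_asum _ _ _ _ _ _ i j HD Ka (fun i j => kb_term _ _ i j Kb)).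
assert (T2 := ktri_asum _ _ _ _ _ _ i j HD Kc (fun i j => kb_term _ _ i j Ke)).
rewrite <- (sumZ_plus _ _ _ _ T1 T2).
rewrite Ropp_mult_distr_l; f_equal; apply sumZ_ext; intros; ring.
Qed.

Definition near (dx d : R) (X Y : state) (M L : R) : Prop :=
  pS d (zeta X) (zeta Y) M L /\ p2 d (Dp dx (zeta X)) (Dp dx (zeta Y)) M L /\
  p2 d (U X) (U Y) M L /\ pS d (H X) (H Y) M L /\
  p2 d (Dp dx (H X)) (Dp dx (H Y)) M L /\ p2 d (rbar X) (rbar Y) M L /\
  pK d (ker_g X) (ker_g Y) M L /\ pK d (ker_k X) (ker_k Y) M L /\
  pK d (ker_gamma X) (ker_gamma Y) M L /\ pK d (ker_kappa X) (ker_kappa Y) M L.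

Lemma pS_weak d v v' M L M' L' : 0 <= d -> M <= M' -> L <= L' ->
  pS d v v' M L -> pS d v v' M' L'.
Proof.
intros Hd H1 H2 (A & B & C); split; [|split]; intros j.
- generalize (A j); lra.
- generalize (B j); lra.
- generalize (C j); nra.
Qed.

Lemma p2_weak d v v' M L M' L' : 0 <= d -> M <= M' -> L <= L' ->
  p2 d v v' M L -> p2 d v v' M' L'.
Proof.
intros Hd H1 H2 (A & B & C); split; [|split].
- now apply (l2b_weak v M).
- now apply (l2b_weak v' M).
- apply (l2b_weak _ (L * d)); [nra|easy].
Qed.

Lemma pK_weak d a a' M L M' L' : 0 <= d -> M <= M' -> L <= L' ->
  pK d a a' M L -> pK d a a' M' L'.
Proof.
intros Hd H1 H2 (A & B & C); split; [|split].
- now apply (kb_weak a M).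
- now apply (kb_weak a' M).
- apply (kb_weak _ (L * d)); [nra|easy].
Qed.

(** [K] and [L] are existential variables that unification fills in while the rules above follow the
    structure of [Q]; being introduced before [X], [Y] and [d], they cannot depend on them. *)
Lemma Q_lip dx rho M : exists K L, forall X Y d, 0 <= d -> near dx d X Y M 1 ->
  p2 d (Qfun dx rho X) (Qfun dx rho Y) K L.
Proof.
eexists; eexists; intros X Y d Hd (Bz & Bdz & Bu & Bh & Bdh & Br & Kg & Kk & Ka & Kp).
eapply p2_ext; [intros j; symmetry; apply Qfun_kv|intros j; symmetry; apply Qfun_kv|].
apply p2_plus; apply p2_scal, p2_kv; try exact Kg; try exact Kp.
- apply p2_mult; [apply p2_pS; exact Bu|apply p2_Dp; exact Bu].
- apply p2_plus; [exact Bdh|apply p2_scal; exact Br].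
Qed.

Lemma R_lip dx rho M : exists K L, forall X Y d, 0 <= d -> near dx d X Y M 1 ->
  p2 d (Rfun dx rho X) (Rfun dx rho Y) K L.
Proof.
eexists; eexists; intros X Y d Hd (Bz & Bdz & Bu & Bh & Bdh & Br & Kg & Kk & Ka & Kp).
eapply p2_ext; [intros j; symmetry; apply Rfun_kv|intros j; symmetry; apply Rfun_kv|].
apply p2_plus; apply p2_scal, p2_kv; try exact Ka; try exact Kk.
- apply p2_mult; [apply p2_pS; exact Bu|apply p2_Dp; exact Bu].
- apply p2_plus; [exact Bdh|apply p2_scal; exact Br].
Qed.

Lemma ker_lip dx M : exists K L, forall (X Y : state) d a b c e a' b' c' e', 0 <= d ->
  near dx d X Y M 1 ->
  pK d a a' M 1 -> pK d b b' M 1 -> pK d c c' M 1 -> pK d e e' M 1 ->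
  pK d (ker_rhs dx X a b c e) (ker_rhs dx Y a' b' c' e') K L.
Proof.
eexists; eexists; intros X Y d a b c e a' b' c' e' Hd
  (_ & _ & Bu & _) Ka Kb Kc Ke.
assert (S := p2_pS _ _ _ _ _ (p2_Dp d dx _ _ _ _ Bu)).
eapply pK_ext.
- intros i j; apply (ker_rhs_ktri dx X a b c e _ M i j (proj1 S)); firstorder.
- intros i j; apply (ker_rhs_ktri dx Y a' b' c' e' _ M i j (proj1 (proj2 S)));
    firstorder.
- apply pK_scal, pK_plus; (apply pK_ktri; [exact S| |]); eassumption.
Qed.

Lemma near_rhs dx rho M : exists K L, 0 <= K /\ 0 <= L /\
  forall X Y d, 0 <= d -> near dx d X Y M 1 ->
  near dx d (state_rhs dx rho X) (state_rhs dx rho Y) K L.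
Proof.
destruct (Q_lip dx rho M) as (K1 & L1 & HQ).
destruct (R_lip dx rho M) as (K2 & L2 & HR).
destruct (ker_lip dx M) as (K3 & L3 & HK).
assert (E4 : exists K L, forall X Y d, 0 <= d -> near dx d X Y M 1 ->
  p2 d (Dp dx (U X)) (Dp dx (U Y)) K L).
{ eexists; eexists; intros X Y d Hd (_ & _ & Bu & _); apply p2_Dp; exact Bu. }
destruct E4 as (K4 & L4 & HDU).
assert (E5 : exists K L, forall X Y d, 0 <= d -> near dx d X Y M 1 ->
  p2 d (fun j => - (U X j * Rfun dx rho X (j - 1)%Z))
       (fun j => - (U Y j * Rfun dx rho Y (j - 1)%Z)) K L).
{ eexists; eexists; intros X Y d Hd N; assert (NR := HR X Y d Hd N).
  destruct N as (_ & _ & Bu & _).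
  apply p2_opp, p2_mult; [apply p2_pS; exact Bu|apply p2_prev; exact NR]. }
destruct E5 as (K5 & L5 & HH).
assert (E6 : exists K L, forall X Y d, 0 <= d -> near dx d X Y M 1 ->
  p2 d (Dp dx (fun j => - (U X j * Rfun dx rho X (j - 1)%Z)))
       (Dp dx (fun j => - (U Y j * Rfun dx rho Y (j - 1)%Z))) K L).
{ eexists; eexists; intros X Y d Hd N; apply p2_Dp, HH; auto. }
destruct E6 as (K6 & L6 & HDH).
assert (E7 : exists K L, forall X Y d, 0 <= d -> near dx d X Y M 1 ->
  p2 d (fun j => - (rho * Dp dx (U X) j)) (fun j => - (rho * Dp dx (U Y) j)) K L).
{ eexists; eexists; intros X Y d Hd N; apply p2_opp, p2_scal, HDU; auto. }
destruct E7 as (K7 & L7 & Hr).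
exists (Rabs M + Rabs K1 + Rabs K3 + Rabs K4 + Rabs K5 + Rabs K6 + Rabs K7),
  (1 + Rabs L1 + Rabs L3 + Rabs L4 + Rabs L5 + Rabs L6 + Rabs L7).
assert (HA := fun x => conj (Rabs_pos x) (Rle_abs x)).
generalize (HA M) (HA K1) (HA K3) (HA K4) (HA K5) (HA K6) (HA K7) (HA L1) (HA L3)
  (HA L4) (HA L5) (HA L6) (HA L7); intros.
split; [lra|split; [lra|]]; intros X Y d Hd N; assert (N0 := N).
destruct N as (Bz & Bdz & Bu & Bh & Bdh & Br & Kg & Kk & Ka & Kp).
unfold near; cbn [ev zeta U Defs.H rbar ker_g ker_k ker_gamma ker_kappa state_rhs].
split; [|split; [|split; [|split; [|split; [|split; [|split; [|split; [|split]]]]]]]].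
- apply (pS_weak d _ _ M 1); try lra; now apply p2_pS.
- apply (p2_weak d _ _ K4 L4); try lra; auto.
- apply (p2_weak d _ _ (Rabs (-1) * K1) (Rabs (-1) * L1));
    rewrite ?(Rabs_left (-1)) by lra; try lra.
  rewrite <- (Rabs_left (-1)) by lra; apply p2_opp; auto.
- apply (pS_weak d _ _ K5 L5); try lra; apply p2_pS; auto.
- apply (p2_weak d _ _ K6 L6); try lra; auto.
- apply (p2_weak d _ _ K7 L7); try lra; auto.
- apply (pK_weak d _ _ K3 L3); try lra; auto.
- apply (pK_weak d _ _ K3 L3); try lra; auto.
- apply (pK_weak d _ _ K3 L3); try lra; auto.
- apply (pK_weak d _ _ K3 L3); try lra; auto.
Qed.

Lemma Dp_minus dx v w j :
  Dp dx (fun j => v j - w j) j = Dp dx v j - Dp dx w j.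
Proof. unfold Dp, Rdiv; ring. Qed.

Lemma near_intro dx d x y M : bndX dx x M -> bndX dx y M ->
  bndX dx (fun i => x i - y i) d -> near dx d (unflat x) (unflat y) M 1.
Proof.
intros A B C; apply bnd_nrm in A; apply bnd_nrm in B; apply bnd_nrm in C.
unfold near, pS, p2, pK, nrm in *; simpl in *; rewrite Rmult_1_l.
repeat match goal with K : _ /\ _ |- _ => destruct K end.
repeat match goal with |- _ /\ _ => split end; auto.
- apply (l2b_ext (Dp dx (fun j => x (Iz j) - y (Iz j)))); [|easy].
  intros; apply Dp_minus.
- apply (l2b_ext (Dp dx (fun j => x (Ih j) - y (Ih j)))); [|easy].
  intros; apply Dp_minus.
Qed.

Lemma near_elim dx d x y M L : near dx d (unflat x) (unflat y) M L ->
  bndX dx x M /\ bndX dx (fun i => x i - y i) (L * d).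
Proof.
intros A; rewrite !bnd_nrm; unfold near, pS, p2, pK, nrm in *; simpl in *.
repeat match goal with K : _ /\ _ |- _ => destruct K end.
split; repeat match goal with |- _ /\ _ => split end; auto.
- apply (l2b_ext (fun j => Dp dx (fun j => x (Iz j)) j - Dp dx (fun j => y (Iz j)) j));
    [|easy]; intros; symmetry; apply Dp_minus.
- apply (l2b_ext (fun j => Dp dx (fun j => x (Ih j)) j - Dp dx (fun j => y (Ih j)) j));
    [|easy]; intros; symmetry; apply Dp_minus.
Qed.

Lemma unflat_rhs dx rho x : unflat (rhs dx rho x) = state_rhs dx rho (unflat x).
Proof. apply unflat_flat. Qed.

Lemma bndX_zero dx x : bndX dx (fun i => x i - x i) 0.
Proof.
intros w Hw.
rewrite finlin_minus, Rminus_diag, Rabs_R0 by (now apply functionals_finlin in Hw).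
lra.
Qed.

(** Boundedness is the case [d = 0] of the Lipschitz rules, applied to the pair [(x, x)]. *)
Lemma rhs_bnd dx rho M :
  exists K, 0 <= K /\ forall x, bndX dx x M -> bndX dx (rhs dx rho x) K.
Proof.
destruct (near_rhs dx rho M) as (K & L & HK & HL & N).
exists K; split; [easy|]; intros x B.
apply (near_elim dx 0 _ (rhs dx rho x) K L); rewrite unflat_rhs; apply N; [lra|].
apply near_intro; try easy; apply bndX_zero.
Qed.

Lemma rhs_lip dx rho M : exists L, 0 <= L /\ forall x y d,
  0 <= d -> bndX dx x M -> bndX dx y M -> bndX dx (fun i => x i - y i) d ->
  bndX dx (fun i => rhs dx rho x i - rhs dx rho y i) (L * d).
Proof.
destruct (near_rhs dx rho M) as (K & L & HK & HL & N).
exists L; split; [easy|]; intros x y d Hd A B C.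
apply (near_elim dx d _ _ K L); rewrite !unflat_rhs; apply N; [easy|now apply near_intro].
Qed.

(** * The discrete Green's functions *)

Lemma incr_chain (f : Z -> R) k m : (forall j, (k <= j < m)%Z -> f j <= f (j + 1)%Z) ->
  (k <= m)%Z -> f k <= f m.
Proof.
intros E L.
assert (P : forall n : nat, (k + Z.of_nat n <= m)%Z -> f k <= f (k + Z.of_nat n)%Z).
{ induction n as [|n IHn]; intros Hn.
  - replace (k + Z.of_nat 0)%Z with k by lia; lra.
  - apply Rle_trans with (f (k + Z.of_nat n)%Z); [apply IHn; lia|].
    replace (k + Z.of_nat (S n))%Z with (k + Z.of_nat n + 1)%Z by lia.
    apply E; lia. }
specialize (P (Z.to_nat (m - k))).
replace (k + Z.of_nat (Z.to_nat (m - k)))%Z with m in P by lia; apply P; lia.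
Qed.

Lemma incr_right (f : Z -> R) k (l : R) :
  (forall j, (k <= j)%Z -> f j <= f (j + 1)%Z) ->
  is_lim_seq (fun n => f (Z.of_nat n)) l -> forall j, (k <= j)%Z -> f j <= l.
Proof.
intros E L j Hj.
apply (is_lim_seq_le_loc (fun _ => f j) (fun n => f (Z.of_nat n)) (f j) l).
- exists (Z.abs_nat j); intros n Hn; apply incr_chain; [|lia].
  intros; apply E; lia.
- apply is_lim_seq_const.
- easy.
Qed.

Lemma incr_left (f : Z -> R) k (l : R) :
  (forall j, (j < k)%Z -> f j <= f (j + 1)%Z) ->
  is_lim_seq (fun n => f (- Z.of_nat n)%Z) l -> forall j, (j <= k)%Z -> l <= f j.
Proof.
intros E L j Hj.
apply (is_lim_seq_le_loc (fun n => f (- Z.of_nat n)%Z) (fun _ => f j) l (f j)).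
- exists (Z.abs_nat j); intros n Hn; apply incr_chain; [|lia].
  intros; apply E; lia.
- easy.
- apply is_lim_seq_const.
Qed.

Definition vanishing (v : Z -> R) : Prop :=
  is_lim_seq (fun n => v (Z.of_nat n)) 0 /\ is_lim_seq (fun n => v (- Z.of_nat n)%Z) 0.

Lemma vanishing_product u v : vanishing u -> vanishing v ->
  vanishing (fun j => u (j + 1)%Z * v j).
Proof.
intros [U1 U2] [V1 V2]; split.
- replace (Finite 0) with (Finite (0 * 0)) by (f_equal; ring).
  apply is_lim_seq_mult'; [|easy].
  apply is_lim_seq_incr_1 in U1; apply is_lim_seq_ext with (2 := U1).
  intros; f_equal; lia.
- replace (Finite 0) with (Finite (0 * 0)) by (f_equal; ring).
  apply is_lim_seq_mult'; [|easy].
  apply is_lim_seq_incr_1; apply is_lim_seq_ext with (2 := U2).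
  intros; f_equal; lia.
Qed.

Lemma vanishing_reflect u : vanishing u -> vanishing (fun j => u (- j)%Z).
Proof.
intros [U1 U2]; split; [easy|].
apply is_lim_seq_ext with (2 := U1); intros; f_equal; lia.
Qed.

Lemma vanishing_opp u : vanishing u -> vanishing (fun j => - u j).
Proof.
assert (K : forall f : nat -> R, is_lim_seq f 0 -> is_lim_seq (fun n => - f n) 0).
{ intros f Hf; replace (Finite 0) with (Rbar_opp 0) by (simpl; f_equal; ring).
  now apply is_lim_seq_opp in Hf. }
intros [U1 U2]; split; now apply K.
Qed.

(** [u] and [v] stand for the rows [g_i] and [gamma_i], and [a] for [D_+ y]. In the continuous limit
    and in the variable [y] the equations read [u - v_y = delta], [u_y = v], with decaying solution
    [u = exp (- |y - y_i|) / 2]. Its sign, monotonicity and mass are recovered below although [a]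
    may vanish. *)
Section Green.

Variables (dx : R) (a : Z -> R).
Hypothesis Hdx : 0 < dx.
Hypothesis Ha : forall j, 0 <= a j.

Variables (i : Z) (u v : Z -> R).
Hypothesis Hv : forall j, a j * u j - Dm dx v j = kron i j / dx.
Hypothesis Hu : forall j, Dp dx u j = a j * v j.
Hypothesis Lu : vanishing u.
Hypothesis Lv : vanishing v.

Lemma green_v j : v j = v (j - 1)%Z + dx * (a j * u j) - kron i j.
Proof.
assert (E := Hv j); unfold Dm in E.
replace (a j * u j) with (kron i j / dx + (v j - v (j - 1)%Z) / dx) by lra.
field; lra.
Qed.

Lemma green_v_next j : v (j + 1)%Z
  = v j + dx * (a (j + 1)%Z * u (j + 1)%Z) - kron i (j + 1).
Proof. rewrite green_v; replace (j + 1 - 1)%Z with j by lia; reflexivity. Qed.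

Lemma green_u j : u (j + 1)%Z = u j + dx * (a j * v j).
Proof. rewrite <- Hu; unfold Dp; field; lra. Qed.

(** The staggering of [u] against [v] makes the product rule exact, without an error term in
    [dx]. *)
Definition flux j := u (j + 1)%Z * v j.

Lemma flux_next j : flux (j + 1) = flux j
  + dx * (a (j + 1)%Z * (u (j + 1)%Z ^ 2 + v (j + 1)%Z ^ 2))
  - kron i (j + 1) * u (j + 1)%Z.
Proof.
unfold flux; rewrite green_u; assert (E := green_v_next j).
replace (v j) with
  (v (j + 1)%Z - dx * (a (j + 1)%Z * u (j + 1)%Z) + kron i (j + 1)) by lra; ring.
Qed.

Lemma energy_density_ge0 j : 0 <= dx * (a j * (u j ^ 2 + v j ^ 2)).
Proof. apply Rmult_le_pos; [lra|apply Rmult_le_pos; [apply Ha|nra]]. Qed.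

Lemma flux_le0 j : (i <= j)%Z -> flux j <= 0.
Proof.
apply incr_right; [|apply (vanishing_product u v Lu Lv)].
intros k Hk; rewrite flux_next, kron_diff by lia.
generalize (energy_density_ge0 (k + 1)); lra.
Qed.

Lemma flux_ge0 j : (j < i)%Z -> 0 <= flux j.
Proof.
intros Hj; apply (incr_left flux (i - 1)); [| |lia].
- intros k Hk; rewrite flux_next, kron_diff by lia.
  generalize (energy_density_ge0 (k + 1)); lra.
- apply (vanishing_product u v Lu Lv).
Qed.

(** At the diagonal the flux jumps by the energy density minus [u i], and it jumps from a
    nonnegative to a nonpositive value. *)
Lemma green_diag_ge0 : 0 <= u i.
Proof.
assert (E := flux_next (i - 1)); replace (i - 1 + 1)%Z with i in E by lia.
rewrite kron_same in E.
generalize (flux_le0 i ltac:(lia)) (flux_ge0 (i - 1) ltac:(lia))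
  (energy_density_ge0 i); lra.
Qed.

Lemma dxa_ge0 j : 0 <= dx * a j.
Proof. apply Rmult_le_pos; [lra|apply Ha]. Qed.

(** Induction away from the diagonal on both sides: if the next value of [u] were negative, the sign
    of the flux would determine the sign of the factor [v], and the recursion would then contradict
    the value already known to be nonnegative. *)
Lemma green_u_ge0 j : 0 <= u j.
Proof.
assert (Up : forall n : nat, 0 <= u (i + Z.of_nat n)%Z).
{ induction n as [|n IHn].
  - replace (i + Z.of_nat 0)%Z with i by lia; apply green_diag_ge0.
  - replace (i + Z.of_nat (S n))%Z with (i + Z.of_nat n + 1)%Z by lia.
    assert (Q := flux_le0 (i + Z.of_nat n) ltac:(lia)); unfold flux in Q.
    assert (E := green_u (i + Z.of_nat n)).
    assert (D := dxa_ge0 (i + Z.of_nat n)).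
    destruct (Rle_dec 0 (u (i + Z.of_nat n + 1)%Z)) as [|N]; [easy|].
    assert (0 <= v (i + Z.of_nat n)%Z) by nra.
    assert (0 <= dx * a (i + Z.of_nat n)%Z * v (i + Z.of_nat n)%Z)
      by now apply Rmult_le_pos.
    lra. }
assert (Down : forall n : nat, 0 <= u (i - Z.of_nat n)%Z).
{ induction n as [|n IHn].
  - replace (i - Z.of_nat 0)%Z with i by lia; apply green_diag_ge0.
  - pose (m := (i - Z.of_nat (S n))%Z).
    replace (i - Z.of_nat n)%Z with (m + 1)%Z in IHn by (unfold m; lia).
    fold m; destruct (Rle_dec 0 (u m)) as [|N]; [easy|].
    assert (Q := flux_ge0 (m - 1) ltac:(unfold m; lia)); unfold flux in Q.
    replace (m - 1 + 1)%Z with m in Q by lia.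
    assert (Ev := green_v m); rewrite kron_diff in Ev by (unfold m; lia).
    assert (Eu := green_u m); assert (D := dxa_ge0 m).
    assert (v (m - 1)%Z <= 0) by nra.
    assert (0 <= dx * a m * (- u m)) by (apply Rmult_le_pos; lra).
    assert (0 <= dx * a m * (- v m)) by (apply Rmult_le_pos; lra).
    lra. }
destruct (Z_le_dec i j).
- replace j with (i + Z.of_nat (Z.to_nat (j - i)))%Z by lia; apply Up.
- replace j with (i - Z.of_nat (Z.to_nat (i - j)))%Z by lia; apply Down.
Qed.

Lemma dxau_ge0 j : 0 <= dx * (a j * u j).
Proof. rewrite <- Rmult_assoc; apply Rmult_le_pos; [apply dxa_ge0|apply green_u_ge0]. Qed.

Lemma green_v_le0 j : (i <= j)%Z -> v j <= 0.
Proof.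
apply incr_right; [|apply Lv]; intros k Hk.
rewrite green_v_next, kron_diff by lia; generalize (dxau_ge0 (k + 1)); lra.
Qed.

Lemma green_v_ge0 j : (j < i)%Z -> 0 <= v j.
Proof.
intros Hj; apply (incr_left v (i - 1)); [|apply Lv|lia]; intros k Hk.
rewrite green_v_next, kron_diff by lia; generalize (dxau_ge0 (k + 1)); lra.
Qed.

(* [v] is monotone off [i] and jumps there by at least -1, from a nonnegative
   to a nonpositive value. *)
Lemma green_v_bound j : Rabs (v j) <= 1.
Proof.
assert (E := green_v i); rewrite kron_same in E.
assert (A := dxau_ge0 i); assert (B := green_v_le0 i ltac:(lia)).
assert (C := green_v_ge0 (i - 1) ltac:(lia)).
destruct (Z_le_dec i j).
- assert (v i <= v j).
  { apply incr_chain; [|easy]; intros k Hk; rewrite green_v_next, kron_diff by lia.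
    generalize (dxau_ge0 (k + 1)); lra. }
  generalize (green_v_le0 j ltac:(lia)); intros; apply Rabs_le; lra.
- assert (v j <= v (i - 1)%Z).
  { apply incr_chain; [|lia]; intros k Hk; rewrite green_v_next, kron_diff by lia.
    generalize (dxau_ge0 (k + 1)); lra. }
  generalize (green_v_ge0 j ltac:(lia)); intros; apply Rabs_le; lra.
Qed.

Lemma green_u_decr j : (i <= j)%Z -> u (j + 1)%Z <= u j.
Proof.
intros Hj; rewrite green_u; assert (A := dxa_ge0 j).
assert (B := green_v_le0 j Hj).
assert (0 <= dx * a j * (- v j)) by (apply Rmult_le_pos; lra); lra.
Qed.

Lemma green_u_incr j : (j < i)%Z -> u j <= u (j + 1)%Z.
Proof.
intros Hj; rewrite green_u; assert (A := dxa_ge0 j).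
assert (B := green_v_ge0 j Hj).
assert (0 <= dx * a j * v j) by (apply Rmult_le_pos; lra); lra.
Qed.

Lemma green_u_decr_le j k : (i <= j <= k)%Z -> u k <= u j.
Proof.
intros Hj; assert (- u j <= - u k); [|lra].
apply (incr_chain (fun j => - u j)); [|lia].
intros m Hm; generalize (green_u_decr m ltac:(lia)); lra.
Qed.

Lemma green_u_le_diag j : u j <= u i.
Proof.
destruct (Z_le_dec i j); [apply green_u_decr_le; lia|].
apply incr_chain; [|lia]; intros k Hk; apply green_u_incr; lia.
Qed.

Lemma green_energy n : dx * psum (fun j => a j * (u j ^ 2 + v j ^ 2)) n <= u i.
Proof.
(* The window is enlarged past the diagonal, so that the boundary fluxes lie on the two sides of [i]
   and have favourable signs. *)
pose (m := (n + S (Z.abs_nat i))%nat).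
apply Rle_trans with (dx * psum (fun j => a j * (u j ^ 2 + v j ^ 2)) m).
{ apply Rmult_le_compat_l; [lra|]; apply psum_mono; [|unfold m; lia].
  intros j; apply Rmult_le_pos; [apply Ha|nra]. }
rewrite <- psum_scal.
rewrite (psum_ext _ (fun j => (flux (j + 1 - 1) - flux (j - 1)) + kron i j * u j)).
- rewrite psum_plus, (psum_telescope (fun j => flux (j - 1))), psum_kron.
  assert (A := flux_le0 (Z.of_nat m - 1) ltac:(unfold m; lia)).
  assert (B := flux_ge0 (- Z.of_nat m - 1) ltac:(unfold m; lia)).
  destruct Z_le_dec; [destruct Z_lt_dec|]; unfold m in *; try lia; lra.
- intros j; replace (j + 1 - 1)%Z with (j - 1 + 1)%Z by lia.
  rewrite flux_next; replace (j - 1 + 1)%Z with j by lia; ring.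
Qed.

Lemma green_mass n : dx * psum (fun j => a j * u j) n <= 1.
Proof.
pose (m := (n + S (Z.abs_nat i))%nat).
apply Rle_trans with (dx * psum (fun j => a j * u j) m).
{ apply Rmult_le_compat_l; [lra|]; apply psum_mono; [|unfold m; lia].
  intros j; apply Rmult_le_pos; [apply Ha|apply green_u_ge0]. }
rewrite <- psum_scal.
rewrite (psum_ext _ (fun j => (v (j + 1 - 1)%Z - v (j - 1)%Z) + kron i j * 1)).
- rewrite psum_plus, (psum_telescope (fun j => v (j - 1)%Z)).
  rewrite (psum_kron i (fun _ => 1)).
  assert (A := green_v_le0 (Z.of_nat m - 1) ltac:(unfold m; lia)).
  assert (B := green_v_ge0 (- Z.of_nat m - 1) ltac:(unfold m; lia)).
  destruct Z_le_dec; [destruct Z_lt_dec|]; unfold m in *; try lia; lra.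
- intros j; replace (j + 1 - 1)%Z with j by lia.
  rewrite (green_v j) at 1; ring.
Qed.

Lemma green_variation n : dx * psum (fun j => a j * Rabs (v j)) n <= 2 * u i.
Proof.
(* Reflecting [u] at its maximum turns its total variation into a single telescoping sum. *)
pose (P j := if Z_le_dec j i then u j else 2 * u i - u j).
rewrite <- psum_scal, (psum_ext _ (fun j => P (j + 1)%Z - P j)).
- rewrite psum_telescope.
  assert (B : forall j, 0 <= P j <= 2 * u i).
  { intros j; unfold P; generalize (green_u_ge0 j) (green_u_le_diag j).
    destruct Z_le_dec; lra. }
  generalize (B (Z.of_nat n)) (B (- Z.of_nat n)%Z); lra.
- intros j; unfold P; destruct (Z_le_dec (j + 1) i) as [L|L];
    destruct (Z_le_dec j i) as [L'|L']; try lia; rewrite green_u.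
  + rewrite Rabs_pos_eq by (apply green_v_ge0; lia); ring.
  + replace i with j by lia; rewrite Rabs_left1 by (apply green_v_le0; lia); ring.
  + rewrite Rabs_left1 by (apply green_v_le0; lia); ring.
Qed.

(** * The diagonal value and the l^1 sums of the Green's functions *)

Variables (y : Z -> R) (Zb : R).
Hypothesis Hy : forall j, y (j + 1)%Z - y j = dx * a j.
Hypothesis HyZ : forall j, Rabs (y j - IZR j * dx) <= Zb.

(** Since [|v| <= 1], [u] is 1-Lipschitz with respect to [y]. *)
Lemma green_slope j : (i <= j)%Z -> u i - u j <= y j - y i.
Proof.
intros Hj; assert (u i + y i <= u j + y j); [|lra].
apply (incr_chain (fun j => u j + y j)); [|easy]; intros k Hk.
rewrite green_u; assert (E := Hy k); assert (A := dxa_ge0 k).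
assert (B := green_v_bound k); apply Rabs_le_between in B.
assert (0 <= dx * a k * (1 + v k)) by (apply Rmult_le_pos; lra); lra.
Qed.

(** The mass of [a u] between [i] and [j] is at most 1, and [u >= u j] on that window. *)
Lemma green_window j : (i <= j)%Z -> u j * (y (j + 1)%Z - y i) <= 1.
Proof.
intros Hj.
assert (v i - u j * y (i + 1)%Z <= v j - u j * y (j + 1)%Z).
{ apply (incr_chain (fun m => v m - u j * y (m + 1)%Z)); [|easy]; intros k Hk.
  rewrite green_v_next, kron_diff by lia; assert (E := Hy (k + 1)%Z).
  assert (A := dxa_ge0 (k + 1)); assert (B := green_u_decr_le (k + 1) j ltac:(lia)).
  assert (dx * a (k + 1)%Z * u j <= dx * a (k + 1)%Z * u (k + 1)%Z)
    by now apply Rmult_le_compat_l.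
  nra. }
assert (E := green_v i); rewrite kron_same in E.
assert (A := dxa_ge0 i); assert (B := green_u_decr_le i j ltac:(lia)).
assert (dx * a i * u j <= dx * a i * u i) by now apply Rmult_le_compat_l.
assert (C := green_v_ge0 (i - 1) ltac:(lia)); assert (D := green_v_le0 j Hj).
specialize (Hy i); nra.
Qed.

Lemma green_diag_bound : u i <= 2 + 4 * Zb.
Proof.
assert (HZ : 0 <= Zb).
{ eapply Rle_trans; [apply Rabs_pos|apply (HyZ 0)]. }
(* The shortest window over which [y], staying within [Zb] of the grid, is forced to grow by more
   than 1; [green_window] then gives [u J <= 1]. The slope bound is applied over [N - 1] steps only,
   of total length at most [1 + 2 Zb], which keeps [dx] out of the result
   [1 + (1 + 2 Zb) + 2 Zb]. *)
pose (N := up ((1 + 2 * Zb) / dx)).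
destruct (archimed ((1 + 2 * Zb) / dx)) as [A1 A2]; fold N in A1, A2.
assert (P : 0 < (1 + 2 * Zb) / dx) by (apply Rdiv_lt_0_compat; lra).
assert (HN : (0 < N)%Z) by (apply lt_IZR; simpl; lra).
assert (B1 : 1 + 2 * Zb < IZR N * dx).
{ apply (Rmult_gt_compat_r dx) in A1; [|lra].
  replace ((1 + 2 * Zb) / dx * dx) with (1 + 2 * Zb) in A1 by (field; lra); lra. }
assert (B2 : (IZR N - 1) * dx <= 1 + 2 * Zb).
{ assert (A3 : IZR N - 1 <= (1 + 2 * Zb) / dx) by lra.
  apply (Rmult_le_compat_r dx) in A3; [|lra].
  replace ((1 + 2 * Zb) / dx * dx) with (1 + 2 * Zb) in A3 by (field; lra); lra. }
pose (J := (i + N - 1)%Z).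
assert (W := green_window J ltac:(unfold J; lia)).
assert (S := green_slope J ltac:(unfold J; lia)).
assert (U0 := green_u_ge0 J).
assert (Y0 := HyZ i); assert (Y1 := HyZ J); assert (Y2 := HyZ (J + 1)).
apply Rabs_le_between in Y0; apply Rabs_le_between in Y1;
  apply Rabs_le_between in Y2.
replace (J + 1)%Z with (i + N)%Z in W, Y2 by (unfold J; lia).
rewrite plus_IZR in Y2; unfold J in Y1; rewrite minus_IZR, plus_IZR in Y1.
fold J in Y1; nra.
Qed.

Variable Pb : R.
Hypothesis HP : forall n, psum (fun j => (a j - 1) ^ 2) n <= Pb.

(* Either [a >= 1/2] or [(a - 1)^2 >= 1/4]. *)
Lemma le_weighted w j : 0 <= w -> w <= 2 * (a j * w) + 4 * ((a j - 1) ^ 2 * w).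
Proof.
intros Hw; assert (S := pow2_ge_0 (a j - 3 / 4)).
assert (1 <= 2 * a j + 4 * (a j - 1) ^ 2) by lra.
assert (0 <= w * (2 * a j + 4 * (a j - 1) ^ 2 - 1)) by (apply Rmult_le_pos; lra); lra.
Qed.

(** The weight [a] may vanish, but square summability of [a - 1] leaves room for at most [Pb] zeros.
    The resulting l^1 bounds depend on [dx]; they keep the kernels in [nrm] during continuation and
    do not enter the growth rate. *)
Lemma psum_weighted w A B n : (forall j, 0 <= w j <= B) ->
  dx * psum (fun j => a j * w j) n <= A ->
  psum w n <= 2 * (A / dx) + 4 * (Pb * B).
Proof.
intros Hw HA.
eapply Rle_trans; [apply psum_le; intros j; apply (le_weighted (w j) j), Hw|].
rewrite psum_plus, !psum_scal.
apply Rplus_le_compat.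
- apply Rmult_le_compat_l; [lra|].
  apply (Rmult_le_reg_l dx); [easy|]; replace (dx * (A / dx)) with A by (field; lra).
  easy.
- apply Rmult_le_compat_l; [lra|].
  apply Rle_trans with (psum (fun j => B * (a j - 1) ^ 2) n).
  + apply psum_le; intros j; rewrite (Rmult_comm B).
    apply Rmult_le_compat_l; [apply pow2_ge_0|apply Hw].
  + rewrite psum_scal, Rmult_comm; apply Rmult_le_compat_r; [|apply HP].
    generalize (Hw 0%Z); lra.
Qed.

Lemma green_u_sum : asum u (2 * (1 / dx) + 4 * (Pb * (2 + 4 * Zb))).
Proof.
intros n; apply psum_weighted.
- intros j; rewrite Rabs_pos_eq by apply green_u_ge0.
  generalize (green_u_ge0 j) (green_u_le_diag j) green_diag_bound; lra.
- rewrite (psum_ext _ (fun j => a j * u j)); [apply green_mass|].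
  intros; rewrite Rabs_pos_eq; [easy|apply green_u_ge0].
Qed.

Lemma green_v_sum : asum v (2 * (2 * (2 + 4 * Zb) / dx) + 4 * (Pb * 1)).
Proof.
intros n; apply psum_weighted.
- intros j; split; [apply Rabs_pos|apply green_v_bound].
- eapply Rle_trans; [apply green_variation|generalize green_diag_bound; lra].
Qed.

End Green.

(** * Identities for R and Q *)

Lemma clamp_continuity f t : 0 <= t ->
  (forall r, 0 <= r <= t -> exists l, deriv_at f r l) ->
  continuity (fun s => f (Rmax 0 (Rmin s t))).
Proof.
intros Ht D s eps He.
pose (r := Rmax 0 (Rmin s t)).
assert (Hr : 0 <= r <= t).
{ unfold r, Rmax, Rmin; repeat destruct Rle_dec; lra. }
destruct (D r Hr) as [l Dl]; apply deriv_at_lim in Dl.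
destruct (Dl (fun z => Rabs (z - f r) < eps)) as [d Hd].
{ exists (mkposreal eps He); intros z Hz; exact Hz. }
exists d; split; [apply cond_pos|]; intros z [[_ Nz] Hz].
unfold Rdist in *; simpl in *; unfold Rdist in *; fold r.
destruct (Req_dec (Rmax 0 (Rmin z t)) r) as [->|N].
- rewrite Rminus_diag, Rabs_R0; easy.
- apply Hd; [|easy|apply Rmax_l].
  change (Rabs (Rmax 0 (Rmin z t) - r) < d); eapply Rle_lt_trans; [|exact Hz].
  unfold r, Rmax, Rmin; repeat destruct Rle_dec; unfold Rabs;
    repeat destruct Rcase_abs; lra.
Qed.

(** [f^2 exp (2 L t)] is nondecreasing, so [f] has no zero, and the intermediate value theorem
    preserves its sign. Working with the square avoids presupposing the sign. *)
Lemma stays_positive f f' T L : 0 <= L ->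
  (forall t, 0 <= t < T -> deriv_at f t (f' t)) ->
  (forall t, 0 <= t < T -> Rabs (f' t) <= L * Rabs (f t)) ->
  0 < f 0 -> forall t, 0 <= t < T -> 0 < f t.
Proof.
intros HL D B H0.
assert (NZ : forall t, 0 <= t < T -> f t <> 0).
{ intros t Ht E.
  assert (Dexp : forall r, deriv_at (fun s => exp (2 * L * s)) r (2 * L * exp (2 * L * r))).
  { intros r; apply is_derive_deriv_at; auto_derive; [easy|ring]. }
  assert (Q : - (f t ^ 2 * exp (2 * L * t)) - - (f 0 ^ 2 * exp (2 * L * 0)) <= 0 - 0).
  { apply (mean_value_le (fun s => - (f s ^ 2 * exp (2 * L * s)))
      (fun s => - (2 * f s * f' s * exp (2 * L * s)
                   + f s ^ 2 * (2 * L * exp (2 * L * s)))) (fun _ => 0) (fun _ => 0)).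
    - lra.
    - intros r Hr; apply deriv_at_opp.
      apply (deriv_at_mult (fun s => f s ^ 2) (fun s => exp (2 * L * s))); [|apply Dexp].
      apply deriv_at_sqr, D; lra.
    - intros r; apply (is_derive_const 0).
    - intros r Hr; specialize (B r ltac:(lra)).
      assert (He := exp_pos (2 * L * r)).
      assert (0 <= f r * f' r + L * f r ^ 2).
      { rewrite <- (pow2_abs (f r)).
        assert (Rabs (f r * f' r) <= L * Rabs (f r) ^ 2).
        { rewrite Rabs_mult; generalize (Rabs_pos (f r)); nra. }
        apply Rabs_le_between in H; lra. }
      assert (0 <= (f r * f' r + L * f r ^ 2) * exp (2 * L * r))
        by (apply Rmult_le_pos; lra); lra. }
  rewrite E, Rmult_0_r, exp_0 in Q; nra. }
intros t Ht; destruct (Rlt_dec 0 (f t)) as [|N]; [easy|exfalso].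
assert (C := clamp_continuity f t (proj1 Ht)
  (fun r Hr => ex_intro _ _ (D r ltac:(lra)))).
destruct (IVT_gen _ 0 t 0 C) as [x [Hx Ex]].
- rewrite (Rmin_left 0 t), (Rmin_left t t), (Rmax_right 0 t), (Rmax_left 0 0) by lra.
  rewrite Rmin_right, Rmax_left by lra; lra.
- apply (NZ (Rmax 0 (Rmin x t))); [|exact Ex].
  unfold Rmax, Rmin; repeat destruct Rle_dec; lra.
Qed.

Definition avec (dx : R) (X : state) (j : Z) : R := Dp dx (ypos dx X) j.

Lemma avec_zeta dx (X : state) j : dx <> 0 -> avec dx X j = 1 + Dp dx (zeta X) j.
Proof.
intros; unfold avec, Dp, ypos; rewrite plus_IZR; field; easy.
Qed.

Definition B_kernel (dx : R) (X : state) : Prop := forall i j : Z,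
  avec dx X j * ker_g X i j - Dm dx (ker_gamma X i) j = kron i j / dx /\
  Dp dx (ker_g X i) j = avec dx X j * ker_gamma X i j /\
  avec dx X j * ker_k X i j - Dp dx (ker_kappa X i) j = kron i j / dx /\
  Dm dx (ker_k X i) j = avec dx X j * ker_kappa X i j /\
  ker_g X j i = ker_g X i j /\ ker_k X j i = ker_k X i j /\
  ker_gamma X j i = - ker_kappa X i j.

Lemma kron_sym i j : kron i j = kron j i.
Proof. unfold kron; repeat destruct Z.eq_dec; lia || lra. Qed.

(** The relations (a) hold for every first index, so they can be applied under the sum; the
    Kronecker delta in the relation of [g] returns the source [U D_+ U] at [j]. In [Dp_Q] the delta
    comes from [k] and returns the other source. *)
Lemma Dm_R dx rho (X : state) M j : 0 < dx -> nrm dx X M -> B_kernel dx X ->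
  Dm dx (Rfun dx rho X) j
    = avec dx X j * Qfun dx rho X j - U X j * Dp dx (U X) j.
Proof.
intros Hdx (Bz & Bdz & Bu & Bh & Bdh & Br & Kg & Kk & Ka & Kp) BK.
unfold Dm; rewrite !Rfun_kv, Qfun_kv.
pose (v i := U X i * Dp dx (U X) i); pose (w i := Dp dx (H X) i + rho * rbar X i).
fold v w.
assert (Bv : exists V, forall i, Rabs (v i) <= V).
{ eexists; intros i; apply (l2b_term v), l2b_mult_bd;
    [intros j'; apply (l2b_term _ _ _ Bu)|apply l2b_Dp, Bu]. }
assert (Bw : exists V, forall i, Rabs (w i) <= V).
{ eexists; intros i; apply (l2b_term w), l2b_plus; [apply Bdh|].
  apply l2b_scal, Br. }
destruct Bv as [V Bv]; destruct Bw as [V' Bw].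
assert (E1 : kv (ker_gamma X) v j - kv (ker_gamma X) v (j - 1)
             = dx * avec dx X j * kv (ker_g X) v j - v j).
{ unfold kv; rewrite <- (sumZ_minus _ _ (V * M) (V * M)) by now apply kv_asum.
  rewrite <- (sumZ_kron j v) at 1.
  rewrite <- (sumZ_scal _ _ (V * M)) by now apply kv_asum.
  erewrite <- sumZ_minus.
  - apply sumZ_ext; intros i; destruct (BK i j) as [E _]; unfold Dm in E.
    rewrite (kron_sym j i).
    replace (kron i j) with
      (dx * (avec dx X j * ker_g X i j - (ker_gamma X i j - ker_gamma X i (j - 1)%Z) / dx))
      by (rewrite E; field; lra).
    field; lra.
  - apply asum_scal, (kv_asum _ _ M V); easy.
  - apply asum_kron. }
assert (E2 : kv (ker_k X) w j - kv (ker_k X) w (j - 1)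
             = dx * avec dx X j * kv (ker_kappa X) w j).
{ unfold kv; rewrite <- (sumZ_minus _ _ (V' * M) (V' * M)) by now apply kv_asum.
  rewrite <- (sumZ_scal _ _ (V' * M)) by now apply kv_asum.
  apply sumZ_ext; intros i; destruct (BK i j) as (_ & _ & _ & E & _); unfold Dm in E.
  replace (dx * avec dx X j * (ker_kappa X i j * w i))
    with (dx * (avec dx X j * ker_kappa X i j) * w i) by ring.
  rewrite <- E; field; lra. }
fold (v j).
replace (dx * kv (ker_gamma X) v j + dx * kv (ker_k X) w j -
   (dx * kv (ker_gamma X) v (j - 1) + dx * kv (ker_k X) w (j - 1)))
  with (dx * (kv (ker_gamma X) v j - kv (ker_gamma X) v (j - 1))
        + dx * (kv (ker_k X) w j - kv (ker_k X) w (j - 1))) by ring.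
rewrite E1, E2; field; lra.
Qed.

Lemma Dp_Q dx rho (X : state) M j : 0 < dx -> nrm dx X M -> B_kernel dx X ->
  Dp dx (Qfun dx rho X) j
    = avec dx X j * Rfun dx rho X j - (Dp dx (H X) j + rho * rbar X j).
Proof.
intros Hdx (Bz & Bdz & Bu & Bh & Bdh & Br & Kg & Kk & Ka & Kp) BK.
unfold Dp at 1; rewrite !Qfun_kv, Rfun_kv.
pose (v i := U X i * Dp dx (U X) i); pose (w i := Dp dx (H X) i + rho * rbar X i).
fold v w.
assert (Bv : exists V, forall i, Rabs (v i) <= V).
{ eexists; intros i; apply (l2b_term v), l2b_mult_bd;
    [intros j'; apply (l2b_term _ _ _ Bu)|apply l2b_Dp, Bu]. }
assert (Bw : exists V, forall i, Rabs (w i) <= V).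
{ eexists; intros i; apply (l2b_term w), l2b_plus; [apply Bdh|].
  apply l2b_scal, Br. }
destruct Bv as [V Bv]; destruct Bw as [V' Bw].
assert (E1 : kv (ker_kappa X) w (j + 1) - kv (ker_kappa X) w j
             = dx * avec dx X j * kv (ker_k X) w j - w j).
{ unfold kv; rewrite <- (sumZ_minus _ _ (V' * M) (V' * M)) by now apply kv_asum.
  rewrite <- (sumZ_kron j w) at 1.
  rewrite <- (sumZ_scal _ _ (V' * M)) by now apply kv_asum.
  erewrite <- sumZ_minus.
  - apply sumZ_ext; intros i; destruct (BK i j) as (_ & _ & E & _); unfold Dp in E.
    rewrite (kron_sym j i).
    replace (kron i j) with
      (dx * (avec dx X j * ker_k X i j - (ker_kappa X i (j + 1)%Z - ker_kappa X i j) / dx))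
      by (rewrite E; field; lra).
    field; lra.
  - apply asum_scal, (kv_asum _ _ M V'); easy.
  - apply asum_kron. }
assert (E2 : kv (ker_g X) v (j + 1) - kv (ker_g X) v j
             = dx * avec dx X j * kv (ker_gamma X) v j).
{ unfold kv; rewrite <- (sumZ_minus _ _ (V * M) (V * M)) by now apply kv_asum.
  rewrite <- (sumZ_scal _ _ (V * M)) by now apply kv_asum.
  apply sumZ_ext; intros i; destruct (BK i j) as (_ & E & _); unfold Dp in E.
  replace (dx * avec dx X j * (ker_gamma X i j * v i))
    with (dx * (avec dx X j * ker_gamma X i j) * v i) by ring.
  rewrite <- E; field; lra. }
fold (w j).
replace (dx * kv (ker_g X) v (j + 1) + dx * kv (ker_kappa X) w (j + 1) -
   (dx * kv (ker_g X) v j + dx * kv (ker_kappa X) w j))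
  with (dx * (kv (ker_g X) v (j + 1) - kv (ker_g X) v j)
        + dx * (kv (ker_kappa X) w (j + 1) - kv (ker_kappa X) w j)) by ring.
rewrite E1, E2; field; lra.
Qed.

Lemma near_self dx (X : state) M : nrm dx X M -> near dx 0 X X M 1.
Proof.
intros N; rewrite <- (unflat_flat X) in *; apply bnd_nrm in N.
apply near_intro; try easy; apply bndX_zero.
Qed.

Lemma RQ_bound dx rho M : exists K, 0 <= K /\ forall X : state, nrm dx X M ->
  l2b (Rfun dx rho X) K /\ l2b (Qfun dx rho X) K.
Proof.
destruct (R_lip dx rho M) as (K1 & L1 & HR); destruct (Q_lip dx rho M) as (K2 & L2 & HQ).
exists (Rabs K1 + Rabs K2); split.
{ apply Rplus_le_le_0_compat; apply Rabs_pos. }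
generalize (Rabs_pos K1) (Rabs_pos K2) (Rle_abs K1) (Rle_abs K2); intros.
assert (N := near_self dx X M H3); split.
- apply (l2b_weak _ K1); [lra|]; apply (HR X X 0); [lra|easy].
- apply (l2b_weak _ K2); [lra|]; apply (HQ X X 0); [lra|easy].
Qed.

Lemma nrm_in_Eker dx (X : state) M : 0 < dx -> nrm dx X M -> in_Eker dx X.
Proof.
intros Hdx (Bz & Bdz & Bu & Bh & Bdh & Br & Kg & Kk & Ka & Kp).
assert (L2 : forall v K, l2b v K -> in_l2 v).
{ intros v K B; apply (asum_ex _ (K ^ 2)); intros n.
  rewrite (psum_ext _ (fun j => v j ^ 2)); [now apply l2b_elim|].
  intros j; rewrite pow2_abs; apply Rabs_pos_eq; nra. }
assert (LS : forall a K, kb a K -> in_lstar dx a).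
{ intros a K B; split; [exists (dx * K)|exists K].
  - intros i; destruct B as [B _]; split.
    + eapply asum_ex, asum_abs, B.
    + apply Rmult_le_compat_l; [lra|apply sumZ_abs_bound, B].
  - intros i j; now apply kb_term. }
split; [|split; [|split; [|split]]]; eauto.
split; [|split; [|split]]; eauto.
- split; eauto; now exists M.
- split; eauto; eapply L2, l2b_Dp, Bu.
- split; eauto; now exists M.
Qed.

(** * Invariance of the set B *)

Definition solves_at (dx rho : R) (X : R -> state) (t : R) : Prop := forall i j : Z,
    deriv_at (fun s => zeta (X s) j) t (U (X t) j) /\
    deriv_at (fun s => U (X s) j) t (- Qfun dx rho (X t) j) /\
    deriv_at (fun s => H (X s) j) t
      (- (U (X t) j * Rfun dx rho (X t) (j - 1)%Z)) /\
    deriv_at (fun s => rbar (X s) j) t (- (rho * Dp dx (U (X t)) j)) /\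
    deriv_at (fun s => ker_g (X s) i j) t
      (ker_rhs dx (X t) (ker_g (X t)) (ker_g (X t))
                        (ker_gamma (X t)) (ker_kappa (X t)) i j) /\
    deriv_at (fun s => ker_k (X s) i j) t
      (ker_rhs dx (X t) (ker_k (X t)) (ker_k (X t))
                        (ker_kappa (X t)) (ker_gamma (X t)) i j) /\
    deriv_at (fun s => ker_gamma (X s) i j) t
      (ker_rhs dx (X t) (ker_gamma (X t)) (ker_k (X t))
                        (ker_g (X t)) (ker_gamma (X t)) i j) /\
    deriv_at (fun s => ker_kappa (X s) i j) t
      (ker_rhs dx (X t) (ker_kappa (X t)) (ker_g (X t))
                        (ker_k (X t)) (ker_kappa (X t)) i j).

Lemma sol_solves dx rho X T :
  (forall t, 0 <= t < T -> forall a,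
     deriv_at (fun s => flat (X s) a) t (rhs dx rho (flat (X t)) a)) <->
  (forall t, 0 <= t < T -> solves_at dx rho X t).
Proof.
split.
- intros D t Ht i j; specialize (D t Ht); unfold rhs in D.
  rewrite unflat_flat in D.
  exact (conj (D (Iz j)) (conj (D (Iu j)) (conj (D (Ih j)) (conj (D (Ir j))
    (conj (D (Ig i j)) (conj (D (Ik i j)) (conj (D (Ia i j)) (D (Ip i j))))))))).
- intros D t Ht a; specialize (D t Ht); unfold rhs; rewrite unflat_flat.
  destruct a; try apply (D 0%Z j); apply (D i j).
Qed.

(** * Propagation of the kernel relations (a) *)

Section Lin.

Variables (d A B : Z -> R) (D M : R).
Hypothesis Hd : forall m, Rabs (d m) <= D.
Hypothesis HA : asum A M.
Hypothesis HB : asum B M.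

(** For fixed [i] the equations of [g] and [gamma] apply one linear map, with coefficients [g_i] and
    [gamma_i], to the column pairs [(g, kappa)] and [(gamma, k)]; those of [k] and [kappa] do so
    with [k_i] and [kappa_i]. The map therefore commutes with differences in [j] and with
    multiplication by [D_+ y_j]. *)
Definition lin (p q : Z -> R) : R := sumZ (fun m => d m * (A m * p m + B m * q m)).

Definition lin_dom (p q : Z -> R) : Prop :=
  exists P, (forall m, Rabs (p m) <= P) /\ (forall m, Rabs (q m) <= P).

Lemma lin_asum p q P : (forall m, Rabs (p m) <= P) -> (forall m, Rabs (q m) <= P) ->
  asum (fun m => d m * (A m * p m + B m * q m)) (D * (P * M + P * M)).
Proof.
intros Hp Hq; apply asum_mult_bd; [easy|].
apply (asum_ext _ (fun m => p m * A m + q m * B m)); [intros; ring|].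
apply asum_plus; now apply asum_mult_bd.
Qed.

Lemma lin_bound p q P : (forall m, Rabs (p m) <= P) -> (forall m, Rabs (q m) <= P) ->
  Rabs (lin p q) <= D * (2 * M) * P.
Proof.
intros Hp Hq; assert (Q := sumZ_bound _ _ (lin_asum p q P Hp Hq)).
replace (D * (2 * M) * P) with (D * (P * M + P * M)) by ring; exact Q.
Qed.

Lemma lin_dom_comb c c' p q p' q' : lin_dom p q -> lin_dom p' q' ->
  lin_dom (fun m => c * p m + c' * p' m) (fun m => c * q m + c' * q' m).
Proof.
intros (P & Hp & Hq) (P' & Hp' & Hq').
assert (K : forall f f' : Z -> R, (forall m, Rabs (f m) <= P) ->
  (forall m, Rabs (f' m) <= P') ->
  forall m, Rabs (c * f m + c' * f' m) <= Rabs c * P + Rabs c' * P').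
{ intros f f' Hf Hf' m; eapply Rle_trans; [apply Rabs_triang|]; rewrite !Rabs_mult.
  apply Rplus_le_compat; apply Rmult_le_compat_l; auto using Rabs_pos. }
exists (Rabs c * P + Rabs c' * P'); split; auto.
Qed.

Lemma lin_comb c c' p q p' q' : lin_dom p q -> lin_dom p' q' ->
  lin (fun m => c * p m + c' * p' m) (fun m => c * q m + c' * q' m)
  = c * lin p q + c' * lin p' q'.
Proof.
intros (P & Hp & Hq) (P' & Hp' & Hq'); unfold lin.
assert (S := lin_asum p q P Hp Hq); assert (S' := lin_asum p' q' P' Hp' Hq').
rewrite <- (sumZ_scal c _ _ S), <- (sumZ_scal c' _ _ S').
rewrite <- (sumZ_plus _ _ _ _ (asum_scal c _ _ S) (asum_scal c' _ _ S')).
apply sumZ_ext; intros; ring.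
Qed.

(** Each relation in (a) combines three kernel entries, one weighted by [avec] and two in a
    difference quotient, with a Kronecker delta. *)
Lemma lin_comb4 c1 c2 c3 c4 p1 q1 p2 q2 p3 q3 p4 q4 p q :
  lin_dom p1 q1 -> lin_dom p2 q2 -> lin_dom p3 q3 -> lin_dom p4 q4 ->
  (forall m, p m = c1 * p1 m + c2 * p2 m + c3 * p3 m + c4 * p4 m) ->
  (forall m, q m = c1 * q1 m + c2 * q2 m + c3 * q3 m + c4 * q4 m) ->
  lin p q = c1 * lin p1 q1 + c2 * lin p2 q2 + c3 * lin p3 q3 + c4 * lin p4 q4.
Proof.
intros D1 D2 D3 D4 Ep Eq.
assert (D12 := lin_dom_comb c1 c2 _ _ _ _ D1 D2).
assert (D34 := lin_dom_comb c3 c4 _ _ _ _ D3 D4).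
rewrite !Rplus_assoc, <- Rplus_assoc.
rewrite <- (lin_comb c1 c2) by easy; rewrite <- (lin_comb c3 c4) by easy.
rewrite <- (Rmult_1_l (lin (fun m => c1 * p1 m + _) _)).
rewrite <- (Rmult_1_l (lin (fun m => c3 * p3 m + _) _)).
rewrite <- lin_comb by easy.
apply sumZ_ext; intros m; rewrite Ep, Eq; ring.
Qed.

Lemma lin_dom_kron j : lin_dom (fun m => kron m j) (fun _ => 0) /\
                       lin_dom (fun _ => 0) (fun m => kron m j).
Proof.
assert (K : forall m, Rabs (kron m j) <= 1).
{ intros m; unfold kron; destruct Z.eq_dec; rewrite ?Rabs_R1, ?Rabs_R0; lra. }
assert (K0 : forall m : Z, Rabs 0 <= 1) by (intros; rewrite Rabs_R0; lra).
split; exists 1; auto.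
Qed.

Lemma lin_kron_l j : lin (fun m => kron m j) (fun _ => 0) = d j * A j.
Proof.
unfold lin; rewrite <- (sumZ_kron j (fun m => d m * A m)).
apply sumZ_ext; intros m; rewrite (kron_sym j m); ring.
Qed.

Lemma lin_kron_r j : lin (fun _ => 0) (fun m => kron m j) = d j * B j.
Proof.
unfold lin; rewrite <- (sumZ_kron j (fun m => d m * B m)).
apply sumZ_ext; intros m; rewrite (kron_sym j m); ring.
Qed.

End Lin.

Inductive kerr : Type := E1 | E2 | E3 | E4.

Definition err (dx : R) (X : state) (e : kerr) (i j : Z) : R :=
  match e with
  | E1 => avec dx X j * ker_g X i j - Dm dx (ker_gamma X i) j - kron i j / dx
  | E2 => Dp dx (ker_g X i) j - avec dx X j * ker_gamma X i j
  | E3 => avec dx X j * ker_k X i j - Dp dx (ker_kappa X i) j - kron i j / dx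
  | E4 => Dm dx (ker_k X i) j - avec dx X j * ker_kappa X i j
  end.

(** Differentiating [D_+ y_j] produces a term with [D_+ U_j], and it cancels against the image of
    the Kronecker delta under [lin]. What remains is linear in the defects of column [j], where [E1]
    couples with [E4] and [E2] with [E3]. *)
Definition err_deriv (dx : R) (X : state) (e : kerr) (i j : Z) : R :=
  let Lg := lin (Dp dx (U X)) (ker_g X i) (ker_gamma X i) in
  let Lk := lin (Dp dx (U X)) (ker_k X i) (ker_kappa X i) in
  let er e := fun m => err dx X e m j in
  let mer e := fun m => - err dx X e m j in
  - dx * match e with
         | E1 => Lg (er E1) (mer E4)
         | E2 => Lg (er E2) (mer E3)
         | E3 => Lk (er E3) (mer E2)
         | E4 => Lk (er E4) (mer E1)
         end.

Lemma deriv_avec dx rho X t j : solves_at dx rho X t ->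
  deriv_at (fun s => avec dx (X s) j) t (Dp dx (U (X t)) j).
Proof.
intros S; apply deriv_at_Dp; intros k; unfold ypos.
replace (U (X t) k) with (0 + U (X t) k) by ring.
apply deriv_at_plus; [apply deriv_at_const|apply (S 0%Z k)].
Qed.

Lemma err_has_deriv dx rho X t M e i j : 0 < dx -> nrm dx (X t) M ->
  solves_at dx rho X t ->
  deriv_at (fun s => err dx (X s) e i j) t (err_deriv dx (X t) e i j).
Proof.
intros Hdx N S; assert (Da := deriv_avec dx rho X t j S).
assert (Dg := fun i j => proj1 (proj2 (proj2 (proj2 (proj2 (S i j)))))).
assert (Dk := fun i j => proj1 (proj2 (proj2 (proj2 (proj2 (proj2 (S i j))))))).
assert (Dga := fun i j => proj1 (proj2 (proj2 (proj2 (proj2 (proj2 (proj2 (S i j)))))))).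
assert (Dka := fun i j => proj2 (proj2 (proj2 (proj2 (proj2 (proj2 (proj2 (S i j)))))))).
destruct N as (_ & _ & Bu & _ & _ & _ & Kg & Kk & Ka & Kp).
assert (HD := fun m => l2b_term _ _ m (l2b_Dp dx _ _ Bu)).
assert (Dom : forall a b k, kb a M -> kb b M ->
  lin_dom (fun m => a m k) (fun m => b m k)).
{ intros a b k K1 K2; exists M; split; intros m; now apply kb_term. }
destruct (lin_dom_kron j) as [Dk1 Dk2].
set (x := X t) in *.
pose (Lg := lin (Dp dx (U x)) (ker_g x i) (ker_gamma x i)).
pose (Lk := lin (Dp dx (U x)) (ker_k x i) (ker_kappa x i)).
assert (Rg : forall k, ker_rhs dx x (ker_g x) (ker_g x) (ker_gamma x) (ker_kappa x) i k
  = - (dx * Lg (fun m => ker_g x m k) (fun m => ker_kappa x m k))) by reflexivity.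
assert (Rga : forall k,
  ker_rhs dx x (ker_gamma x) (ker_k x) (ker_g x) (ker_gamma x) i k
  = - (dx * Lg (fun m => ker_gamma x m k) (fun m => ker_k x m k))).
{ intros k; unfold ker_rhs, Lg, lin; f_equal; f_equal; apply sumZ_ext; intros; ring. }
assert (Rk : forall k, ker_rhs dx x (ker_k x) (ker_k x) (ker_kappa x) (ker_gamma x) i k
  = - (dx * Lk (fun m => ker_k x m k) (fun m => ker_gamma x m k))) by reflexivity.
assert (Rka : forall k,
  ker_rhs dx x (ker_kappa x) (ker_g x) (ker_k x) (ker_kappa x) i k
  = - (dx * Lk (fun m => ker_kappa x m k) (fun m => ker_g x m k))).
{ intros k; unfold ker_rhs, Lk, lin; f_equal; f_equal; apply sumZ_ext; intros; ring. }
destruct e; unfold err_deriv; cbv zeta.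
- rewrite (lin_comb4 _ _ _ _ M HD (proj1 Kg i) (proj1 Ka i)
    (avec dx x j) (- / dx) (/ dx) (- / dx)
    (fun m => ker_g x m j) (fun m => ker_kappa x m j)
    (fun m => ker_gamma x m j) (fun m => ker_k x m j)
    (fun m => ker_gamma x m (j - 1)%Z) (fun m => ker_k x m (j - 1)%Z)
    (fun m => kron m j) (fun _ => 0)); auto;
    try (intros m; unfold err, Dm; field; lra).
  rewrite lin_kron_l; fold Lg.
  match goal with |- deriv_at _ _ ?l => replace l with
    (Dp dx (U x) j * ker_g x i j
     + avec dx x j * ker_rhs dx x (ker_g x) (ker_g x) (ker_gamma x) (ker_kappa x) i j
     - Dm dx (ker_rhs dx x (ker_gamma x) (ker_k x) (ker_g x) (ker_gamma x) i) j - 0) end.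
  2:{ unfold Dm; rewrite Rg, !Rga; field; lra. }
  unfold err; apply deriv_at_minus; [|apply deriv_at_const].
  apply deriv_at_minus; [now apply deriv_at_mult|].
  now apply deriv_at_Dm.
- rewrite (lin_comb4 _ _ _ _ M HD (proj1 Kg i) (proj1 Ka i)
    (- avec dx x j) (/ dx) (- / dx) (/ dx)
    (fun m => ker_gamma x m j) (fun m => ker_k x m j)
    (fun m => ker_g x m (j + 1)%Z) (fun m => ker_kappa x m (j + 1)%Z)
    (fun m => ker_g x m j) (fun m => ker_kappa x m j)
    (fun _ => 0) (fun m => kron m j)); auto;
    try (intros m; unfold err, Dp; field; lra).
  rewrite lin_kron_r; fold Lg.
  match goal with |- deriv_at _ _ ?l => replace l with
    (Dp dx (ker_rhs dx x (ker_g x) (ker_g x) (ker_gamma x) (ker_kappa x) i) j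
     - (Dp dx (U x) j * ker_gamma x i j
     + avec dx x j * ker_rhs dx x (ker_gamma x) (ker_k x) (ker_g x) (ker_gamma x) i j)) end.
  2:{ unfold Dp at 1; rewrite !Rg, !Rga; field; lra. }
  unfold err; apply deriv_at_minus; [now apply deriv_at_Dp|now apply deriv_at_mult].
- rewrite (lin_comb4 _ _ _ _ M HD (proj1 Kk i) (proj1 Kp i)
    (avec dx x j) (- / dx) (/ dx) (- / dx)
    (fun m => ker_k x m j) (fun m => ker_gamma x m j)
    (fun m => ker_kappa x m (j + 1)%Z) (fun m => ker_g x m (j + 1)%Z)
    (fun m => ker_kappa x m j) (fun m => ker_g x m j)
    (fun m => kron m j) (fun _ => 0)); auto;
    try (intros m; unfold err, Dp; field; lra).
  rewrite lin_kron_l; fold Lk.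
  match goal with |- deriv_at _ _ ?l => replace l with
    (Dp dx (U x) j * ker_k x i j
     + avec dx x j * ker_rhs dx x (ker_k x) (ker_k x) (ker_kappa x) (ker_gamma x) i j
     - Dp dx (ker_rhs dx x (ker_kappa x) (ker_g x) (ker_k x) (ker_kappa x) i) j - 0) end.
  2:{ unfold Dp at 2; rewrite !Rk, !Rka; field; lra. }
  unfold err; apply deriv_at_minus; [|apply deriv_at_const].
  apply deriv_at_minus; [now apply deriv_at_mult|].
  now apply deriv_at_Dp.
- rewrite (lin_comb4 _ _ _ _ M HD (proj1 Kk i) (proj1 Kp i)
    (- avec dx x j) (/ dx) (- / dx) (/ dx)
    (fun m => ker_kappa x m j) (fun m => ker_g x m j)
    (fun m => ker_k x m j) (fun m => ker_gamma x m j)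
    (fun m => ker_k x m (j - 1)%Z) (fun m => ker_gamma x m (j - 1)%Z)
    (fun _ => 0) (fun m => kron m j)); auto;
    try (intros m; unfold err, Dm; field; lra).
  rewrite lin_kron_r; fold Lk.
  match goal with |- deriv_at _ _ ?l => replace l with
    (Dm dx (ker_rhs dx x (ker_k x) (ker_k x) (ker_kappa x) (ker_gamma x) i) j
     - (Dp dx (U x) j * ker_kappa x i j
     + avec dx x j * ker_rhs dx x (ker_kappa x) (ker_g x) (ker_k x) (ker_kappa x) i j)) end.
  2:{ unfold Dm; rewrite !Rk, !Rka; field; lra. }
  unfold err; apply deriv_at_minus; [now apply deriv_at_Dm|now apply deriv_at_mult].
Qed.

Section Invariance.

Variables (dx rho T M : R) (X : R -> state).
Hypothesis Hdx : 0 < dx.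
Hypothesis HN : forall t, 0 <= t < T -> nrm dx (X t) M.
Hypothesis HS : forall t, 0 <= t < T -> solves_at dx rho X t.
Hypothesis HB0 : in_B dx (X 0).

Lemma M_ge0 t : 0 <= t < T -> 0 <= M.
Proof. intros Ht; destruct (HN t Ht) as (A & _). 
generalize (A 0%Z) (Rabs_pos (zeta (X t) 0%Z)); lra. Qed.

Lemma DU_bound t m : 0 <= t < T ->
  Rabs (Dp dx (U (X t)) m) <= Rabs (/ dx) * (M + M).
Proof.
intros Ht; apply (l2b_term (Dp dx (U (X t)))), l2b_Dp, (HN t Ht).
Qed.

Lemma err_zero e i j t : 0 <= t < T -> err dx (X t) e i j = 0.
Proof.
intros Ht; assert (HM := M_ge0 t Ht).
pose (D := Rabs (/ dx) * (M + M)).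
assert (HD0 : 0 <= D) by (apply Rmult_le_pos; [apply Rabs_pos|lra]).
revert t Ht.
assert (K := gronwall_zero (kerr * (Z * Z))
  (fun a t => err dx (X t) (fst a) (fst (snd a)) (snd (snd a)))
  (fun a t => err_deriv dx (X t) (fst a) (fst (snd a)) (snd (snd a)))
  T (dx * (D * (2 * M))) ((1 + M) * M + Rabs (/ dx) * (M + M) + Rabs (/ dx))).
enough (K' : forall (a : kerr * (Z * Z)) t, 0 <= t < T ->
  err dx (X t) (fst a) (fst (snd a)) (snd (snd a)) = 0).
{ intros t Ht; apply (K' (e, (i, j)) t Ht). }
apply K; clear K.
- apply Rmult_le_pos; [lra|apply Rmult_le_pos; lra].
- intros [e' [i' j']] t Ht; simpl.
  apply (err_has_deriv dx rho X t M); auto.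
- intros [e' [i' j']]; simpl.
  destruct HB0 as (_ & A & _); destruct (A i' j') as (A1 & A2 & A3 & A4 & _).
  destruct e'; unfold err, avec; lra.
- intros [e' [i' j']] t Ht; cbn [fst snd].
  assert (Ha : Rabs (avec dx (X t) j') <= 1 + M).
  { rewrite avec_zeta by lra; eapply Rle_trans; [apply Rabs_triang|].
    rewrite Rabs_R1; apply Rplus_le_compat_l, (l2b_term (Dp dx (zeta (X t)))).
    apply (HN t Ht). }
  destruct (HN t Ht) as (_ & _ & _ & _ & _ & _ & Kg & Kk & Ka & Kp).
  assert (Hm : forall b, kb b M -> Rabs (avec dx (X t) j' * b i' j') <= (1 + M) * M).
  { intros b Kb; rewrite Rabs_mult; apply Rmult_le_compat; try apply Rabs_pos; auto.
    now apply kb_term. }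
  assert (Hdf : forall b k l, kb b M ->
     Rabs ((b i' k - b i' l) / dx) <= Rabs (/ dx) * (M + M)).
  { intros b k l Kb; unfold Rdiv; rewrite Rmult_comm, Rabs_mult.
    apply Rmult_le_compat_l; [apply Rabs_pos|].
    unfold Rminus; eapply Rle_trans; [apply Rabs_triang|]; rewrite Rabs_Ropp.
    apply Rplus_le_compat; now apply kb_term. }
  assert (Hk : Rabs (kron i' j' / dx) <= Rabs (/ dx)).
  { unfold Rdiv; rewrite Rabs_mult; rewrite <- (Rmult_1_l (Rabs (/ dx))) at 2.
    apply Rmult_le_compat_r; [apply Rabs_pos|].
    unfold kron; destruct Z.eq_dec; rewrite ?Rabs_R1, ?Rabs_R0; lra. }
  assert (Hp := Rabs_pos (/ dx)).
  assert (T3 : forall x y z, Rabs (x - y - z) <= Rabs x + Rabs y + Rabs z).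
  { intros; unfold Rminus; eapply Rle_trans; [apply Rabs_triang|].
    rewrite Rabs_Ropp; apply Rplus_le_compat_r.
    rewrite <- (Rabs_Ropp y); apply Rabs_triang. }
  destruct e'; unfold err.
  + eapply Rle_trans; [apply T3|]; unfold Dm.
    generalize (Hm _ Kg) (Hdf _ j' (j' - 1)%Z Ka); lra.
  + rewrite <- (Rminus_0_r (_ - _)); eapply Rle_trans; [apply T3|]; unfold Dp at 1.
    rewrite Rabs_R0; generalize (Hm _ Ka) (Hdf _ (j' + 1)%Z j' Kg); lra.
  + eapply Rle_trans; [apply T3|]; unfold Dp at 1.
    generalize (Hm _ Kk) (Hdf _ (j' + 1)%Z j' Kp); lra.
  + rewrite <- (Rminus_0_r (_ - _)); eapply Rle_trans; [apply T3|]; unfold Dm at 1.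
    rewrite Rabs_R0; generalize (Hm _ Kp) (Hdf _ j' (j' - 1)%Z Kk); lra.
- intros t C Ht HC HE [e' [i' j']]; cbn [fst snd].
  assert (HE' : forall e m, Rabs (err dx (X t) e m j') <= C)
    by (intros e0 m; apply (HE (e0, (m, j')))).
  assert (HE'' : forall e m, Rabs (- err dx (X t) e m j') <= C)
    by (intros; rewrite Rabs_Ropp; auto).
  destruct (HN t Ht) as (_ & _ & _ & _ & _ & _ & Kg & Kk & Ka & Kp).
  assert (HDt := fun m => DU_bound t m Ht).
  unfold err_deriv; cbv zeta; rewrite Rabs_mult, Rabs_Ropp, (Rabs_pos_eq dx) by lra.
  rewrite Rmult_assoc; apply Rmult_le_compat_l; [lra|].
  destruct e'; apply lin_bound; auto; try apply Kg; try apply Ka;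
    try apply Kk; try apply Kp.
Qed.

Lemma ker_sum_asum t (a b c e : kernel) i j : 0 <= t < T ->
  kb a M -> kb b M -> kb c M -> kb e M ->
  exists K, asum (fun m => Dp dx (U (X t)) m * (a i m * b m j + c i m * e m j)) K.
Proof.
intros Ht Ka Kb Kc Ke; eexists.
apply asum_mult_bd; [exact (fun m => DU_bound t m Ht)|].
apply (asum_ext _ (fun m => b m j * a i m + e m j * c i m)); [intros; ring|].
apply asum_plus; apply asum_mult_bd.
- intros m; apply (kb_term _ _ m j Kb).
- apply Ka.
- intros m; apply (kb_term _ _ m j Ke).
- apply Kc.
Qed.

Lemma asum_four t C (x1 x2 x3 x4 y1 y2 y3 y4 f : Z -> R) : 0 <= t < T ->
  (forall m, Rabs (x1 m) <= C) -> (forall m, Rabs (x2 m) <= C) ->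
  (forall m, Rabs (x3 m) <= C) -> (forall m, Rabs (x4 m) <= C) ->
  asum y1 M -> asum y2 M -> asum y3 M -> asum y4 M ->
  (forall m, f m = Dp dx (U (X t)) m *
     (x1 m * y1 m + x2 m * y2 m + x3 m * y3 m + x4 m * y4 m)) ->
  Rabs (sumZ f) <= Rabs (/ dx) * (M + M) * (4 * M) * C.
Proof.
intros Ht B1 B2 B3 B4 A1 A2 A3 A4 E; rewrite (sumZ_ext _ _ E).
replace (Rabs (/ dx) * (M + M) * (4 * M) * C)
  with (Rabs (/ dx) * (M + M) * (C * M + C * M + C * M + C * M)) by ring.
apply sumZ_bound, asum_mult_bd; [intros; now apply DU_bound|].
repeat apply asum_plus; now apply asum_mult_bd.
Qed.

Inductive serr_ix : Type := S1 | S2 | S3.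

Definition serr (x : state) (e : serr_ix) (i j : Z) : R :=
  match e with
  | S1 => ker_g x i j - ker_g x j i
  | S2 => ker_k x i j - ker_k x j i
  | S3 => ker_gamma x j i + ker_kappa x i j
  end.

Definition serr_deriv (x : state) (e : serr_ix) (i j : Z) : R :=
  match e with
  | S1 => ker_rhs dx x (ker_g x) (ker_g x) (ker_gamma x) (ker_kappa x) i j
          - ker_rhs dx x (ker_g x) (ker_g x) (ker_gamma x) (ker_kappa x) j i
  | S2 => ker_rhs dx x (ker_k x) (ker_k x) (ker_kappa x) (ker_gamma x) i j
          - ker_rhs dx x (ker_k x) (ker_k x) (ker_kappa x) (ker_gamma x) j i
  | S3 => ker_rhs dx x (ker_gamma x) (ker_k x) (ker_g x) (ker_gamma x) j i
          + ker_rhs dx x (ker_kappa x) (ker_g x) (ker_k x) (ker_kappa x) i j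
  end.

(** Transposing a kernel equation reverses its products. Exchanging one factor at a time expands the
    difference into four products, each of a symmetry defect and a summable kernel entry. *)
Lemma serr_deriv_bound t C e i j : 0 <= t < T ->
  (forall e i j, Rabs (serr (X t) e i j) <= C) ->
  Rabs (serr_deriv (X t) e i j) <= dx * (Rabs (/ dx) * (M + M) * (4 * M)) * C.
Proof.
intros Ht HC.
destruct (HN t Ht) as (_ & _ & _ & _ & _ & _ & Kg & Kk & Ka & Kp).
assert (Red : forall f, Rabs (sumZ f) <= Rabs (/ dx) * (M + M) * (4 * M) * C ->
  Rabs (- (dx * sumZ f)) <= dx * (Rabs (/ dx) * (M + M) * (4 * M)) * C).
{ intros f Hf; rewrite Rabs_Ropp, Rabs_mult, (Rabs_pos_eq dx), Rmult_assoc by lra.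
  apply Rmult_le_compat_l; lra. }
assert (Ho : forall x : Z -> R, (forall m, Rabs (x m) <= C) ->
  forall m, Rabs (- x m) <= C) by (intros; rewrite Rabs_Ropp; auto).
destruct e; unfold serr_deriv, ker_rhs.
- destruct (ker_sum_asum t _ _ _ _ i j Ht Kg Kg Ka Kp) as [K1 A1].
  destruct (ker_sum_asum t _ _ _ _ j i Ht Kg Kg Ka Kp) as [K2 A2].
  unfold Rminus; rewrite Ropp_involutive.
  rewrite <- (Ropp_involutive (_ + _)), Ropp_plus_distr, Ropp_involutive.
  change (Rabs (- (dx * sumZ (fun m => Dp dx (U (X t)) m *
     (ker_g (X t) i m * ker_g (X t) m j + ker_gamma (X t) i m * ker_kappa (X t) m j))
     - dx * sumZ (fun m => Dp dx (U (X t)) m *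
     (ker_g (X t) j m * ker_g (X t) m i + ker_gamma (X t) j m * ker_kappa (X t) m i)))) <=
    dx * (Rabs (/ dx) * (M + M) * (4 * M)) * C).
  rewrite <- Rmult_minus_distr_l, <- (sumZ_minus _ _ _ _ A1 A2); apply Red.
  apply (asum_four t C (fun m => serr (X t) S1 i m) (fun m => serr (X t) S1 m j)
    (fun m => serr (X t) S3 m i) (fun m => - serr (X t) S3 m j)
    (fun m => ker_g (X t) m j) (fun m => ker_g (X t) m i)
    (fun m => ker_kappa (X t) m j) (fun m => ker_kappa (X t) m i)); auto;
    try apply Kg; try apply Kp.
  intros m; unfold serr; ring.
- destruct (ker_sum_asum t _ _ _ _ i j Ht Kk Kk Kp Ka) as [K1 A1].
  destruct (ker_sum_asum t _ _ _ _ j i Ht Kk Kk Kp Ka) as [K2 A2].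
  unfold Rminus; rewrite Ropp_involutive.
  rewrite <- (Ropp_involutive (_ + _)), Ropp_plus_distr, Ropp_involutive.
  change (Rabs (- (dx * sumZ (fun m => Dp dx (U (X t)) m *
     (ker_k (X t) i m * ker_k (X t) m j + ker_kappa (X t) i m * ker_gamma (X t) m j))
     - dx * sumZ (fun m => Dp dx (U (X t)) m *
     (ker_k (X t) j m * ker_k (X t) m i + ker_kappa (X t) j m * ker_gamma (X t) m i)))) <=
    dx * (Rabs (/ dx) * (M + M) * (4 * M)) * C).
  rewrite <- Rmult_minus_distr_l, <- (sumZ_minus _ _ _ _ A1 A2); apply Red.
  apply (asum_four t C (fun m => serr (X t) S2 i m) (fun m => serr (X t) S2 m j)
    (fun m => serr (X t) S3 i m) (fun m => - serr (X t) S3 j m)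
    (fun m => ker_k (X t) m j) (fun m => ker_k (X t) m i)
    (fun m => ker_gamma (X t) m j) (fun m => ker_gamma (X t) m i)); auto;
    try apply Kk; try apply Ka.
  intros m; unfold serr; ring.
- destruct (ker_sum_asum t _ _ _ _ j i Ht Ka Kk Kg Ka) as [K1 A1].
  destruct (ker_sum_asum t _ _ _ _ i j Ht Kp Kg Kk Kp) as [K2 A2].
  rewrite <- Ropp_plus_distr.
  rewrite <- Rmult_plus_distr_l, <- (sumZ_plus _ _ _ _ A1 A2); apply Red.
  apply (asum_four t C (fun m => serr (X t) S3 m j) (fun m => serr (X t) S2 i m)
    (fun m => serr (X t) S3 i m) (fun m => serr (X t) S1 m j)
    (fun m => ker_k (X t) m i) (fun m => ker_kappa (X t) m j)
    (fun m => ker_g (X t) j m) (fun m => ker_kappa (X t) i m)); auto;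
    try apply Kk; try apply Kp; try apply Kg.
  intros m; unfold serr; ring.
Qed.

Lemma serr_zero e i j t : 0 <= t < T -> serr (X t) e i j = 0.
Proof.
intros Ht; assert (HM := M_ge0 t Ht); revert t Ht.
assert (K := gronwall_zero (serr_ix * (Z * Z))
  (fun a t => serr (X t) (fst a) (fst (snd a)) (snd (snd a)))
  (fun a t => serr_deriv (X t) (fst a) (fst (snd a)) (snd (snd a)))
  T (dx * (Rabs (/ dx) * (M + M) * (4 * M))) (M + M)).
enough (K' : forall (a : serr_ix * (Z * Z)) t, 0 <= t < T ->
  serr (X t) (fst a) (fst (snd a)) (snd (snd a)) = 0).
{ intros t Ht; apply (K' (e, (i, j)) t Ht). }
apply K; clear K.
- repeat apply Rmult_le_pos; try apply Rabs_pos; lra.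
- intros [e' [i' j']] t Ht; cbn [fst snd].
  assert (S := HS t Ht i' j'); assert (S' := HS t Ht j' i').
  destruct e'; unfold serr, serr_deriv;
    [apply deriv_at_minus|apply deriv_at_minus|apply deriv_at_plus];
    try apply S; apply S'.
- intros [e' [i' j']]; cbn [fst snd].
  destruct HB0 as (_ & A & _); destruct (A i' j') as (_ & _ & _ & _ & A1 & A2 & A3).
  destruct e'; unfold serr; lra.
- intros [e' [i' j']] t Ht; cbn [fst snd].
  destruct (HN t Ht) as (_ & _ & _ & _ & _ & _ & Kg & Kk & Ka & Kp).
  destruct e'; unfold serr, Rminus; (eapply Rle_trans; [apply Rabs_triang|]);
    rewrite ?Rabs_Ropp; apply Rplus_le_compat; now apply kb_term.
- intros t C Ht HC HE [e' [i' j']]; cbn [fst snd].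
  apply serr_deriv_bound; [easy|]; intros e0 i0 j0; apply (HE (e0, (i0, j0))).
Qed.

Lemma flow_B_kernel t : 0 <= t < T -> B_kernel dx (X t).
Proof.
intros Ht i j.
assert (A1 := err_zero E1 i j t Ht); assert (A2 := err_zero E2 i j t Ht).
assert (A3 := err_zero E3 i j t Ht); assert (A4 := err_zero E4 i j t Ht).
assert (A5 := serr_zero S1 i j t Ht); assert (A6 := serr_zero S2 i j t Ht).
assert (A7 := serr_zero S3 i j t Ht).
unfold err, serr in *; repeat split; lra.
Qed.

(** * The identity (c) and the signs (d) *)

Definition hvec (x : state) (j : Z) : R := Dp dx (H x) j.
Definition wvec (x : state) (j : Z) : R := Dp dx (U x) j.

(** The shift of [R] in the equation of [H] makes the product rule exact: [D_+ (U_j R_{j-1}) = (D_+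
    U_j) R_j + U_j (D_- R_j)], and [Dm_R] evaluates the last difference. *)
Lemma deriv_hvec t j : 0 <= t < T ->
  deriv_at (fun s => hvec (X s) j) t
    (- (wvec (X t) j * Rfun dx rho (X t) j) - U (X t) j *
       (avec dx (X t) j * Qfun dx rho (X t) j - U (X t) j * wvec (X t) j)).
Proof.
intros Ht; unfold wvec.
rewrite <- (Dm_R dx rho (X t) M j Hdx (HN t Ht) (flow_B_kernel t Ht)).
replace (- (Dp dx (U (X t)) j * Rfun dx rho (X t) j)
   - U (X t) j * Dm dx (Rfun dx rho (X t)) j)
  with (Dp dx (fun j => - (U (X t) j * Rfun dx rho (X t) (j - 1)%Z)) j).
- apply deriv_at_Dp; intros k; apply (HS t Ht k k).
- unfold Dp, Dm; replace (j + 1 - 1)%Z with j by lia; field; lra.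
Qed.

Lemma deriv_wvec t j : 0 <= t < T ->
  deriv_at (fun s => wvec (X s) j) t
    (- (avec dx (X t) j * Rfun dx rho (X t) j)
     + (hvec (X t) j + rho * rbar (X t) j)).
Proof.
intros Ht.
replace (- (avec dx (X t) j * Rfun dx rho (X t) j)
   + (hvec (X t) j + rho * rbar (X t) j)) with (- Dp dx (Qfun dx rho (X t)) j).
- replace (- Dp dx (Qfun dx rho (X t)) j)
    with (Dp dx (fun j => - Qfun dx rho (X t) j) j) by (unfold Dp; field; lra).
  apply deriv_at_Dp; intros k; apply (HS t Ht k k).
- rewrite (Dp_Q dx rho (X t) M j Hdx (HN t Ht) (flow_B_kernel t Ht)).
  unfold hvec; ring.
Qed.

Lemma flow_identity t j : 0 <= t < T ->
  2 * avec dx (X t) j * hvec (X t) j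
    = U (X t) j ^ 2 * avec dx (X t) j ^ 2 + wvec (X t) j ^ 2 + rbar (X t) j ^ 2.
Proof.
intros Ht.
pose (f s := 2 * (avec dx (X s) j * hvec (X s) j)
   - ((U (X s) j * avec dx (X s) j) ^ 2 + (wvec (X s) j ^ 2 + rbar (X s) j ^ 2))).
assert (Q : Rabs (f t - f 0) <= 0 * Rabs (t - 0)).
{ apply (mean_value_bound f (fun _ => 0)); [lra|lra| |intros; rewrite Rabs_R0; lra].
  rewrite Rmin_left, Rmax_right by lra; intros r Hr.
  assert (Hr' : 0 <= r < T) by lra.
  assert (Da := deriv_avec dx rho X r j (HS r Hr')).
  assert (Dh := deriv_hvec r j Hr'); assert (Dw := deriv_wvec r j Hr').
  destruct (HS r Hr' j j) as (_ & Du & _ & Dr & _).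
  assert (Df := deriv_at_minus _ _ _ _ _
     (deriv_at_scal 2 _ _ _ (deriv_at_mult _ _ _ _ _ Da Dh))
     (deriv_at_plus _ _ _ _ _ (deriv_at_sqr _ _ _ (deriv_at_mult _ _ _ _ _ Du Da))
        (deriv_at_plus _ _ _ _ _ (deriv_at_sqr _ _ _ Dw) (deriv_at_sqr _ _ _ Dr)))).
  unfold f; eapply eq_ind; [exact Df|].
  cbv beta; fold (wvec (X r) j); ring. }
destruct HB0 as (_ & _ & _ & C & _); specialize (C j).
fold (avec dx (X 0) j) (hvec (X 0) j) (wvec (X 0) j) in C.
rewrite Rmult_0_l in Q; apply Rabs_le_between in Q; unfold f in Q; lra.
Qed.

Lemma flow_positive t j : 0 <= t < T ->
  0 <= avec dx (X t) j /\ 0 <= hvec (X t) j /\ 0 < avec dx (X t) j + hvec (X t) j.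
Proof.
intros Ht; destruct (RQ_bound dx rho M) as [K [HK HRQ]].
assert (HM := M_ge0 t Ht).
assert (P : 0 < avec dx (X t) j + hvec (X t) j).
{ assert (HL : 0 <= 1 + K + M * K + M * M)
    by (assert (0 <= M * K) by (now apply Rmult_le_pos); nra).
  apply (stays_positive (fun s => avec dx (X s) j + hvec (X s) j)
    (fun s => wvec (X s) j + (- (wvec (X s) j * Rfun dx rho (X s) j) - U (X s) j *
       (avec dx (X s) j * Qfun dx rho (X s) j - U (X s) j * wvec (X s) j)))
    T (1 + K + M * K + M * M) HL); auto.
  - intros r Hr; apply deriv_at_plus; [apply (deriv_avec dx rho); auto|].
    now apply deriv_hvec.
  - intros r Hr; assert (I := flow_identity r j Hr).
    destruct (HRQ (X r) (HN r Hr)) as [BR BQ].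
    assert (BR' := l2b_term _ _ j BR); assert (BQ' := l2b_term _ _ j BQ).
    destruct (HN r Hr) as (_ & _ & Bu & _); assert (Bu' := l2b_term _ _ j Bu).
    set (a := avec dx (X r) j) in *; set (h := hvec (X r) j) in *.
    set (w := wvec (X r) j) in *; set (u := U (X r) j) in *.
    set (RR := Rfun dx rho (X r) j) in *; set (QQ := Qfun dx rho (X r) j) in *.
    (* By (c), [w^2 <= 2 a h <= (a + h)^2], and likewise [a^2 <= (a + h)^2]. No sign of [a] or [h]
       may be used here, as this is what is being proved. *)
    assert (Aw : Rabs w <= Rabs (a + h)).
    { apply abs_le_of_sqr; [apply Rabs_pos|]; rewrite pow2_abs.
      assert (0 <= (u * a) ^ 2) by apply pow2_ge_0.
      assert (0 <= rbar (X r) j ^ 2) by apply pow2_ge_0.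
      assert (0 <= a ^ 2) by apply pow2_ge_0; assert (0 <= h ^ 2) by apply pow2_ge_0.
      lra. }
    assert (Aa : Rabs a <= Rabs (a + h)).
    { apply abs_le_of_sqr; [apply Rabs_pos|]; rewrite pow2_abs.
      assert (0 <= (u * a) ^ 2) by apply pow2_ge_0.
      assert (0 <= rbar (X r) j ^ 2) by apply pow2_ge_0.
      assert (0 <= w ^ 2) by apply pow2_ge_0; assert (0 <= h ^ 2) by apply pow2_ge_0.
      lra. }
    set (N := Rabs (a + h)) in *; assert (HN0 : 0 <= N) by apply Rabs_pos.
    assert (Pr : forall x y b c, 0 <= b -> Rabs x <= b -> Rabs y <= c ->
       Rabs (x * y) <= b * c).
    { intros; rewrite Rabs_mult; apply Rmult_le_compat; auto; apply Rabs_pos. }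
    replace (w + (- (w * RR) - u * (a * QQ - u * w)))
      with (w + (- (RR * w) + (- (u * (QQ * a)) + u * (u * w)))) by ring.
    replace ((1 + K + M * K + M * M) * N)
      with (N + (K * N + (M * (K * N) + M * (M * N)))) by ring.
    repeat (eapply Rle_trans; [apply Rabs_triang|]; apply Rplus_le_compat);
      rewrite ?Rabs_Ropp; auto.
  - apply HB0. }
assert (I := flow_identity t j Ht).
(* By (c) the product is nonnegative; with a positive sum neither factor can be negative. *)
assert (0 <= avec dx (X t) j * hvec (X t) j).
{ assert (0 <= (U (X t) j * avec dx (X t) j) ^ 2) by apply pow2_ge_0.
  assert (0 <= rbar (X t) j ^ 2) by apply pow2_ge_0.
  assert (0 <= wvec (X t) j ^ 2) by apply pow2_ge_0; lra. }
split; [|split; [|easy]]; nra.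
Qed.

Lemma flow_in_B t : 0 <= t < T -> in_B dx (X t).
Proof.
intros Ht; assert (N := HN t Ht); split; [now apply (nrm_in_Eker dx _ M)|].
split; [exact (flow_B_kernel t Ht)|].
split; [|split; intros j; [now apply flow_identity|now apply flow_positive]].
destruct N as (Bz & Bdz & Bu & Bh & Bdh & Br & _).
split; [|split; [|split]].
- exists (1 + M); intros j; fold (avec dx (X t) j); rewrite avec_zeta by lra.
  eapply Rle_trans; [apply Rabs_triang|].
  rewrite Rabs_R1; apply Rplus_le_compat_l, (l2b_term _ _ j Bdz).
- eexists; intros j; apply (DU_bound t j Ht).
- exists M; intros j; apply (l2b_term _ _ j Bdh).
- exists M; intros j; apply (l2b_term _ _ j Br).
Qed.

End Invariance.

(** * Bounds at a fixed time *)

Lemma psum_reflect_le f n : (forall j, 0 <= f j) ->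
  psum f n <= psum (fun j => f (- j)%Z) (S n).
Proof.
intros Hf; rewrite <- psum_reflect.
rewrite (psum_ext _ (fun j => f (- (j + 1))%Z)) by (intros; f_equal; lia).
apply (psum_shift_pos (fun j => f (- j)%Z)); intros; apply Hf.
Qed.

Lemma psum_reflect_le' f n : (forall j, 0 <= f j) ->
  psum (fun j => f (- j)%Z) n <= psum f (S n).
Proof.
intros Hf; eapply Rle_trans; [apply psum_reflect_le; intros; apply Hf|].
right; apply psum_ext; intros; f_equal; lia.
Qed.

Lemma asum_reflect f B : asum (fun j => f (- j)%Z) B -> asum f B.
Proof.
intros A n; eapply Rle_trans; [apply psum_reflect_le; intros; apply Rabs_pos|].
apply (A (S n)).
Qed.

Lemma in_lstar_vanishing dx a i : in_lstar dx a -> vanishing (a i).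
Proof.
intros [[M A] _]; destruct (A i) as [X _]; exact (asum_lim _ _ (asum_of_ex _ X)).
Qed.

Section StaticBounds.

Variables (dx rho : R) (X : state) (Zb Pb E : R).
Hypothesis Hdx : 0 < dx.
Hypothesis Hrho : 0 <= rho.
Hypothesis HB : in_B dx X.
Hypothesis HZ : forall j, Rabs (zeta X j) <= Zb.
Hypothesis HP : forall n, psum (fun j => Dp dx (zeta X) j ^ 2) n <= Pb.
Hypothesis HE : forall i j, (i <= j)%Z -> H X j - H X i <= E.

Definition diag_bound : R := 2 + 4 * Zb.

Lemma a_ge0 j : 0 <= avec dx X j.
Proof. destruct HB as (_ & _ & _ & _ & A); apply A. Qed.

Lemma h_ge0 j : 0 <= hvec dx X j.
Proof. destruct HB as (_ & _ & _ & _ & A); apply A. Qed.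

Lemma B_identity j : 2 * avec dx X j * hvec dx X j =
  U X j ^ 2 * avec dx X j ^ 2 + wvec dx X j ^ 2 + rbar X j ^ 2.
Proof. destruct HB as (_ & _ & _ & A & _); apply A. Qed.

Lemma in_B_kernel : B_kernel dx X.
Proof. exact (proj1 (proj2 HB)). Qed.

Lemma ypos_step j : ypos dx X (j + 1) - ypos dx X j = dx * avec dx X j.
Proof. unfold avec, Dp; field; lra. Qed.

Lemma ypos_dist j : Rabs (ypos dx X j - IZR j * dx) <= Zb.
Proof.
unfold ypos; replace (IZR j * dx + zeta X j - IZR j * dx) with (zeta X j) by ring.
apply HZ.
Qed.

Lemma a_dist n : psum (fun j => (avec dx X j - 1) ^ 2) n <= Pb.
Proof.
eapply Rle_trans; [|apply (HP n)]; right; apply psum_ext; intros j.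
rewrite avec_zeta by lra; ring.
Qed.

Lemma g_vanishing i : vanishing (ker_g X i).
Proof. destruct HB as ((_ & A & _) & _); now apply (in_lstar_vanishing dx). Qed.
Lemma k_vanishing i : vanishing (ker_k X i).
Proof. destruct HB as ((_ & _ & A & _) & _); now apply (in_lstar_vanishing dx). Qed.
Lemma gamma_vanishing i : vanishing (ker_gamma X i).
Proof. destruct HB as ((_ & _ & _ & A & _) & _); now apply (in_lstar_vanishing dx). Qed.
Lemma kappa_vanishing i : vanishing (ker_kappa X i).
Proof. destruct HB as ((_ & _ & _ & _ & A) & _); now apply (in_lstar_vanishing dx). Qed.

Definition sum_bound : R :=
  2 * (1 / dx) + 4 * (Pb * (2 + 4 * Zb)) + (2 * (2 * (2 + 4 * Zb) / dx) + 4 * (Pb * 1)).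

Lemma Zb_ge0 : 0 <= Zb.
Proof. generalize (HZ 0%Z) (Rabs_pos (zeta X 0%Z)); lra. Qed.

Lemma Pb_ge0 : 0 <= Pb.
Proof. exact (HP O). Qed.

Lemma g_bounds i : (forall j, 0 <= ker_g X i j <= diag_bound) /\
  (forall j, Rabs (ker_gamma X i j) <= 1) /\
  (forall n, dx * psum (fun j => avec dx X j *
      (ker_g X i j ^ 2 + ker_gamma X i j ^ 2)) n <= diag_bound) /\
  asum (ker_g X i) sum_bound /\ asum (ker_gamma X i) sum_bound.
Proof.
assert (Hv := fun j => proj1 (in_B_kernel i j)).
assert (Hu := fun j => proj1 (proj2 (in_B_kernel i j))).
assert (Lu := g_vanishing i); assert (Lv := gamma_vanishing i).
assert (D := green_diag_bound dx _ Hdx a_ge0 i _ _ Hv Hu Lu Lv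
               _ _ ypos_step ypos_dist); fold diag_bound in D.
assert (HZ0 := Zb_ge0); assert (HP0 := Pb_ge0).
assert (Q1 : 0 <= 1 / dx) by (apply Rlt_le, Rdiv_lt_0_compat; lra).
assert (Q2 : 0 <= 2 * (2 + 4 * Zb) / dx) by (apply Rlt_le, Rdiv_lt_0_compat; lra).
assert (Q3 : 0 <= Pb * (2 + 4 * Zb)) by (apply Rmult_le_pos; lra).
split; [|split; [|split; [|split]]].
- intros j; split; [apply (green_u_ge0 dx _ Hdx a_ge0 i _ _ Hv Hu Lu Lv)|].
  eapply Rle_trans; [apply (green_u_le_diag dx _ Hdx a_ge0 i _ _ Hv Hu Lu Lv)|easy].
- apply (green_v_bound dx _ Hdx a_ge0 i _ _ Hv Hu Lu Lv).
- intros n; eapply Rle_trans; [apply (green_energy dx _ Hdx a_ge0 i _ _ Hv Hu Lu Lv)|easy].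
- eapply asum_weak; [apply (green_u_sum dx _ Hdx a_ge0 i _ _ Hv Hu Lu Lv _ _
    ypos_step ypos_dist Pb a_dist)|unfold sum_bound; lra].
- eapply asum_weak; [apply (green_v_sum dx _ Hdx a_ge0 i _ _ Hv Hu Lu Lv _ _
    ypos_step ypos_dist Pb a_dist)|unfold sum_bound; lra].
Qed.

(* The reflection [j -> -j] turns the equations of [k], [kappa] into those of
   [g], [gamma], with [-kappa] in the role of [gamma]. *)
Lemma k_bounds i : (forall j, 0 <= ker_k X i j <= diag_bound) /\
  (forall j, Rabs (ker_kappa X i j) <= 1) /\
  (forall n, dx * psum (fun j => avec dx X j *
      (ker_k X i j ^ 2 + ker_kappa X i j ^ 2)) n <= diag_bound) /\
  asum (ker_k X i) sum_bound /\ asum (ker_kappa X i) sum_bound.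
Proof.
pose (a' j := avec dx X (- j)).
pose (u j := ker_k X i (- j)%Z); pose (v j := - ker_kappa X i (- j)%Z).
(* Reflection turns forward differences into backward ones. The index [1 - j] undoes this shift, and
   adding [dx] brings [y] back to within [Zb] of the grid. *)
pose (y j := - ypos dx X (1 - j) + dx).
assert (Ha : forall j, 0 <= a' j) by (intros; apply a_ge0).
assert (Hv : forall j, a' j * u j - Dm dx v j = kron (- i) j / dx).
{ intros j; destruct (in_B_kernel i (- j)%Z) as (_ & _ & A & _).
  replace (kron (- i) j) with (kron i (- j))
    by (unfold kron; repeat destruct Z.eq_dec; lia || lra).
  rewrite <- A; unfold a', u, v, Dp, Dm.
  replace (- (j - 1))%Z with (- j + 1)%Z by lia; field; lra. }
assert (Hu : forall j, Dp dx u j = a' j * v j).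
{ intros j; destruct (in_B_kernel i (- j)%Z) as (_ & _ & _ & A & _).
  unfold a', u, v, Dp, Dm in *; replace (- (j + 1))%Z with (- j - 1)%Z by lia.
  rewrite <- Ropp_mult_distr_r, <- A; field; lra. }
assert (Lu : vanishing u) by apply vanishing_reflect, k_vanishing.
assert (Lv : vanishing v)
  by apply (vanishing_opp (fun j => ker_kappa X i (- j)%Z)),
     vanishing_reflect, kappa_vanishing.
assert (Hy : forall j, y (j + 1)%Z - y j = dx * a' j).
{ intros j; unfold y, a'; rewrite <- ypos_step.
  replace (1 - (j + 1))%Z with (- j)%Z by lia.
  replace (1 - j)%Z with (- j + 1)%Z by lia; ring. }
assert (HyZ : forall j, Rabs (y j - IZR j * dx) <= Zb).
{ intros j; rewrite <- Rabs_Ropp.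
  replace (- (y j - IZR j * dx)) with (ypos dx X (1 - j) - IZR (1 - j) * dx)
    by (unfold y; rewrite minus_IZR; ring).
  apply ypos_dist. }
assert (HP' : forall n, psum (fun j => (a' j - 1) ^ 2) n <= Pb).
{ intros n; eapply Rle_trans; [|apply (a_dist (S n))].
  apply (psum_reflect_le' (fun j => (avec dx X j - 1) ^ 2)); intros; apply pow2_ge_0. }
assert (D := green_diag_bound dx _ Hdx Ha _ _ _ Hv Hu Lu Lv _ _ Hy HyZ).
fold diag_bound in D.
assert (HZ0 := Zb_ge0); assert (HP0 := Pb_ge0).
assert (Q1 : 0 <= 1 / dx) by (apply Rlt_le, Rdiv_lt_0_compat; lra).
assert (Q2 : 0 <= 2 * (2 + 4 * Zb) / dx) by (apply Rlt_le, Rdiv_lt_0_compat; lra).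
assert (Q3 : 0 <= Pb * (2 + 4 * Zb)) by (apply Rmult_le_pos; lra).
split; [|split; [|split; [|split]]].
- intros j; replace (ker_k X i j) with (u (- j)%Z) by (unfold u; f_equal; lia).
  split; [apply (green_u_ge0 dx _ Hdx Ha _ _ _ Hv Hu Lu Lv)|].
  eapply Rle_trans; [apply (green_u_le_diag dx _ Hdx Ha _ _ _ Hv Hu Lu Lv)|easy].
- intros j; rewrite <- Rabs_Ropp.
  replace (- ker_kappa X i j) with (v (- j)%Z) by (unfold v; do 2 f_equal; lia).
  apply (green_v_bound dx _ Hdx Ha _ _ _ Hv Hu Lu Lv).
- intros n; eapply Rle_trans;
    [|eapply Rle_trans; [apply (green_energy dx _ Hdx Ha _ _ _ Hv Hu Lu Lv (S n))|easy]].
  apply Rmult_le_compat_l; [lra|].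
  eapply Rle_trans; [apply psum_reflect_le|].
  + intros j; apply Rmult_le_pos; [apply a_ge0|].
    apply Rplus_le_le_0_compat; apply pow2_ge_0.
  + right; apply psum_ext; intros j; unfold a', u, v; ring.
- apply asum_reflect; eapply asum_weak; [apply (green_u_sum dx _ Hdx Ha _ _ _ Hv Hu Lu Lv _ _
    Hy HyZ Pb HP')|unfold sum_bound; lra].
- apply asum_reflect; apply (asum_ext _ (fun j => - v j)).
  + intros j; unfold v; ring.
  + apply asum_opp; eapply asum_weak; [apply (green_v_sum dx _ Hdx Ha _ _ _ Hv Hu Lu Lv _ _
    Hy HyZ Pb HP')|unfold sum_bound; lra].
Qed.

Lemma g_sym i j : ker_g X j i = ker_g X i j.
Proof. apply (in_B_kernel i j). Qed.
Lemma k_sym i j : ker_k X j i = ker_k X i j.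
Proof. apply (in_B_kernel i j). Qed.
Lemma gamma_kappa i j : ker_gamma X j i = - ker_kappa X i j.
Proof. apply (in_B_kernel i j). Qed.

Lemma kernels_kb : kb (ker_g X) sum_bound /\ kb (ker_k X) sum_bound /\
  kb (ker_gamma X) sum_bound /\ kb (ker_kappa X) sum_bound.
Proof.
split; [|split; [|split]]; split.
- apply g_bounds.
- intros j; apply (asum_ext _ (ker_g X j)); [intros; apply g_sym|apply g_bounds].
- apply k_bounds.
- intros j; apply (asum_ext _ (ker_k X j)); [intros; apply k_sym|apply k_bounds].
- apply g_bounds.
- intros j; apply (asum_ext _ (fun i => - ker_kappa X j i)).
  + intros; apply gamma_kappa.
  + apply asum_opp, k_bounds.
- apply k_bounds.
- intros j; apply (asum_ext _ (fun i => - ker_gamma X j i)).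
  + intros i; rewrite gamma_kappa; ring.
  + apply asum_opp, g_bounds.
Qed.

(** * Sup bounds of [R], [Q] and [U] by the energy *)

Lemma E_ge0 : 0 <= E.
Proof. generalize (HE 0 0 ltac:(lia)); lra. Qed.

(** By (c), [2 a h >= (u a)^2 + w^2 >= 2 a |u w|], which settles the case [a > 0]; where [a = 0],
    (c) forces [w = 0]. *)
Lemma UDU_le_h j : Rabs (U X j * wvec dx X j) <= hvec dx X j.
Proof.
assert (I := B_identity j); assert (A := a_ge0 j); assert (Hh := h_ge0 j).
set (a := avec dx X j) in *; set (h := hvec dx X j) in *.
set (w := wvec dx X j) in *; set (u := U X j) in *; set (r := rbar X j) in *.
assert (R2 := pow2_ge_0 r); assert (W2 := pow2_ge_0 w).
destruct (Req_dec a 0) as [E0|N].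
- rewrite E0 in I; assert (w ^ 2 = 0) by lra.
  assert (w = 0) by nra; rewrite H0, Rmult_0_r, Rabs_R0; easy.
- assert (Hp : 0 < a) by lra.
  assert (S1 := pow2_ge_0 (u * a - w)); assert (S2 := pow2_ge_0 (u * a + w)).
  apply Rabs_le; split; apply (Rmult_le_reg_l a); lra.
Qed.

Lemma h_sum n : dx * psum (hvec dx X) n <= E.
Proof.
rewrite <- psum_scal, (psum_ext _ (fun j => H X (j + 1)%Z - H X j)).
- rewrite psum_telescope; apply HE; lia.
- intros j; unfold hvec, Dp; field; lra.
Qed.

(** By (c), [r^2 <= 2 a h]. Splitting the geometric mean leaves [h], which is summable, and puts the
    weight [a] on [c^2]; for [c] a kernel entry this is exactly what [green_energy] controls. *)
Lemma weighted_r_bound c j :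
  Rabs (c * rbar X j) <= / 2 * (avec dx X j * c ^ 2) + hvec dx X j.
Proof.
assert (I := B_identity j); assert (A := a_ge0 j); assert (Hh := h_ge0 j).
set (a := avec dx X j) in *; set (h := hvec dx X j) in *.
set (w := wvec dx X j) in *; set (u := U X j) in *; set (r := rbar X j) in *.
assert (c2 := pow2_ge_0 c).
assert (0 <= a * c ^ 2) by now apply Rmult_le_pos.
apply abs_le_of_sqr; [lra|].
assert (Hr : r ^ 2 <= 2 * a * h).
{ assert (0 <= (u * a) ^ 2) by apply pow2_ge_0.
  assert (0 <= w ^ 2) by apply pow2_ge_0; lra. }
assert (c ^ 2 * r ^ 2 <= c ^ 2 * (2 * a * h)) by now apply Rmult_le_compat_l.
assert (S := pow2_ge_0 (/ 2 * (a * c ^ 2) - h)); lra.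
Qed.

(** One constant serves both: in [Q] the sup bound [diag_bound] is that of [g] and 1 that of
    [kappa], in [R] 1 is that of [gamma] and [diag_bound] that of [k]. The terms with [rho] come
    from [weighted_r_bound]. *)
Definition RQ_sup : R := diag_bound * E + E + rho * (/ 2 * diag_bound + E).

Lemma conv_UDU_bound a j B : (forall i, Rabs (a i j) <= B) ->
  Rabs (dx * kv a (fun i => U X i * Dp dx (U X) i) j) <= B * E.
Proof.
intros Ha; assert (HB0 : 0 <= B) by (generalize (Ha 0%Z) (Rabs_pos (a 0%Z j)); lra).
rewrite Rabs_mult, (Rabs_pos_eq dx) by lra.
apply Rle_trans with (dx * (B * (E / dx))); [|right; field; lra].
apply Rmult_le_compat_l; [lra|]; apply sumZ_bound, asum_mult_bd; [easy|].
intros n; apply (Rmult_le_reg_l dx); [easy|].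
replace (dx * (E / dx)) with E by (field; lra).
eapply Rle_trans; [|apply (h_sum n)]; apply Rmult_le_compat_l; [lra|].
apply psum_le; intros i; apply UDU_le_h.
Qed.

Lemma conv_h_bound a j B C : (forall i, Rabs (a i j) <= B) ->
  (forall n, dx * psum (fun i => avec dx X i * a i j ^ 2) n <= C) ->
  Rabs (dx * kv a (fun i => Dp dx (H X) i + rho * rbar X i) j)
    <= B * E + rho * (/ 2 * C + E).
Proof.
intros Ha HC; assert (HB0 : 0 <= B) by (generalize (Ha 0%Z) (Rabs_pos (a 0%Z j)); lra).
rewrite Rabs_mult, (Rabs_pos_eq dx) by lra.
apply Rle_trans with (dx * ((B * E + rho * (/ 2 * C + E)) / dx)); [|right; field; lra].
apply Rmult_le_compat_l; [lra|]; apply sumZ_bound; intros n.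
apply (Rmult_le_reg_l dx); [easy|].
replace (dx * ((B * E + rho * (/ 2 * C + E)) / dx))
  with (B * E + rho * (/ 2 * C + E)) by (field; lra).
apply Rle_trans with (dx * psum (fun i => B * hvec dx X i +
   rho * (/ 2 * (avec dx X i * a i j ^ 2) + hvec dx X i)) n).
- apply Rmult_le_compat_l; [lra|]; apply psum_le; intros i.
  rewrite Rmult_plus_distr_l; eapply Rle_trans; [apply Rabs_triang|].
  apply Rplus_le_compat.
  + rewrite Rabs_mult; fold (hvec dx X i); rewrite (Rabs_pos_eq (hvec dx X i)) by apply h_ge0.
    apply Rmult_le_compat_r; [apply h_ge0|easy].
  + replace (a i j * (rho * rbar X i)) with (rho * (a i j * rbar X i)) by ring.
    rewrite Rabs_mult, (Rabs_pos_eq rho) by easy.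
    apply Rmult_le_compat_l; [easy|apply weighted_r_bound].
- rewrite psum_plus, !psum_scal, psum_plus, !psum_scal.
  specialize (HC n); assert (S := h_sum n).
  replace (dx * (B * psum (hvec dx X) n + rho *
     (/ 2 * psum (fun i => avec dx X i * a i j ^ 2) n + psum (hvec dx X) n)))
    with (B * (dx * psum (hvec dx X) n) + rho *
     (/ 2 * (dx * psum (fun i => avec dx X i * a i j ^ 2) n) + dx * psum (hvec dx X) n))
    by ring.
  apply Rplus_le_compat; apply Rmult_le_compat_l; try easy; lra.
Qed.

Lemma split_energy (u v : Z -> R) C n : dx * psum (fun j => avec dx X j *
      (u j ^ 2 + v j ^ 2)) n <= C ->
  dx * psum (fun j => avec dx X j * u j ^ 2) n <= C /\
  dx * psum (fun j => avec dx X j * v j ^ 2) n <= C.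
Proof.
intros HC; split; (eapply Rle_trans; [|exact HC]); apply Rmult_le_compat_l;
  try lra; apply psum_le; intros j; apply Rmult_le_compat_l; try apply a_ge0;
  generalize (pow2_ge_0 (u j)) (pow2_ge_0 (v j)); lra.
Qed.

Lemma Q_sup j : Rabs (Qfun dx rho X j) <= RQ_sup.
Proof.
rewrite Qfun_kv; eapply Rle_trans; [apply Rabs_triang|].
unfold RQ_sup; rewrite Rplus_assoc; apply Rplus_le_compat.
- apply conv_UDU_bound; intros i.
  destruct (g_bounds i) as (A & _); specialize (A j); rewrite Rabs_pos_eq; lra.
- rewrite <- (Rmult_1_l E) at 1; apply conv_h_bound.
  + intros i; apply k_bounds.
  + intros n; rewrite (psum_ext _ (fun i => avec dx X i * ker_gamma X j i ^ 2)).
    * apply (split_energy (ker_g X j) (ker_gamma X j)), g_bounds.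
    * intros i; rewrite gamma_kappa; ring.
Qed.

Lemma R_sup j : Rabs (Rfun dx rho X j) <= RQ_sup.
Proof.
rewrite Rfun_kv; eapply Rle_trans; [apply Rabs_triang|].
unfold RQ_sup; rewrite (Rplus_comm (diag_bound * E)), Rplus_assoc.
apply Rplus_le_compat.
- rewrite <- (Rmult_1_l E) at 1; apply conv_UDU_bound; intros i; apply g_bounds.
- apply conv_h_bound.
  + intros i; destruct (k_bounds i) as (A & _); specialize (A j).
    rewrite Rabs_pos_eq; lra.
  + intros n; rewrite (psum_ext _ (fun i => avec dx X i * ker_k X j i ^ 2)).
    * apply (split_energy (ker_k X j) (ker_kappa X j)), k_bounds.
    * intros i; now rewrite k_sym.
Qed.

Lemma U_vanishing : vanishing (U X).
Proof.
destruct HB as [[[_ [[A _] _]] _] _].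
assert (B : asum (fun j => Rabs (U X j) ^ 2) (sumZ (fun j => Rabs (U X j) ^ 2))).
{ intros n; rewrite (psum_ext _ (fun j => Rabs (U X j) ^ 2)).
  - apply psum_le_sumZ; [exact A|intros; apply pow2_ge_0].
  - intros; apply Rabs_pos_eq, pow2_ge_0. }
assert (L : l2b (U X) (sqrt (sumZ (fun j => Rabs (U X j) ^ 2)))).
{ apply l2b_intro; [apply sqrt_pos|]; intros n; rewrite pow2_sqrt by apply (asum_ge0 _ _ B).
  specialize (B n); rewrite (psum_ext _ (fun j => U X j ^ 2)) in B; [easy|].
  intros j; rewrite pow2_abs; apply Rabs_pos_eq, pow2_ge_0. }
exact (l2b_lim _ _ L).
Qed.

(** By [UDU_le_h], [U^2 + 2 H] is nondecreasing in [j]: the discrete remainder [(dx w)^2] of the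
    difference of squares is favourable in this direction. The comparison is therefore with large
    indices, where [U] vanishes. *)
Lemma U_sup_energy j : U X j ^ 2 <= 2 * E.
Proof.
apply (is_lim_seq_le_loc (fun _ => U X j ^ 2)
  (fun n => U X (Z.of_nat n) * U X (Z.of_nat n) + 2 * E) (U X j ^ 2) (2 * E)).
- exists (Z.abs_nat j); intros n Hn.
  assert (C : U X j ^ 2 + 2 * H X j <= U X (Z.of_nat n) ^ 2 + 2 * H X (Z.of_nat n)).
  { apply (incr_chain (fun j => U X j ^ 2 + 2 * H X j)); [|lia]; intros m _.
    assert (K := UDU_le_h m); apply Rabs_le_between in K.
    assert (E1 : U X (m + 1)%Z = U X m + dx * wvec dx X m)
      by (unfold wvec, Dp; field; lra).
    assert (E2 : H X (m + 1)%Z = H X m + dx * hvec dx X m)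
      by (unfold hvec, Dp; field; lra).
    rewrite E1, E2; assert (S := pow2_ge_0 (dx * wvec dx X m)).
    assert (0 <= dx * (U X m * wvec dx X m + hvec dx X m)) by (apply Rmult_le_pos; lra).
    lra. }
  generalize (HE j (Z.of_nat n) ltac:(lia)); lra.
- apply is_lim_seq_const.
- replace (Finite (2 * E)) with (Finite (0 * 0 + 2 * E)) by (f_equal; ring).
  apply is_lim_seq_plus'; [|apply is_lim_seq_const].
  apply is_lim_seq_mult'; apply U_vanishing.
Qed.

(** A discrete Sobolev inequality with constant 1 on every grid: moving right, [- U^2] grows by at
    most [dx (U^2 + w^2)] per step. Unlike [U_sup_energy] it gives a bound linear in the norm, as
    the final estimate requires. *)
Lemma U_sup_h1 j S : (forall n, dx * psum (fun j => U X j ^ 2 + wvec dx X j ^ 2) n <= S) ->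
  U X j ^ 2 <= S.
Proof.
intros HS.
apply (is_lim_seq_le_loc (fun _ => U X j ^ 2)
  (fun n => U X (Z.of_nat n) * U X (Z.of_nat n) + S) (U X j ^ 2) S).
- exists (Z.abs_nat j); intros n Hn.
  (* [G] is frozen to the left of [j], so the symmetric window only sees the indices from [j] on. *)
  pose (G m := if Z_le_dec j m then - U X m ^ 2 else - U X j ^ 2).
  assert (T := psum_telescope G n).
  assert (P : psum (fun m => G (m + 1)%Z - G m) n <= S).
  { eapply Rle_trans; [|apply (HS n)]; rewrite <- psum_scal; apply psum_le; intros m.
    assert (E1 : U X (m + 1)%Z = U X m + dx * wvec dx X m)
      by (unfold wvec, Dp; field; lra).
    assert (0 <= dx * (U X m + wvec dx X m) ^ 2)
      by (apply Rmult_le_pos; [lra|apply pow2_ge_0]).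
    assert (0 <= dx * (U X m ^ 2 + wvec dx X m ^ 2))
      by (apply Rmult_le_pos; [lra|apply Rplus_le_le_0_compat; apply pow2_ge_0]).
    assert (S2 := pow2_ge_0 (dx * wvec dx X m)).
    unfold G; destruct (Z_le_dec j (m + 1)); destruct (Z_le_dec j m); try lia.
    - rewrite E1; lra.
    - replace (m + 1)%Z with j by lia; lra.
    - lra. }
  rewrite T in P; unfold G in P.
  destruct (Z_le_dec j (Z.of_nat n)); [|lia].
  destruct (Z_le_dec j (- Z.of_nat n)).
  + replace (- Z.of_nat n)%Z with j in P by lia; lra.
  + lra.
- apply is_lim_seq_const.
- replace (Finite S) with (Finite (0 * 0 + S)) by (f_equal; ring).
  apply is_lim_seq_plus'; [|apply is_lim_seq_const].
  apply is_lim_seq_mult'; apply U_vanishing.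
Qed.

(** * Bounds of [R] and [Q] in l^2 *)

Variable M : R.
Hypothesis HM : nrm dx X M.

(** [2 RQ_sup^2] absorbs the terms [p q^2] and [p r^2], [2 E] bounds the factor [U^2], and
    [2 + 2 rho^2] comes from [(h + rho rbar)^2]. *)
Definition RQ_l2_const : R := 2 * RQ_sup ^ 2 + 2 * E + 2 + 2 * rho ^ 2.

(** [a] has no positive lower bound, so the quadratic form alone is not coercive. With [a = 1 + p],
    the sup bound [S] of [q] turns [- p q^2] into at most [S^2 p^2 + q^2 / 4], and the same for [r];
    half of [q^2 + r^2] survives. *)
Lemma RQ_pointwise j : let q := Qfun dx rho X j in let r := Rfun dx rho X j in
  let p := Dp dx (zeta X) j in let h := hvec dx X j in
  / 2 * (q ^ 2 + r ^ 2) <=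
  (avec dx X j * (q ^ 2 + r ^ 2) - q * (U X j * wvec dx X j)
     - r * (h + rho * rbar X j))
  + RQ_l2_const * (p ^ 2 + wvec dx X j ^ 2 + h ^ 2 + rbar X j ^ 2).
Proof.
intros q r p h; rewrite avec_zeta by lra; fold p.
assert (BQ := Q_sup j); assert (BR := R_sup j); fold q in BQ; fold r in BR.
assert (BU := U_sup_energy j); assert (HE0 := E_ge0).
set (u := U X j) in *; set (w := wvec dx X j) in *; set (b := rbar X j).
set (S := RQ_sup) in *.
assert (Sq : forall x y, Rabs y <= S -> - (x * y * y) <= x ^ 2 * S ^ 2 + y ^ 2 / 4).
{ intros x y Hy; assert (0 <= S) by (generalize (Rabs_pos y); lra).
  assert (y ^ 2 <= S ^ 2) by (rewrite <- (pow2_abs y); apply pow_incr; split;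
     [apply Rabs_pos|easy]).
  assert (x ^ 2 * y ^ 2 <= x ^ 2 * S ^ 2)
    by (apply Rmult_le_compat_l; [apply pow2_ge_0|easy]).
  assert (Z := pow2_ge_0 (x * y + y / 2)); lra. }
assert (K1 := Sq p q BQ); assert (K2 := Sq p r BR).
assert (K3 := pow2_ge_0 (q / 2 - u * w)).
assert (K4 := pow2_ge_0 (r / 2 - (h + rho * b))).
assert (K5 : u ^ 2 * w ^ 2 <= 2 * E * w ^ 2)
  by (apply Rmult_le_compat_r; [apply pow2_ge_0|easy]).
assert (K6 := pow2_ge_0 (h - rho * b)).
assert (P1 := pow2_ge_0 p); assert (P2 := pow2_ge_0 w); assert (P3 := pow2_ge_0 h).
assert (P4 := pow2_ge_0 b); assert (P5 := pow2_ge_0 S); assert (P6 := pow2_ge_0 rho).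
assert (M1 := Rmult_le_pos _ _ P5 P2); assert (M2 := Rmult_le_pos _ _ P5 P3).
assert (M3 := Rmult_le_pos _ _ P5 P4); assert (M4 := Rmult_le_pos _ _ HE0 P1).
assert (M5 := Rmult_le_pos _ _ HE0 P3); assert (M6 := Rmult_le_pos _ _ HE0 P4).
assert (M7 := Rmult_le_pos _ _ P6 P1); assert (M8 := Rmult_le_pos _ _ P6 P2).
assert (M9 := Rmult_le_pos _ _ P6 P3); unfold RQ_l2_const; fold S.
assert (K7 : u * w * (u * w) = u ^ 2 * w ^ 2) by ring.
lra.
Qed.

(* [Q D_- R + R D_+ Q] is a telescoping sum. *)
Lemma RQ_telescope n :
  psum (fun j => avec dx X j * (Qfun dx rho X j ^ 2 + Rfun dx rho X j ^ 2)
     - Qfun dx rho X j * (U X j * wvec dx X j)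
     - Rfun dx rho X j * (hvec dx X j + rho * rbar X j)) n =
  / dx * (Qfun dx rho X (Z.of_nat n) * Rfun dx rho X (Z.of_nat n - 1)%Z
   - Qfun dx rho X (- Z.of_nat n)%Z * Rfun dx rho X (- Z.of_nat n - 1)%Z).
Proof.
rewrite <- (psum_telescope (fun j => Qfun dx rho X j * Rfun dx rho X (j - 1)%Z)).
rewrite <- psum_scal; apply psum_ext; intros j.
assert (ER := Dm_R dx rho X M j Hdx HM in_B_kernel).
assert (EQ := Dp_Q dx rho X M j Hdx HM in_B_kernel).
fold (wvec dx X j) in ER; fold (hvec dx X j) in EQ.
replace (hvec dx X j + rho * rbar X j)
  with (avec dx X j * Rfun dx rho X j - Dp dx (Qfun dx rho X) j) by lra.
replace (U X j * wvec dx X j)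
  with (avec dx X j * Qfun dx rho X j - Dm dx (Rfun dx rho X) j) by lra.
unfold Dp, Dm; replace (j + 1 - 1)%Z with j by lia; field; lra.
Qed.

(** Over a finite window the pointwise bound telescopes up to boundary terms. These vanish in the
    limit because [R] and [Q] are in l^2 with some bound [K], which depends on the grid and leaves
    no trace in the result. *)
Lemma RQ_l2 e : (forall n, psum (fun j => Dp dx (zeta X) j ^ 2 + wvec dx X j ^ 2
     + hvec dx X j ^ 2 + rbar X j ^ 2) n <= e) ->
  forall n, psum (fun j => Qfun dx rho X j ^ 2 + Rfun dx rho X j ^ 2) n
     <= 2 * RQ_l2_const * e.
Proof.
intros He n.
destruct (RQ_bound dx rho M) as [K [HK HRQ]]; destruct (HRQ X HM) as [BR BQ].
assert (HC : 0 <= RQ_l2_const).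
{ unfold RQ_l2_const; generalize (pow2_ge_0 RQ_sup) (pow2_ge_0 rho) E_ge0; lra. }
assert (VQ : vanishing (Qfun dx rho X)) by exact (l2b_lim _ _ BQ).
assert (VR : vanishing (fun j => Rfun dx rho X (j - 1)%Z))
  by exact (l2b_lim _ _ (l2b_prev _ _ BR)).
apply (is_lim_seq_le_loc
  (fun _ => psum (fun j => Qfun dx rho X j ^ 2 + Rfun dx rho X j ^ 2) n)
  (fun m => 2 * (/ dx * (Qfun dx rho X (Z.of_nat m) * Rfun dx rho X (Z.of_nat m - 1)%Z
   - Qfun dx rho X (- Z.of_nat m)%Z * Rfun dx rho X (- Z.of_nat m - 1)%Z))
     + 2 * RQ_l2_const * e)
  (psum (fun j => Qfun dx rho X j ^ 2 + Rfun dx rho X j ^ 2) n)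
  (2 * RQ_l2_const * e)).
- exists n; intros m Hm; rewrite <- RQ_telescope.
  apply Rle_trans with (psum (fun j => Qfun dx rho X j ^ 2 + Rfun dx rho X j ^ 2) m).
  { apply psum_mono; [|easy]; intros; apply Rplus_le_le_0_compat; apply pow2_ge_0. }
  assert (P := psum_le _ _ m RQ_pointwise).
  cbv beta zeta in P.
  rewrite psum_scal, (psum_plus _ (fun j => RQ_l2_const * _)), psum_scal in P.
  assert (Q := Rmult_le_compat_l _ _ _ HC (He m)); lra.
- apply is_lim_seq_const.
- replace (Finite (2 * RQ_l2_const * e))
    with (Finite (2 * (/ dx * (0 * 0 - 0 * 0)) + 2 * RQ_l2_const * e)) by (f_equal; ring).
  apply is_lim_seq_plus'; [|apply is_lim_seq_const].
  apply (is_lim_seq_scal_l _ 2 (Finite (/ dx * (0 * 0 - 0 * 0)))).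
  apply (is_lim_seq_scal_l _ (/ dx) (Finite (0 * 0 - 0 * 0))).
  apply is_lim_seq_minus'; apply is_lim_seq_mult';
    try apply VQ; apply VR.
Qed.

End StaticBounds.

(** * Growth in time *)

Definition edens (dx : R) (X : state) (j : Z) : R :=
  Dp dx (zeta X) j ^ 2 + U X j ^ 2 + wvec dx X j ^ 2 + hvec dx X j ^ 2 + rbar X j ^ 2.

(* [T] below is a time horizon, [Z] bounds the initial [zeta] and [E] is the
   energy; none of the constants depends on the grid size. *)
Definition speed (E : R) : R := sqrt (2 * E).
Definition zeta_sup (T Z E : R) : R := Z + T * speed E.
Definition flow_RQ (T Z E rho : R) : R := RQ_sup rho (zeta_sup T Z E) E.
Definition rate (T Z E rho : R) : R :=
  let S := flow_RQ T Z E rho in let V := speed E in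
  4 * (1 + S + V + V * S + V ^ 2 + rho)
    * (1 + 2 * RQ_l2_const rho (zeta_sup T Z E) E).

Section APriori.

Variables (dx rho T M : R) (X : R -> state).
Hypothesis Hdx : 0 < dx.
Hypothesis Hrho : 0 <= rho.
Hypothesis HN : forall t, 0 <= t < T -> nrm dx (X t) M.
Hypothesis HS : forall t, 0 <= t < T -> solves_at dx rho X t.
Hypothesis HB0 : in_B dx (X 0).

Let HB := flow_in_B dx rho T M X Hdx HN HS HB0.

(** [H] need not decay at infinity, but its time derivative [- U_j R_{j-1}] is square summable. The
    increment thus vanishes at both ends, which is the conservation of the total energy. *)
Lemma H_increment_l2 t : 0 <= t < T ->
  exists K, l2b (fun j => H (X t) j - H (X 0) j) K.
Proof.
intros Ht; destruct (RQ_bound dx rho M) as [K [HK HRQ]].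
exists (M * K * Rabs (t - 0)); intros n c Hc.
rewrite (psum_ext _ (fun j => c j * H (X t) j - c j * H (X 0) j)) by (intros; ring).
rewrite psum_minus.
apply (mean_value_bound (fun s => psum (fun j => c j * H (X s) j) n)
  (fun s => psum (fun j => c j * - (U (X s) j * Rfun dx rho (X s) (j - 1)%Z)) n));
  try lra; rewrite Rmin_left, Rmax_right by lra; intros r Hr.
- apply (deriv_at_psum (fun s j => c j * H (X s) j)
    (fun s j => c j * - (U (X s) j * Rfun dx rho (X s) (j - 1)%Z))).
  intros j; apply deriv_at_scal; apply (HS r ltac:(lra) j j).
- assert (N := HN r ltac:(lra)); destruct (HRQ _ N) as [BR _].
  destruct N as (_ & _ & Bu & _).
  apply (l2b_opp (fun j => U (X r) j * Rfun dx rho (X r) (j - 1)%Z)); [|easy].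
  apply l2b_mult_bd; [intros j; apply (l2b_term _ _ j Bu)|now apply l2b_prev].
Qed.

Lemma H_monotone t i j : 0 <= t < T -> (i <= j)%Z -> H (X t) i <= H (X t) j.
Proof.
intros Ht; apply incr_chain; intros k _.
assert (A := h_ge0 dx (X t) (HB t Ht) k); unfold hvec, Dp in A.
apply (Rmult_le_compat_r dx) in A; [|lra].
replace ((H (X t) (k + 1)%Z - H (X t) k) / dx * dx)
  with (H (X t) (k + 1)%Z - H (X t) k) in A by (field; lra); lra.
Qed.

Variables (Tc Z0 E0 A : R).
Hypothesis HTc : T <= Tc.
Hypothesis HZ0 : forall j, Rabs (zeta (X 0) j) <= Z0.
Hypothesis HE0 : forall i j, (i <= j)%Z -> H (X 0) j - H (X 0) i <= E0.
Hypothesis HA : forall n, psum (edens dx (X 0)) n <= A.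

(** Monotonicity in the index moves [i] and [j] out to infinity, where [H (X t)] and [H (X 0)]
    differ by less and less. *)
Lemma flow_energy t i j : 0 <= t < T -> (i <= j)%Z -> H (X t) j - H (X t) i <= E0.
Proof.
intros Ht Hij; destruct (H_increment_l2 t Ht) as [K BK].
destruct (l2b_lim _ _ BK) as [L1 L2].
pose (d k := H (X t) k - H (X 0) k).
apply (is_lim_seq_le_loc (fun _ => H (X t) j - H (X t) i)
  (fun n => (d (Z.of_nat n) - d (- Z.of_nat n)%Z) + E0)
  (H (X t) j - H (X t) i) E0).
- exists (Z.abs_nat i + Z.abs_nat j)%nat; intros n Hn; unfold d.
  generalize (H_monotone t j (Z.of_nat n) Ht ltac:(lia))
    (H_monotone t (- Z.of_nat n) i Ht ltac:(lia))
    (HE0 (- Z.of_nat n) (Z.of_nat n) ltac:(lia)); lra.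
- apply is_lim_seq_const.
- replace (Finite E0) with (Finite (0 - 0 + E0)) by (f_equal; ring).
  apply is_lim_seq_plus'; [|apply is_lim_seq_const].
  now apply is_lim_seq_minus'.
Qed.

Lemma E0_ge0 : 0 <= E0.
Proof. generalize (HE0 0 0 ltac:(lia)); lra. Qed.

Lemma speed_sqr : speed E0 ^ 2 = 2 * E0.
Proof. unfold speed; rewrite pow2_sqrt; [easy|generalize E0_ge0; lra]. Qed.

Lemma flow_U_sup t j : 0 <= t < T -> Rabs (U (X t) j) <= speed E0.
Proof.
intros Ht; apply abs_le_of_sqr; [apply sqrt_pos|]; rewrite speed_sqr.
apply (U_sup_energy dx (X t) E0 Hdx (HB t Ht)).
intros; now apply flow_energy.
Qed.

Lemma flow_zeta_sup t j : 0 <= t < T -> Rabs (zeta (X t) j) <= zeta_sup Tc Z0 E0.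
Proof.
intros Ht; unfold zeta_sup.
assert (Q : Rabs (zeta (X t) j - zeta (X 0) j) <= speed E0 * Rabs (t - 0)).
{ apply (mean_value_bound (fun s => zeta (X s) j) (fun s => U (X s) j)); try lra;
    rewrite Rmin_left, Rmax_right by lra; intros r Hr.
  - apply (HS r ltac:(lra) j j).
  - apply flow_U_sup; lra. }
rewrite Rminus_0_r, (Rabs_pos_eq t) in Q by lra.
replace (zeta (X t) j) with (zeta (X 0) j + (zeta (X t) j - zeta (X 0) j)) by ring.
eapply Rle_trans; [apply Rabs_triang|].
assert (0 <= speed E0) by apply sqrt_pos.
specialize (HZ0 j); assert (t * speed E0 <= Tc * speed E0)
  by (apply Rmult_le_compat_r; lra); lra.
Qed.

Lemma flow_p_sum t n : 0 <= t < T ->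
  psum (fun j => Dp dx (zeta (X t)) j ^ 2) n <= M ^ 2.
Proof. intros Ht; apply l2b_elim, (HN t Ht). Qed.

Lemma flow_Q_sup t j : 0 <= t < T ->
  Rabs (Qfun dx rho (X t) j) <= flow_RQ Tc Z0 E0 rho.
Proof.
intros Ht; apply (Q_sup dx rho (X t) _ (M ^ 2) _ Hdx Hrho (HB t Ht)).
- intros; now apply flow_zeta_sup.
- intros; now apply flow_p_sum.
- intros; now apply flow_energy.
Qed.

Lemma flow_R_sup t j : 0 <= t < T ->
  Rabs (Rfun dx rho (X t) j) <= flow_RQ Tc Z0 E0 rho.
Proof.
intros Ht; apply (R_sup dx rho (X t) _ (M ^ 2) _ Hdx Hrho (HB t Ht)).
- intros; now apply flow_zeta_sup.
- intros; now apply flow_p_sum.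
- intros; now apply flow_energy.
Qed.

Definition edens_deriv (x : state) (j : Z) : R :=
  2 * Dp dx (zeta x) j * wvec dx x j + 2 * U x j * - Qfun dx rho x j
  + 2 * wvec dx x j * (- (avec dx x j * Rfun dx rho x j)
     + (hvec dx x j + rho * rbar x j))
  + 2 * hvec dx x j * (- (wvec dx x j * Rfun dx rho x j) - U x j *
       (avec dx x j * Qfun dx rho x j - U x j * wvec dx x j))
  + 2 * rbar x j * - (rho * wvec dx x j).

Lemma edens_has_deriv t j : 0 <= t < T ->
  deriv_at (fun s => edens dx (X s) j) t (edens_deriv (X t) j).
Proof.
intros Ht; unfold edens, edens_deriv.
assert (S := HS t Ht).
assert (Dz : deriv_at (fun s => Dp dx (zeta (X s)) j) t (wvec dx (X t) j)).
{ apply deriv_at_Dp; intros k; apply (S k k). }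
assert (Dw := deriv_wvec dx rho T M X Hdx HN HS HB0 t j Ht).
assert (Dh := deriv_hvec dx rho T M X Hdx HN HS HB0 t j Ht).
destruct (S j j) as (_ & Du & _ & Dr & _).
repeat apply deriv_at_plus.
- now apply (deriv_at_sqr (fun s => Dp dx (zeta (X s)) j)).
- now apply (deriv_at_sqr (fun s => U (X s) j)).
- now apply (deriv_at_sqr (fun s => wvec dx (X s) j)).
- now apply (deriv_at_sqr (fun s => hvec dx (X s) j)).
- now apply (deriv_at_sqr (fun s => rbar (X s) j)).
Qed.

Lemma young c B x y : Rabs c <= B -> 2 * (c * (x * y)) <= B * (x ^ 2 + y ^ 2).
Proof.
intros Hc; assert (0 <= B) by (generalize (Rabs_pos c); lra).
apply Rabs_le_between in Hc.
assert (S1 := pow2_ge_0 (x - y)); assert (S2 := pow2_ge_0 (x + y)).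
assert (P1 : 0 <= (B + c) * (x - y) ^ 2) by (apply Rmult_le_pos; lra).
assert (P2 : 0 <= (B - c) * (x + y) ^ 2) by (apply Rmult_le_pos; lra).
lra.
Qed.

(** In every product all but two factors have a sup bound. These bounds are the summands of the
    constant, and [young] treats the remaining two factors. *)
Lemma edens_deriv_bound t j : 0 <= t < T ->
  let S := flow_RQ Tc Z0 E0 rho in let V := speed E0 in
  edens_deriv (X t) j <= 4 * (1 + S + V + V * S + V ^ 2 + rho) *
    (edens dx (X t) j + (Qfun dx rho (X t) j ^ 2 + Rfun dx rho (X t) j ^ 2)).
Proof.
intros Ht S V; unfold edens_deriv, edens; rewrite avec_zeta by lra.
assert (BQ := flow_Q_sup t j Ht); assert (BR := flow_R_sup t j Ht).
assert (BU := flow_U_sup t j Ht); fold S in BQ, BR; fold V in BU.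
set (p := Dp dx (zeta (X t)) j); set (u := U (X t) j) in *.
set (w := wvec dx (X t) j); set (h := hvec dx (X t) j); set (b := rbar (X t) j).
set (q := Qfun dx rho (X t) j) in *; set (r := Rfun dx rho (X t) j) in *.
clearbody S V p u w h b q r.
assert (HS0 : 0 <= S) by (generalize (Rabs_pos q); lra).
assert (HV0 : 0 <= V) by (generalize (Rabs_pos u); lra).
assert (B1 : Rabs 1 <= 1) by (rewrite Rabs_R1; lra).
assert (B1' : Rabs (-1) <= 1) by (rewrite Rabs_left; lra).
assert (Br : Rabs rho <= rho) by (rewrite Rabs_pos_eq; lra).
assert (Br' : Rabs (- rho) <= rho) by (rewrite Rabs_Ropp; easy).
assert (BR' : Rabs (- r) <= S) by (rewrite Rabs_Ropp; easy).
assert (BU' : Rabs (- u) <= V) by (rewrite Rabs_Ropp; easy).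
assert (BUQ : Rabs (- (u * q)) <= V * S).
{ rewrite Rabs_Ropp, Rabs_mult; apply Rmult_le_compat; auto; apply Rabs_pos. }
assert (BUU : Rabs (u * u) <= V ^ 2).
{ rewrite Rabs_mult; simpl; rewrite Rmult_1_r.
  apply Rmult_le_compat; auto; apply Rabs_pos. }
assert (Y1 := young 1 1 p w B1); assert (Y2 := young (-1) 1 u q B1').
assert (Y3 := young (-1) 1 w r B1'); assert (Y4 := young (- r) S w p BR').
assert (Y5 := young 1 1 w h B1); assert (Y6 := young rho rho w b Br).
assert (Y7 := young (- r) S h w BR'); assert (Y8 := young (- u) V h q BU').
assert (Y9 := young (- (u * q)) (V * S) h p BUQ).
assert (Y10 := young (u * u) (V ^ 2) h w BUU).
assert (Y11 := young (- rho) rho b w Br').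
assert (HVS : 0 <= V * S) by now apply Rmult_le_pos.
assert (HVV : 0 <= V ^ 2) by apply pow2_ge_0.
assert (Sq : forall x, 0 <= S * x ^ 2 /\ 0 <= V * x ^ 2 /\ 0 <= (V * S) * x ^ 2 /\
   0 <= V ^ 2 * x ^ 2 /\ 0 <= rho * x ^ 2 /\ 0 <= x ^ 2).
{ intros x; assert (Hx := pow2_ge_0 x).
  repeat split; try (apply Rmult_le_pos; lra); lra. }
generalize (Sq p) (Sq u) (Sq w) (Sq h) (Sq b) (Sq q) (Sq r); intros.
repeat match goal with K : _ /\ _ |- _ => destruct K end.
lra.
Qed.

Lemma rate_ge0 : 0 < T -> 0 <= rate Tc Z0 E0 rho.
Proof.
intros HT; unfold rate; cbv zeta.
assert (S0 : 0 <= flow_RQ Tc Z0 E0 rho).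
{ generalize (flow_Q_sup 0 0 ltac:(lra)) (Rabs_pos (Qfun dx rho (X 0) 0)); lra. }
assert (V0 : 0 <= speed E0) by apply sqrt_pos.
assert (VS := Rmult_le_pos _ _ V0 S0).
apply Rmult_le_pos; [generalize (pow2_ge_0 (speed E0)); lra|].
unfold RQ_l2_const.
generalize (pow2_ge_0 (RQ_sup rho (zeta_sup Tc Z0 E0) E0)) (pow2_ge_0 rho) E0_ge0; lra.
Qed.

Lemma flow_edens t n : 0 <= t < T ->
  psum (edens dx (X t)) n <= A * exp (rate Tc Z0 E0 rho * t).
Proof.
intros Ht.
assert (HA0 : 0 <= A) by exact (HA O).
(* [M] and [W] depend on the grid; as the crude bound of the Gronwall iteration they disappear from
   its conclusion. *)
pose (W := Rabs (/ dx) * (M + M)).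
assert (HT : 0 < T) by lra; revert n t Ht.
(* The family is indexed by the window, so no infinite sum is differentiated; the nonlocal terms
   [Q^2 + R^2] on one window are bounded through the energy on all windows. *)
apply (gronwall_family nat (fun n t => psum (edens dx (X t)) n)
  (fun n t => psum (edens_deriv (X t)) n) T (rate Tc Z0 E0 rho) A
  (M ^ 2 + M ^ 2 + W ^ 2 + M ^ 2 + M ^ 2)); auto.
- now apply rate_ge0.
- generalize (pow2_ge_0 M) (pow2_ge_0 W); lra.
- intros n t Ht; apply (deriv_at_psum (fun s j => edens dx (X s) j)
    (fun s j => edens_deriv (X s) j)); intros; now apply edens_has_deriv.
- intros n t Ht; unfold edens; rewrite !psum_plus.
  assert (N := HN t Ht); destruct N as (_ & Bdz & Bu & _ & Bdh & Br & _).
  assert (Bw := l2b_Dp dx _ _ Bu); fold W in Bw.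
  repeat apply Rplus_le_compat; apply l2b_elim; assumption.
- intros t D Ht HD HfD n; unfold rate; cbv zeta.
  set (S := flow_RQ Tc Z0 E0 rho); set (V := speed E0).
  set (C6 := 4 * (1 + S + V + V * S + V ^ 2 + rho)).
  assert (HC6 : 0 <= C6).
  { assert (S0 : 0 <= S).
    { generalize (flow_Q_sup 0 0 ltac:(lra)) (Rabs_pos (Qfun dx rho (X 0) 0)).
      unfold S; lra. }
    assert (V0 : 0 <= V) by apply sqrt_pos; assert (VS := Rmult_le_pos _ _ V0 S0).
    unfold C6; generalize (pow2_ge_0 V); lra. }
  eapply Rle_trans; [apply psum_le; intros j; apply (edens_deriv_bound t j Ht)|].
  fold S V C6; rewrite psum_scal, Rmult_assoc; apply Rmult_le_compat_l; [easy|].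
  rewrite psum_plus, Rmult_plus_distr_r, Rmult_1_l; apply Rplus_le_compat; [apply HfD|].
  apply (RQ_l2 dx rho (X t) (zeta_sup Tc Z0 E0) (M ^ 2) E0 Hdx Hrho (HB t Ht)) with (M := M).
  + intros; now apply flow_zeta_sup.
  + intros; now apply flow_p_sum.
  + intros; now apply flow_energy.
  + auto.
  + intros m; eapply Rle_trans; [|apply (HfD m)]; apply psum_le; intros j.
    unfold edens; generalize (pow2_ge_0 (U (X t) j)); lra.
Qed.

End APriori.

(** * Global existence *)

(** The bound [M] keeps the supremum finite; at infinity [real] would return a default value. *)
Lemma norm_linf_spec v M : (forall j, Rabs (v j) <= M) ->
  (forall j, Rabs (v j) <= norm_linf v) /\ norm_linf v <= M.
Proof.
intros B; unfold norm_linf.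
destruct (Lub_Rbar_correct (fun x => exists j : Z, x = Rabs (v j))) as [U L].
destruct (Lub_Rbar (fun x => exists j : Z, x = Rabs (v j))) as [l| |]; simpl in *.
- split.
  + intros j; apply (U (Rabs (v j))); now exists j.
  + apply (L (Finite M)); intros x [j ->]; apply B.
- exfalso; apply (L (Finite M)); intros x [j ->]; apply B.
- exfalso; apply (U (Rabs (v 0%Z))); now exists 0%Z.
Qed.

Lemma norm_linf_ge0 v : in_linf v -> 0 <= norm_linf v.
Proof.
intros [M B]; destruct (norm_linf_spec v M B) as [K _].
eapply Rle_trans; [apply Rabs_pos|apply (K 0%Z)].
Qed.

Lemma in_l2_psum v n : in_l2 v ->
  psum (fun j => v j ^ 2) n <= sumZ (fun j => Rabs (v j) ^ 2).
Proof.
intros B; rewrite (psum_ext _ (fun j => Rabs (v j) ^ 2))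
  by (intros; now rewrite pow2_abs).
apply psum_le_sumZ; [exact B|intros; apply pow2_ge_0].
Qed.

Lemma sumZ_le_bound f B : (forall j, 0 <= f j) -> (forall n, psum f n <= B) ->
  sumZ f <= B.
Proof.
intros P A; eapply Rle_trans; [apply Rle_abs|apply sumZ_bound]; intros n.
rewrite (psum_ext _ f); [apply A|intros; apply Rabs_pos_eq, P].
Qed.

Lemma norm_l2_psum dx v n : 0 < dx -> in_l2 v ->
  dx * psum (fun j => v j ^ 2) n <= norm_l2 dx v ^ 2.
Proof.
intros Hdx B; unfold norm_l2; rewrite pow2_sqrt.
- apply Rmult_le_compat_l; [lra|now apply in_l2_psum].
- apply Rmult_le_pos; [lra|exact (in_l2_psum v O B)].
Qed.

Lemma norm_l2_le dx v B : 0 < dx -> 0 <= B ->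
  (forall n, dx * psum (fun j => v j ^ 2) n <= B ^ 2) -> norm_l2 dx v <= B.
Proof.
intros Hdx HB A; unfold norm_l2; rewrite <- (sqrt_pow2 B) by easy.
apply sqrt_le_1_alt; apply (Rmult_le_reg_l (/ dx)); [now apply Rinv_0_lt_compat|].
rewrite <- Rmult_assoc, Rinv_l, Rmult_1_l by lra.
apply sumZ_le_bound; [intros; apply pow2_ge_0|]; intros n.
apply (Rmult_le_reg_l dx); [easy|].
rewrite <- Rmult_assoc, Rinv_r, Rmult_1_l by lra.
eapply Rle_trans; [|apply (A n)]; right; f_equal; apply psum_ext; intros.
apply pow2_abs.
Qed.

Lemma norm_l2_ge0 dx v : 0 <= norm_l2 dx v.
Proof. apply sqrt_pos. Qed.

Lemma l2b_norm_l2 dx v M : 0 < dx -> l2b v M -> norm_l2 dx v <= sqrt dx * M.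
Proof.
intros Hdx B; apply norm_l2_le; [easy| |].
- apply Rmult_le_pos; [apply sqrt_pos|now apply (l2b_ge0 v)].
- intros n; rewrite Rpow_mult_distr, pow2_sqrt by lra.
  apply Rmult_le_compat_l; [lra|now apply l2b_elim].
Qed.

Lemma norm_l2_l2b dx v : 0 < dx -> in_l2 v -> l2b v (/ sqrt dx * norm_l2 dx v).
Proof.
intros Hdx B; assert (Hs : 0 < sqrt dx) by now apply sqrt_lt_R0.
apply l2b_intro.
- apply Rmult_le_pos; [left; now apply Rinv_0_lt_compat|apply norm_l2_ge0].
- intros n; assert (K := norm_l2_psum dx v n Hdx B).
  rewrite Rpow_mult_distr, pow_inv, pow2_sqrt by lra.
  apply (Rmult_le_reg_l dx); [easy|].
  rewrite <- Rmult_assoc, Rinv_r, Rmult_1_l by lra; exact K.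
Qed.

Lemma sqrt_sum_le a b : 0 <= a -> 0 <= b -> sqrt (a ^ 2 + b ^ 2) <= a + b.
Proof.
intros Ha Hb; rewrite <- (sqrt_pow2 (a + b)) by lra.
apply sqrt_le_1_alt; assert (0 <= a * b) by (now apply Rmult_le_pos); lra.
Qed.

(* Zero kernels, so that the norm on states also measures an [evec]. *)
Definition lift (v : evec) : state :=
  State v (fun _ _ => 0) (fun _ _ => 0) (fun _ _ => 0) (fun _ _ => 0).

Lemma kb_zero M : 0 <= M -> kb (fun _ _ => 0) M.
Proof.
assert (A : 0 <= M -> asum (fun _ => 0) M).
{ intros HM n; rewrite (psum_ext _ (fun _ => 0 * 0)); [rewrite psum_scal; lra|].
  intros; rewrite Rabs_R0; ring. }
intros HM; split; auto.
Qed.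

Lemma norm_E_ge0 dx v : in_E dx v -> 0 <= norm_E dx v.
Proof.
intros [[Bz _] [_ [[Bh _] _]]]; unfold norm_E, norm_V.
generalize (norm_linf_ge0 _ Bz) (norm_linf_ge0 _ Bh) (norm_l2_ge0 dx (Dp dx (zeta v)))
  (norm_l2_ge0 dx (Dp dx (H v))) (norm_l2_ge0 dx (rbar v))
  (sqrt_pos (norm_l2 dx (U v) ^ 2 + norm_l2 dx (Dp dx (U v)) ^ 2)).
unfold norm_h1; lra.
Qed.

Lemma norm_h1_l2 dx v : norm_l2 dx v <= norm_h1 dx v.
Proof.
unfold norm_h1; rewrite <- (sqrt_pow2 (norm_l2 dx v)) at 1 by apply norm_l2_ge0.
apply sqrt_le_1_alt; generalize (pow2_ge_0 (norm_l2 dx (Dp dx v))); lra.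
Qed.

Lemma in_E_nrm dx v : 0 < dx -> in_E dx v ->
  nrm dx (lift v) ((1 + / sqrt dx) * norm_E dx v).
Proof.
intros Hdx HE; assert (HN := norm_E_ge0 dx v HE).
destruct HE as [[[M1 Bz] Bdz] [[Bu Bdu] [[[M2 Bh] Bdh] Br]]].
assert (Hs : 0 < / sqrt dx) by now apply Rinv_0_lt_compat, sqrt_lt_R0.
destruct (norm_linf_spec _ _ Bz) as [Nz _]; destruct (norm_linf_spec _ _ Bh) as [Nh _].
assert (Pz := norm_linf_ge0 _ (ex_intro _ _ Bz)).
assert (Ph := norm_linf_ge0 _ (ex_intro _ _ Bh)).
assert (P1 := norm_l2_ge0 dx (Dp dx (zeta v))).
assert (P2 := norm_l2_ge0 dx (Dp dx (H v))); assert (P3 := norm_l2_ge0 dx (rbar v)).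
assert (P4 := norm_l2_ge0 dx (U v)); assert (P5 := norm_h1_l2 dx (U v)).
assert (E : norm_E dx v = norm_linf (zeta v) + norm_l2 dx (Dp dx (zeta v))
  + norm_h1 dx (U v) + (norm_linf (H v) + norm_l2 dx (Dp dx (H v)))
  + norm_l2 dx (rbar v)) by reflexivity.
set (N := norm_E dx v) in *; clearbody N.
assert (K1 : 0 <= / sqrt dx * N) by (apply Rmult_le_pos; lra).
assert (K2 : forall x, x <= N -> / sqrt dx * x <= (1 + / sqrt dx) * N).
{ intros x Hx; assert (/ sqrt dx * x <= / sqrt dx * N)
    by (apply Rmult_le_compat_l; lra); lra. }
assert (KZ : kb (fun _ _ => 0) ((1 + / sqrt dx) * N)) by (apply kb_zero; lra).
split; [|split; [|split; [|split; [|split; [|split; [|auto]]]]]].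
- intros j; simpl; specialize (Nz j); lra.
- eapply l2b_weak; [|apply norm_l2_l2b; [exact Hdx|eassumption]]; apply K2; cbn [lift ev]; lra.
- eapply l2b_weak; [|apply norm_l2_l2b; [exact Hdx|eassumption]]; apply K2; cbn [lift ev]; lra.
- intros j; simpl; specialize (Nh j); lra.
- eapply l2b_weak; [|apply norm_l2_l2b; [exact Hdx|eassumption]]; apply K2; cbn [lift ev]; lra.
- eapply l2b_weak; [|apply norm_l2_l2b; [exact Hdx|eassumption]]; apply K2; cbn [lift ev]; lra.
Qed.

(** 2 for the two sup norms, [4 * sqrt dx] for the l^2 norms of [D_+ zeta], [U], [D_+ H] and [rbar],
    and the last term for [D_+ U], estimated by [l2b_Dp]. *)
Definition norm_E_const (dx : R) : R := 2 + 4 * sqrt dx + 2 * sqrt dx * Rabs (/ dx).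

Lemma nrm_norm_E dx (Y : state) M : 0 < dx -> nrm dx Y M ->
  norm_E dx Y <= norm_E_const dx * M.
Proof.
intros Hdx (Bz & Bdz & Bu & Bh & Bdh & Br & _).
assert (Bw := l2b_Dp dx _ _ Bu).
destruct (norm_linf_spec _ _ Bz) as [_ Nz]; destruct (norm_linf_spec _ _ Bh) as [_ Nh].
apply (l2b_norm_l2 dx _ _ Hdx) in Bdz, Bu, Bdh, Br, Bw.
assert (K := sqrt_sum_le _ _ (norm_l2_ge0 dx (U Y)) (norm_l2_ge0 dx (Dp dx (U Y)))).
unfold norm_E, norm_V, norm_h1, norm_E_const in *; lra.
Qed.

Lemma norm_E_const_ge0 dx : 0 <= norm_E_const dx.
Proof.
unfold norm_E_const; generalize (sqrt_pos dx)
  (Rmult_le_pos _ _ (sqrt_pos dx) (Rabs_pos (/ dx))); lra.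
Qed.

Lemma nrm_in_E dx (Y : state) M : 0 < dx -> nrm dx Y M -> in_E dx Y.
Proof. intros Hdx N; apply (nrm_in_Eker dx Y M Hdx N). Qed.

Lemma flat_unflat x : flat (unflat x) = x.
Proof. apply functional_extensionality; intros []; reflexivity. Qed.

Lemma flow_sol dx rho T M (X : R -> state) :
  (forall t, 0 <= t < T -> nrm dx (X t) M) ->
  (forall t, 0 <= t < T -> solves_at dx rho X t) ->
  sol idx (functionals dx) (rhs dx rho) (fun t => flat (X t)) T.
Proof.
intros HN HS; split.
- exists M; intros t Ht; apply bnd_nrm; rewrite unflat_flat; auto.
- now apply sol_solves.
Qed.

Lemma sol_flow dx rho T x : sol idx (functionals dx) (rhs dx rho) x T ->
  (exists M, forall t, 0 <= t < T -> nrm dx (unflat (x t)) M) /\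
  (forall t, 0 <= t < T -> solves_at dx rho (fun s => unflat (x s)) t).
Proof.
intros [[M B] D]; split.
- exists M; intros t Ht; now apply bnd_nrm, B.
- apply sol_solves; intros t Ht a; rewrite flat_unflat.
  apply (deriv_at_ext (fun s => x s a)); [|now apply D].
  intros s; now rewrite flat_unflat.
Qed.

(** * A priori bounds for continuation *)

Lemma edens_parts dx (Y : state) j : let e := edens dx Y j in
  Dp dx (zeta Y) j ^ 2 <= e /\ U Y j ^ 2 <= e /\ wvec dx Y j ^ 2 <= e /\
  hvec dx Y j ^ 2 <= e /\ rbar Y j ^ 2 <= e /\ U Y j ^ 2 + wvec dx Y j ^ 2 <= e.
Proof.
unfold edens.
generalize (pow2_ge_0 (Dp dx (zeta Y) j)) (pow2_ge_0 (U Y j))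
  (pow2_ge_0 (wvec dx Y j)) (pow2_ge_0 (hvec dx Y j)) (pow2_ge_0 (rbar Y j)).
intros; repeat split; lra.
Qed.

Definition B_nrm_const (dx Zb e Hb : R) : R :=
  Zb + sqrt e + Hb + sum_bound dx Zb e.

(** On [in_B] the relations (a) bound the kernels through [zeta] alone. This serves the
    continuation, and in the uniqueness proof it bounds the kernels of an arbitrary competitor. *)
Lemma B_nrm dx (Y : state) Zb e Hb : 0 < dx -> in_B dx Y ->
  (forall j, Rabs (zeta Y j) <= Zb) -> (forall n, psum (edens dx Y) n <= e) ->
  (forall j, Rabs (H Y j) <= Hb) -> nrm dx Y (B_nrm_const dx Zb e Hb).
Proof.
intros Hdx HB HZ He HH.
assert (He0 : 0 <= e) by exact (He O).
assert (HP : forall n, psum (fun j => Dp dx (zeta Y) j ^ 2) n <= e).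
{ intros n; eapply Rle_trans; [apply psum_le; intros j; apply edens_parts|apply He]. }
destruct (kernels_kb dx Y Zb e Hdx HB HZ HP) as (Kg & Kk & Ka & Kp).
assert (Z0 : 0 <= Zb) by (generalize (HZ 0%Z) (Rabs_pos (zeta Y 0%Z)); lra).
assert (H0 : 0 <= Hb) by (generalize (HH 0%Z) (Rabs_pos (H Y 0%Z)); lra).
assert (S0 := kb_ge0 _ _ Kg); assert (Q0 := sqrt_pos e).
unfold B_nrm_const.
assert (L : forall v, (forall j, v j ^ 2 <= edens dx Y j) ->
  l2b v (Zb + sqrt e + Hb + sum_bound dx Zb e)).
{ intros v Hv; apply (l2b_weak _ (sqrt e)); [lra|].
  apply l2b_intro; [easy|]; intros n; rewrite pow2_sqrt by easy.
  eapply Rle_trans; [apply psum_le, Hv|apply He]. }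
split; [|split; [|split; [|split; [|split; [|split]]]]].
- intros j; specialize (HZ j); lra.
- apply L; intros; apply edens_parts.
- apply L; intros; apply edens_parts.
- intros j; specialize (HH j); lra.
- apply L; intros j; apply (edens_parts dx Y j).
- apply L; intros; apply edens_parts.
- split; [|split; [|split]]; (eapply kb_weak; [|eassumption]); lra.
Qed.

Lemma in_B_init dx (Y : state) : in_B dx Y -> exists Zb Hb A,
  (forall j, Rabs (zeta Y j) <= Zb) /\ (forall j, Rabs (H Y j) <= Hb) /\
  (forall n, psum (edens dx Y) n <= A).
Proof.
intros [[[[[M1 Bz] Bdz] [[Bu Bdu] [[[M2 Bh] Bdh] Br]]] _] _].
exists M1, M2; eexists; split; [easy|split; [easy|]]; intros n.
unfold edens; rewrite !psum_plus.
repeat apply Rplus_le_compat; (eapply in_l2_psum; eassumption).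
Qed.

Section Existence.

Variables (dx rho : R) (X0 : state).
Hypothesis Hdx : 0 < dx.
Hypothesis Hrho : 0 <= rho.
Hypothesis HB0 : in_B dx X0.

(** [Mb] is fixed before [T'] and [M], as [sol_up_to] requires; the finite but unknown [M] only
    makes the invariance and the growth estimate applicable. *)
Lemma apriori_bound T : 0 < T -> exists Mb, nrm dx X0 Mb /\
  forall T' M (X : R -> state), T' <= T ->
    (forall t, 0 <= t < T' -> nrm dx (X t) M) ->
    (forall t, 0 <= t < T' -> solves_at dx rho X t) -> X 0 = X0 ->
    forall t, 0 <= t < T' -> nrm dx (X t) Mb.
Proof.
intros HT; destruct (in_B_init dx X0 HB0) as (Z0 & Hb & A & HZ & HH & HA).
(* [H] is not normalised at minus infinity here, so its oscillation, at most twice its supremum,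
   takes the place of the energy. *)
pose (E0 := 2 * Hb).
assert (HE : forall i j, (i <= j)%Z -> H X0 j - H X0 i <= E0).
{ intros i j _; generalize (HH i) (HH j); intros K1 K2.
  apply Rabs_le_between in K1; apply Rabs_le_between in K2; unfold E0; lra. }
assert (HA0 : 0 <= A) by exact (HA O).
(* Only an upper bound of the rate matters here, and the absolute value makes [q * T] nonnegative at
   once. *)
pose (q := Rabs (rate T Z0 E0 rho)).
pose (e := A * exp (q * T)).
pose (Hs := Hb + T * (speed E0 * Rabs (flow_RQ T Z0 E0 rho))).
assert (Q0 : 0 <= q) by apply Rabs_pos.
assert (V0 : 0 <= speed E0) by apply sqrt_pos.
assert (TV : 0 <= T * speed E0) by (apply Rmult_le_pos; lra).
assert (Hs0 : Hb <= Hs).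
{ unfold Hs; assert (0 <= T * (speed E0 * Rabs (flow_RQ T Z0 E0 rho)));
    [|lra]; repeat apply Rmult_le_pos; try lra; apply Rabs_pos. }
exists (B_nrm_const dx (zeta_sup T Z0 E0) e Hs); split.
- apply B_nrm; auto.
  + intros j; unfold zeta_sup; specialize (HZ j); lra.
  + intros n; eapply Rle_trans; [apply HA|]; unfold e.
    rewrite <- (Rmult_1_r A) at 1; apply Rmult_le_compat_l; [easy|].
    rewrite <- exp_0 at 1; assert (0 <= q * T) by (apply Rmult_le_pos; lra).
    destruct H as [L| <-]; [left; now apply exp_increasing|lra].
  + intros j; specialize (HH j); lra.
- intros T' M X HT' HN HS EX t Ht; rewrite <- EX in *.
  apply B_nrm.
  + easy.
  + apply (flow_in_B dx rho T' M X Hdx HN HS HB0 t Ht).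
  + intros j; apply (flow_zeta_sup dx rho T' M X Hdx HN HS HB0 T Z0 E0); auto.
  + intros n; eapply Rle_trans;
      [apply (flow_edens dx rho T' M X Hdx Hrho HN HS HB0 T Z0 E0 A); auto|].
    apply Rmult_le_compat_l; [easy|].
    assert (rate T Z0 E0 rho * t <= q * T).
    { apply Rle_trans with (q * t); [apply Rmult_le_compat_r; [lra|apply Rle_abs]|].
      apply Rmult_le_compat_l; lra. }
    destruct H as [L|E]; [left; now apply exp_increasing|rewrite E; lra].
  + intros j.
    assert (K : Rabs (H (X t) j - H (X 0) j) <=
        speed E0 * Rabs (flow_RQ T Z0 E0 rho) * Rabs (t - 0)).
    { apply (mean_value_bound (fun s => H (X s) j)
        (fun s => - (U (X s) j * Rfun dx rho (X s) (j - 1)%Z))); try lra;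
      rewrite Rmin_left, Rmax_right by lra; intros r Hr.
      - apply (HS r ltac:(lra) j j).
      - rewrite Rabs_Ropp, Rabs_mult; apply Rmult_le_compat; try apply Rabs_pos.
        + apply (flow_U_sup dx rho T' M X Hdx HN HS HB0 E0); auto; lra.
        + eapply Rle_trans; [|apply Rle_abs].
          apply (flow_R_sup dx rho T' M X Hdx Hrho HN HS HB0 T Z0 E0); auto; lra. }
    rewrite Rminus_0_r, (Rabs_pos_eq t) in K by lra.
    replace (H (X t) j) with (H (X 0) j + (H (X t) j - H (X 0) j)) by ring.
    eapply Rle_trans; [apply Rabs_triang|]; specialize (HH j); unfold Hs.
    assert (speed E0 * Rabs (flow_RQ T Z0 E0 rho) * t <=
            speed E0 * Rabs (flow_RQ T Z0 E0 rho) * T).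
    { apply Rmult_le_compat_l; [|lra]; apply Rmult_le_pos; [easy|apply Rabs_pos]. }
    lra.
Qed.

Lemma global_flow : exists X : R -> state, X 0 = X0 /\
  (forall t, 0 <= t -> solves_at dx rho X t) /\
  (forall T, exists M, forall t, 0 <= t < T -> nrm dx (X t) M).
Proof.
destruct (sol_global idx (functionals dx) (functionals_finlin dx) (functionals_ev dx)
  (rhs dx rho) (rhs_lip dx rho) (flat X0)) as [x [Sx Ex]].
{ intros T HT; destruct (apriori_bound T HT) as (Mb & B0 & AP).
  apply (sol_up_to idx (functionals dx) (functionals_finlin dx) (functionals_ev dx)
    (rhs dx rho) (rhs_bnd dx rho) (rhs_lip dx rho) (flat X0) T Mb HT).
  - apply bnd_nrm; now rewrite unflat_flat.
  - intros x T' HT' Sx Ex t Ht; apply bnd_nrm.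
    destruct (sol_flow dx rho T' x Sx) as [[M HN] HS].
    apply (AP T' M (fun s => unflat (x s))); auto.
    rewrite <- (unflat_flat X0); f_equal; now apply functional_extensionality. }
exists (fun t => unflat (x t)); split; [|split].
- rewrite <- (unflat_flat X0); f_equal; now apply functional_extensionality.
- intros t Ht; apply (sol_flow dx rho (t + 1) x (Sx (t + 1))); lra.
- intros T; apply (sol_flow dx rho T x (Sx T)).
Qed.

End Existence.

(** * Regularity, uniqueness and the final estimate *)

Lemma halfline_limit_0 (f : R -> R) t C T : 0 <= t < T ->
  (forall s, 0 <= s < T -> s <> t -> 0 <= f s <= C * Rabs (s - t)) ->
  filterlim f (halfline' t) (locally 0).
Proof.
intros Ht B P [eps HP]; assert (He := cond_pos eps).
assert (Hc := Rabs_pos C).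
assert (Hm : 0 < Rmin (T - t) (eps / (Rabs C + 1))).
{ apply Rmin_glb_lt; [lra|apply Rdiv_lt_0_compat; lra]. }
exists (mkposreal _ Hm); intros s Hs N H0; apply HP.
change (Rabs (s - t) < Rmin (T - t) (eps / (Rabs C + 1))) in Hs.
change (Rabs (f s - 0) < eps).
assert (L1 := Rlt_le_trans _ _ _ Hs (Rmin_l _ _)).
assert (L2 := Rlt_le_trans _ _ _ Hs (Rmin_r _ _)).
apply (Rmult_lt_compat_r (Rabs C + 1)) in L2; [|lra].
replace (eps / (Rabs C + 1) * (Rabs C + 1)) with (pos eps) in L2 by (field; lra).
assert (Hst := Rabs_def2 _ _ L1); destruct (B s ltac:(lra) N) as [B1 B2].
rewrite Rminus_0_r, Rabs_pos_eq by easy.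
assert (C * Rabs (s - t) <= Rabs C * Rabs (s - t))
  by (apply Rmult_le_compat_r; [apply Rabs_pos|apply Rle_abs]).
generalize (Rabs_pos (s - t)); intros; lra.
Qed.

Lemma flow_C1 dx rho (X : R -> state) : 0 < dx ->
  (forall t, 0 <= t -> solves_at dx rho X t) ->
  (forall T, exists M, forall t, 0 <= t < T -> nrm dx (X t) M) ->
  C1_E dx X.
Proof.
intros Hdx HS HN; split.
{ intros t Ht; destruct (HN (t + 1)) as [M HM].
  apply (nrm_in_E dx (X t) M Hdx); apply HM; lra. }
assert (TL : forall t, 0 <= t -> exists C, 0 <= C /\ forall s, 0 <= s < t + 1 ->
  nrm dx (unflat (fun i => flat (X s) i - flat (X t) i
      - (s - t) * flat (state_rhs dx rho (X t)) i)) (C * (s - t) ^ 2) /\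
  nrm dx (unflat (fun i => flat (state_rhs dx rho (X s)) i
      - flat (state_rhs dx rho (X t)) i)) (C * Rabs (s - t))).
{ intros t Ht; destruct (HN (t + 1)) as [M HM].
  assert (Sx := flow_sol dx rho (t + 1) M X HM (fun s Hs => HS s (proj1 Hs))).
  destruct (sol_taylor idx (functionals dx) (functionals_finlin dx)
    (rhs dx rho) (rhs_bnd dx rho) (rhs_lip dx rho) _ _ Sx) as [C [HC TC]].
  exists C; split; [easy|]; intros s Hs; destruct (TC s t Hs ltac:(lra)) as [T1 T2].
  apply bnd_nrm in T1; apply bnd_nrm in T2; unfold rhs in T1, T2.
  rewrite !unflat_flat in T1, T2; now split. }
(* The derivative is the right-hand side itself: the Taylor remainder is quadratic in [s - t], so
   division by [s - t] leaves a multiple of [|s - t|]. *)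
exists (fun t => ev (state_rhs dx rho (X t))); split; [|split].
- intros t Ht; destruct (HN (t + 1)) as [M HM].
  destruct (near_rhs dx rho M) as (K & L & _ & _ & NR).
  assert (N1 := NR _ _ 0 (Rle_refl 0) (near_self dx (X t) M (HM t ltac:(lra)))).
  rewrite <- (unflat_flat (state_rhs dx rho (X t))) in N1.
  apply near_elim in N1; destruct N1 as [N1 _]; apply bnd_nrm in N1.
  rewrite unflat_flat in N1; now apply (nrm_in_E dx _ K).
- intros t Ht; destruct (TL t Ht) as [C [HC TC]].
  apply (halfline_limit_0 _ t (norm_E_const dx * C) (t + 1)); [lra|].
  intros s Hs N; destruct (TC s Hs) as [T1 _].
  apply bnd_nrm, (bnd_scal idx _ (functionals_finlin dx) (/ (s - t))), bnd_nrm in T1.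
  set (Y := unflat _) in T1.
  assert (EY : evec_sub (evec_scal (/ (s - t)) (evec_sub (X s) (X t)))
                 (state_rhs dx rho (X t)) = ev Y).
  { unfold Y, evec_sub, evec_scal, unflat; simpl.
    f_equal; apply functional_extensionality; intros j; field; lra. }
  rewrite EY; split; [apply norm_E_ge0; exact (nrm_in_E dx Y _ Hdx T1)|].
  eapply Rle_trans; [apply (nrm_norm_E dx Y _ Hdx T1)|].
  rewrite Rmult_assoc; apply Rmult_le_compat_l; [apply norm_E_const_ge0|].
  right; rewrite <- (pow2_abs (s - t)), Rabs_inv; field.
  apply Rabs_no_R0; lra.
- intros t Ht; destruct (TL t Ht) as [C [HC TC]].
  apply (halfline_limit_0 _ t (norm_E_const dx * C) (t + 1)); [lra|].
  intros s Hs N; destruct (TC s Hs) as [_ T2].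
  set (Y := unflat _) in T2.
  assert (EY : evec_sub (state_rhs dx rho (X s)) (state_rhs dx rho (X t)) = ev Y)
    by reflexivity.
  rewrite EY; split; [apply norm_E_ge0; exact (nrm_in_E dx Y _ Hdx T2)|].
  eapply Rle_trans; [apply (nrm_norm_E dx Y _ Hdx T2)|right; ring].
Qed.

(** * Uniqueness *)

Lemma compact_bounded (P : R -> R -> Prop) T : 0 <= T ->
  (forall t K K', K <= K' -> P t K -> P t K') ->
  (forall t, 0 <= t <= T -> exists d K, 0 < d /\
     forall s, 0 <= s -> Rabs (s - t) < d -> P s K) ->
  exists K, forall t, 0 <= t <= T -> P t K.
Proof.
intros HT Mono Loc.
(* The times up to which a single bound works. The local bound at the supremum extends it beyond,
   unless [T] is reached. *)
pose (E t := 0 <= t <= T /\ exists K, forall s, 0 <= s <= t -> P s K).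
assert (E0 : E 0).
{ split; [lra|]; destruct (Loc 0 ltac:(lra)) as (d & K & Hd & HK); exists K.
  intros s Hs; apply HK; [lra|]; replace (s - 0) with 0 by lra; rewrite Rabs_R0; lra. }
destruct (completeness E) as [m [U L]].
- exists T; intros t Et; apply Et.
- now exists 0.
- assert (Hm : 0 <= m <= T).
  { split; [now apply U|apply L; intros t Et; apply Et]. }
  destruct (Loc m Hm) as (d & K & Hd & HK).
  assert (X : exists t, E t /\ m - d < t).
  { destruct (Classical_Prop.classic (exists t, E t /\ m - d < t)) as [|N]; [easy|].
    assert (m <= m - d); [|lra]; apply L; intros t Et.
    destruct (Rle_dec t (m - d)); [easy|]; exfalso; apply N; exists t; split; [easy|lra]. }
  destruct X as [t [Et Lt]]; destruct (Et) as [Ht [K' HK']].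
  assert (U' := U t Et).
  assert (EM : E (Rmin T (m + d / 2))).
  { split; [unfold Rmin; destruct Rle_dec; lra|]; exists (Rmax K K').
    intros s Hs; destruct (Rle_dec s t).
    - apply (Mono s K'); [apply Rmax_r|apply HK'; lra].
    - apply (Mono s K); [apply Rmax_l|apply HK; [lra|]].
      assert (s <= m + d / 2) by (eapply Rle_trans; [apply Hs|apply Rmin_r]).
      apply Rabs_def1; lra. }
  assert (Q := U _ EM); unfold Rmin in *; destruct Rle_dec; [|lra].
  exact (proj2 EM).
Qed.

(** Near [t] the difference quotient is within distance 1 of the derivative, so [v s] is [v t] plus
    [s - t] times a bounded vector. *)
Lemma C1_E_locally_bounded dx (v : R -> evec) t : 0 < dx -> C1_E dx v -> 0 <= t ->
  exists d K, 0 < d /\ forall s, 0 <= s -> Rabs (s - t) < d -> nrm dx (lift (v s)) K.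
Proof.
intros Hdx [Hv (v' & Hv' & D & _)] Ht.
pose (w s := evec_sub (evec_scal (/ (s - t)) (evec_sub (v s) (v t))) (v' t)).
assert (B0 := in_E_nrm dx _ Hdx (Hv t Ht)); assert (B1 := in_E_nrm dx _ Hdx (Hv' t Ht)).
set (k := 1 + / sqrt dx) in *.
assert (Hk : 0 < k) by (assert (0 < / sqrt dx)
  by (now apply Rinv_0_lt_compat, sqrt_lt_R0); unfold k; lra).
set (K0 := k * norm_E dx (v t)) in *; set (K1 := k * norm_E dx (v' t)) in *.
destruct (D t Ht (fun z => Rabs z < 1)) as [d Hd].
{ exists (mkposreal 1 Rlt_0_1); intros z Hz; change (Rabs (z - 0) < 1) in Hz.
  now rewrite Rminus_0_r in Hz. }
rewrite <- (unflat_flat (lift (v t))) in B0; rewrite <- (unflat_flat (lift (v' t))) in B1.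
apply bnd_nrm in B0; apply bnd_nrm in B1.
assert (Hd1 : 0 < Rmin d 1) by (apply Rmin_glb_lt; [apply cond_pos|lra]).
assert (P0 : 0 <= K0) by (apply Rmult_le_pos; [lra|now apply norm_E_ge0, Hv]).
assert (P1 : 0 <= K1) by (apply Rmult_le_pos; [lra|now apply norm_E_ge0, Hv']).
exists (Rmin d 1), (K0 + (k + K1)); split; [easy|]; intros s Hs Ls.
assert (L1 := Rlt_le_trans _ _ _ Ls (Rmin_l _ _)).
assert (L2 := Rlt_le_trans _ _ _ Ls (Rmin_r _ _)).
rewrite <- (unflat_flat (lift (v s))); apply bnd_nrm.
destruct (Req_dec s t) as [->|N].
{ apply (bnd_weak idx _ _ K0); [lra|easy]. }
assert (Wn := Hd s L1 N Hs); cbv beta in Wn; fold (w s) in Wn.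
(* [norm_E] is a total function: a small value carries information only once membership in the space
   is known. *)
assert (WE : in_E dx (w s)).
{ assert (Bs := in_E_nrm dx _ Hdx (Hv s Hs)).
  rewrite <- (unflat_flat (lift (v s))) in Bs; apply bnd_nrm in Bs.
  assert (Bw := bnd_minus idx _ (functionals_finlin dx) _ _ _ _
    (bnd_scal idx _ (functionals_finlin dx) (/ (s - t)) _ _
      (bnd_minus idx _ (functionals_finlin dx) _ _ _ _ Bs B0)) B1).
  apply bnd_nrm in Bw; exact (nrm_in_E dx _ _ Hdx Bw). }
assert (Bw := in_E_nrm dx _ Hdx WE); fold k in Bw.
rewrite <- (unflat_flat (lift (w s))) in Bw; apply bnd_nrm in Bw.
assert (Bw1 : bnd idx (functionals dx) (flat (lift (w s))) k).
{ apply (bnd_weak idx _ _ (k * norm_E dx (w s))); [|easy].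
  rewrite <- (Rmult_1_r k) at 2; apply Rmult_le_compat_l; [lra|].
  apply Rabs_def2 in Wn; lra. }
apply (bnd_weak idx _ _ (K0 + Rabs (s - t) * (k + K1))).
{ apply Rplus_le_compat_l; rewrite <- (Rmult_1_l (k + K1)) at 2.
  apply Rmult_le_compat_r; lra. }
apply (bnd_ext idx _ (functionals_finlin dx) (fun i => flat (lift (v t)) i +
  (s - t) * (flat (lift (w s)) i + flat (lift (v' t)) i))).
- intros []; simpl; field; lra.
- apply (bnd_plus idx _ (functionals_finlin dx)); [easy|].
  apply (bnd_scal idx _ (functionals_finlin dx) (s - t)
    (fun i => flat (lift (w s)) i + flat (lift (v' t)) i)).
  now apply (bnd_plus idx _ (functionals_finlin dx)).
Qed.

(** A competitor is C^1 in norm only in its [E] components, while its kernels are differentiable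
    entrywise. Compactness bounds the former, [in_B] then bounds the latter, and together this is
    the boundedness that [sol_unique] asks for. *)
Lemma global_solution_bounded dx rho X0 (X : R -> state) T : 0 < dx -> 0 <= T ->
  global_solution dx rho X0 X ->
  exists M, forall t, 0 <= t < T -> nrm dx (X t) M.
Proof.
intros Hdx HT (_ & _ & HC & HB).
destruct (compact_bounded (fun t K => nrm dx (lift (X t)) K) T HT) as [K HK].
- intros t K K' L B; rewrite <- (unflat_flat (lift (X t))) in *.
  apply bnd_nrm; apply bnd_nrm in B; now apply (bnd_weak idx _ _ K).
- intros t Ht; apply (C1_E_locally_bounded dx (fun s => ev (X s)) t Hdx HC); lra.
- pose (W := Rabs (/ dx) * (K + K)).
  exists (B_nrm_const dx K (K ^ 2 + K ^ 2 + W ^ 2 + K ^ 2 + K ^ 2) K).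
  intros t Ht; destruct (HK t ltac:(lra)) as (Bz & Bdz & Bu & Bh & Bdh & Br & _).
  assert (Bw := l2b_Dp dx _ _ Bu); fold W in Bw.
  apply B_nrm; auto; [apply HB; lra|]; intros n; unfold edens; rewrite !psum_plus.
  repeat apply Rplus_le_compat; apply l2b_elim; assumption.
Qed.

Lemma global_solution_unique dx rho X0 (X X' : R -> state) : 0 < dx ->
  X 0 = X0 -> (forall t, 0 <= t -> solves_at dx rho X t) ->
  (forall T, exists M, forall t, 0 <= t < T -> nrm dx (X t) M) ->
  global_solution dx rho X0 X' -> forall t, 0 <= t -> X' t = X t.
Proof.
intros Hdx EX HS HN G t Ht.
destruct (HN (t + 1)) as [M HM].
destruct (global_solution_bounded dx rho X0 X' (t + 1) Hdx ltac:(lra) G) as [M' HM'].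
destruct G as (HS' & EX' & _).
rewrite <- (unflat_flat (X' t)), <- (unflat_flat (X t)); f_equal.
apply functional_extensionality; intros i.
apply (sol_unique idx (functionals dx) (functionals_finlin dx) (functionals_ev dx)
  (rhs dx rho) (rhs_lip dx rho) (fun s => flat (X' s)) (fun s => flat (X s)) (t + 1)).
- apply (flow_sol dx rho (t + 1) M'); [easy|]; intros s Hs; exact (HS' s (proj1 Hs)).
- apply (flow_sol dx rho (t + 1) M); [easy|]; intros s Hs; apply HS; lra.
- intros k; now rewrite EX, EX'.
- lra.
Qed.

(** * The cumulative energy and the final estimate *)

Lemma sum_n_cumulative dx (v : Z -> R) j n : 0 < dx ->
  sum_n (fun n => dx * Dp dx v (j - 1 - Z.of_nat n)%Z) n
    = v j - v (j - 1 - Z.of_nat n)%Z.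
Proof.
intros Hdx; induction n as [|n IHn].
- rewrite sum_O; unfold Dp; replace (j - 1 - Z.of_nat 0 + 1)%Z with j by lia.
  match goal with |- ?a = ?b => change (@eq R a b) end; field; lra.
- rewrite sum_Sn, IHn; unfold plus; cbn -[Z.of_nat]; unfold Dp.
  replace (j - 1 - Z.of_nat (S n) + 1)%Z with (j - 1 - Z.of_nat n)%Z by lia.
  match goal with |- ?a = ?b => change (@eq R a b) end; field; lra.
Qed.

Lemma cumulative_lim dx (v : evec) : 0 < dx -> cumulative_energy dx v ->
  is_lim_seq (fun n => H v (- Z.of_nat n)%Z) 0.
Proof.
intros Hdx C; specialize (C 1%Z).
assert (L : is_lim_seq (fun n => H v 1%Z - H v (1 - 1 - Z.of_nat n)%Z) (H v 1%Z)).
{ eapply is_lim_seq_ext; [intros n; apply (sum_n_cumulative dx (H v) 1 n Hdx)|exact C]. }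
apply is_lim_seq_ext with
  (fun n => H v 1%Z - (H v 1%Z - H v (1 - 1 - Z.of_nat n)%Z)).
- intros n; replace (1 - 1 - Z.of_nat n)%Z with (- Z.of_nat n)%Z by lia; ring.
- replace (Finite 0) with (Finite (H v 1%Z - H v 1%Z)) by (f_equal; ring).
  apply is_lim_seq_minus'; [apply is_lim_seq_const|exact L].
Qed.

Lemma Hinfty_facts dx (Y : state) : 0 < dx -> in_B dx Y -> cumulative_energy dx Y ->
  (forall j, 0 <= H Y j <= Hinfty Y) /\
  Hinfty Y <= norm_linf (H Y).
Proof.
intros Hdx HB C.
assert (Mon : forall j, H Y j <= H Y (j + 1)%Z).
{ intros j; assert (A := h_ge0 dx Y HB j); unfold hvec, Dp in A.
  apply (Rmult_le_compat_r dx) in A; [|lra].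
  replace ((H Y (j + 1)%Z - H Y j) / dx * dx)
    with (H Y (j + 1)%Z - H Y j) in A by (field; lra); lra. }
destruct HB as [[[_ [_ [[[M Bh] _] _]]] _] _].
destruct (norm_linf_spec _ _ Bh) as [Nh _].
destruct (ex_finite_lim_seq_incr (fun n => H Y (Z.of_nat n)) M) as [l Hl].
- intros n; replace (Z.of_nat (S n)) with (Z.of_nat n + 1)%Z by lia; apply Mon.
- intros n; eapply Rle_trans; [apply Rle_abs|apply Bh].
- assert (EH : Hinfty Y = l) by (unfold Hinfty; now rewrite (is_lim_seq_unique _ _ Hl)).
  rewrite EH; split; [intros j; split|].
  + apply (incr_left (H Y) j 0); [auto|now apply (cumulative_lim dx)|lia].
  + apply (incr_right (H Y) j l); [auto|easy|lia].
  + apply (is_lim_seq_le (fun n => H Y (Z.of_nat n)) (fun _ => norm_linf (H Y))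
      l (norm_linf (H Y))); [|easy|apply is_lim_seq_const].
    intros n; eapply Rle_trans; [apply Rle_abs|apply Nh].
Qed.

Lemma edens_norm_E dx (Y : state) n : 0 < dx -> in_E dx Y ->
  dx * psum (edens dx Y) n <= norm_E dx Y ^ 2.
Proof.
intros Hdx HE; destruct HE as [[Bz Bdz] [[Bu Bdu] [[Bh Bdh] Br]]].
assert (K1 := norm_l2_psum dx _ n Hdx Bdz); assert (K2 := norm_l2_psum dx _ n Hdx Bu).
assert (K3 := norm_l2_psum dx _ n Hdx Bdu); assert (K4 := norm_l2_psum dx _ n Hdx Bdh).
assert (K5 := norm_l2_psum dx _ n Hdx Br).
assert (E1 : norm_h1 dx (U Y) ^ 2 = norm_l2 dx (U Y) ^ 2 + norm_l2 dx (Dp dx (U Y)) ^ 2).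
{ unfold norm_h1; apply pow2_sqrt, Rplus_le_le_0_compat; apply pow2_ge_0. }
unfold edens; rewrite !psum_plus; fold (wvec dx Y) (hvec dx Y).
unfold wvec, hvec; unfold norm_E, norm_V.
generalize (norm_linf_ge0 _ Bz) (norm_linf_ge0 _ Bh) (norm_l2_ge0 dx (Dp dx (zeta Y)))
  (norm_l2_ge0 dx (Dp dx (H Y))) (norm_l2_ge0 dx (rbar Y)).
assert (P : 0 <= norm_h1 dx (U Y)) by apply sqrt_pos.
set (x1 := norm_linf (zeta Y)); set (x2 := norm_linf (H Y)).
set (x3 := norm_l2 dx (Dp dx (zeta Y))) in *; set (x4 := norm_l2 dx (Dp dx (H Y))) in *.
set (x5 := norm_l2 dx (rbar Y)) in *; set (x6 := norm_h1 dx (U Y)) in *.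
intros H1 H2 H3 H4 H5.
apply Rle_trans with (x3 ^ 2 + x6 ^ 2 + x4 ^ 2 + x5 ^ 2); [lra|].
assert (Q : forall a b, 0 <= a -> 0 <= b -> a ^ 2 + b ^ 2 <= (a + b) ^ 2).
{ intros a b Ha Hb; generalize (Rmult_le_pos _ _ Ha Hb); lra. }
assert (Q1 := Q x3 x6 H3 P); assert (Q2 := Q (x3 + x6) x4 ltac:(lra) H4).
assert (Q3 := Q (x3 + x6 + x4) x5 ltac:(lra) H5).
apply Rle_trans with ((x3 + x6 + x4 + x5) ^ 2); [lra|apply pow_incr; lra].
Qed.

(** [2] accounts for the initial sup norm of [zeta] and the sup norm of [H], [t] for the
    displacement of [zeta], and [4] for the norms of [D_+ zeta], [U], [D_+ H] and [rbar]. The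
    horizon [t + 1] puts [t] inside the half-open interval on which the flow bounds hold. *)
Definition growth (t E rho Z : R) : R :=
  2 + (t + 4) * exp (rate (t + 1) Z E rho * t).

Lemma flow_growth dx rho (X : R -> state) : 0 < dx -> 0 <= rho ->
  in_B dx (X 0) -> (forall t, 0 <= t -> solves_at dx rho X t) ->
  (forall T, exists M, forall t, 0 <= t < T -> nrm dx (X t) M) ->
  cumulative_energy dx (X 0) -> forall t, 0 < t ->
  norm_E dx (X t) <=
    growth t (Hinfty (X 0)) rho (norm_linf (zeta (X 0))) * norm_E dx (X 0).
Proof.
intros Hdx Hrho HB HS HN HC t Ht.
destruct (HN (t + 1)) as [M HM]; assert (HS1 := fun s (Hs : 0 <= s < t + 1) => HS s (proj1 Hs)).
destruct (Hinfty_facts dx (X 0) Hdx HB HC) as [HH Hle].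
assert (HinE : in_E dx (X 0)) by apply HB.
assert (N0ge := norm_E_ge0 dx (X 0) HinE).
assert (HA := fun n => edens_norm_E dx (X 0) n Hdx HinE).
assert (NE : norm_E dx (X 0) = norm_linf (zeta (X 0)) + norm_l2 dx (Dp dx (zeta (X 0)))
  + norm_h1 dx (U (X 0)) + (norm_linf (H (X 0)) + norm_l2 dx (Dp dx (H (X 0))))
  + norm_l2 dx (rbar (X 0))) by reflexivity.
destruct HinE as [[[MZ Bz] _] [_ [[Bh _] _]]].
destruct (norm_linf_spec _ _ Bz) as [HZ _].
assert (Pz := norm_linf_ge0 _ (ex_intro _ _ Bz)); assert (Ph := norm_linf_ge0 _ Bh).
assert (P1 := norm_l2_ge0 dx (Dp dx (zeta (X 0)))).
assert (P2 := norm_l2_ge0 dx (Dp dx (H (X 0)))).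
assert (P3 := norm_l2_ge0 dx (rbar (X 0))).
assert (P4 : 0 <= norm_h1 dx (U (X 0))) by apply sqrt_pos.
set (N0 := norm_E dx (X 0)) in *; set (Z0 := norm_linf (zeta (X 0))) in *.
set (E0 := Hinfty (X 0)) in *; unfold growth.
assert (HE : forall i j, (i <= j)%Z -> H (X 0) j - H (X 0) i <= E0)
  by (intros i j _; generalize (HH i) (HH j); lra).
assert (HA' : forall n, psum (edens dx (X 0)) n <= N0 ^ 2 / dx).
{ intros n; apply (Rmult_le_reg_l dx); [easy|].
  replace (dx * (N0 ^ 2 / dx)) with (N0 ^ 2) by (field; lra); apply HA. }
assert (R0 := rate_ge0 dx rho (t + 1) M X Hdx Hrho HM HS1 HB (t + 1) Z0 E0
  (Rle_refl _) HZ HE ltac:(lra)).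
set (q := rate (t + 1) Z0 E0 rho) in *; set (g := exp (q * t)).
assert (Hg : 1 <= g).
{ unfold g; rewrite <- exp_0; assert (0 <= q * t) by (apply Rmult_le_pos; lra).
  destruct H as [L| <-]; [left; now apply exp_increasing|lra]. }
assert (HNg : 0 <= N0 * g) by (apply Rmult_le_pos; lra).
assert (De : forall s n, 0 <= s <= t -> dx * psum (edens dx (X s)) n <= (N0 * g) ^ 2).
{ intros s n Hs.
  assert (K := flow_edens dx rho (t + 1) M X Hdx Hrho HM HS1 HB (t + 1) Z0 E0 (N0 ^ 2 / dx)
    (Rle_refl _) HZ HE HA' s n ltac:(lra)); fold q in K.
  assert (exp (q * s) <= g).
  { unfold g; assert (q * s <= q * t) by (apply Rmult_le_compat_l; lra).
    destruct H as [L|E]; [left; now apply exp_increasing|rewrite E; lra]. }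
  apply (Rmult_le_compat_l dx) in K; [|lra].
  replace (dx * (N0 ^ 2 / dx * exp (q * s))) with (N0 ^ 2 * exp (q * s)) in K
    by (field; lra).
  (* As [g >= 1], it is relaxed to [g ^ 2], so that the square root of the bound is simply
     [N0 * g]. *)
  assert (N0 ^ 2 * exp (q * s) <= N0 ^ 2 * g ^ 2); [|lra].
  apply Rmult_le_compat_l; [apply pow2_ge_0|].
  assert (g * 1 <= g * g) by (apply Rmult_le_compat_l; lra); lra. }
assert (L2 : forall v, (forall j, v j ^ 2 <= edens dx (X t) j) -> norm_l2 dx v <= N0 * g).
{ intros v Hv; apply norm_l2_le; [easy|easy|]; intros n.
  eapply Rle_trans; [|apply (De t n); lra]; apply Rmult_le_compat_l; [lra|].
  now apply psum_le. }
(* The bound through h^1 is used rather than the one through the energy, because it is linear in the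
   initial norm. *)
assert (US : forall s j, 0 <= s <= t -> Rabs (U (X s) j) <= N0 * g).
{ intros s j Hs; apply abs_le_of_sqr; [easy|].
  apply (U_sup_h1 dx (X s) Hdx).
  - apply (flow_in_B dx rho (t + 1) M X Hdx HM HS1 HB); lra.
  - intros n; eapply Rle_trans; [|apply (De s n Hs)].
    apply Rmult_le_compat_l; [lra|]; apply psum_le; intros; apply edens_parts. }
assert (Kz : norm_linf (zeta (X t)) <= N0 + t * (N0 * g)).
{ apply norm_linf_spec; intros j.
  assert (Q : Rabs (zeta (X t) j - zeta (X 0) j) <= N0 * g * Rabs (t - 0)).
  { apply (mean_value_bound (fun s => zeta (X s) j) (fun s => U (X s) j)); try lra;
      rewrite Rmin_left, Rmax_right by lra; intros r Hr.
    - apply (HS r ltac:(lra) j j).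
    - now apply US. }
  rewrite Rminus_0_r, (Rabs_pos_eq t) in Q by lra.
  replace (zeta (X t) j) with (zeta (X 0) j + (zeta (X t) j - zeta (X 0) j)) by ring.
  eapply Rle_trans; [apply Rabs_triang|]; specialize (HZ j); lra. }
(* [H] stays between 0 and the conserved energy [E0], which is at most the initial sup norm of [H];
   this component does not grow. *)
assert (Kh : norm_linf (H (X t)) <= N0).
{ assert (Ht1 : 0 <= t < t + 1) by lra.
  destruct (H_increment_l2 dx rho (t + 1) M X HM HS1 t Ht1) as [K BK].
  assert (LH : is_lim_seq (fun n => H (X t) (- Z.of_nat n)%Z) 0).
  { replace (Finite 0) with (Finite (0 + 0)) by (f_equal; ring).
    apply is_lim_seq_ext with (fun n => (H (X t) (- Z.of_nat n)%Z - H (X 0) (- Z.of_nat n)%Z)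
       + H (X 0) (- Z.of_nat n)%Z); [intros; ring|].
    apply is_lim_seq_plus'; [apply (l2b_lim _ _ BK)|now apply (cumulative_lim dx)]. }
  apply norm_linf_spec; intros j.
  assert (A1 : 0 <= H (X t) j).
  { apply (incr_left (H (X t)) j 0); [|exact LH|lia]; intros k _.
    apply (H_monotone dx rho (t + 1) M X Hdx HM HS1 HB); [lra|lia]. }
  assert (A2 : H (X t) j <= E0).
  { apply (is_lim_seq_le_loc (fun _ => H (X t) j)
      (fun n => E0 + H (X t) (- Z.of_nat n)%Z) (H (X t) j) E0).
    - exists (Z.abs_nat j); intros n Hn.
      generalize (flow_energy dx rho (t + 1) M X Hdx HM HS1 HB E0 HE t
        (- Z.of_nat n)%Z j Ht1 ltac:(lia)); lra.
    - apply is_lim_seq_const.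
    - replace (Finite E0) with (Finite (E0 + 0)) by (f_equal; ring).
      apply is_lim_seq_plus'; [apply is_lim_seq_const|exact LH]. }
  rewrite Rabs_pos_eq; lra. }
assert (Ku : norm_h1 dx (U (X t)) <= N0 * g).
{ unfold norm_h1; rewrite <- (sqrt_pow2 (N0 * g)) by easy; apply sqrt_le_1_alt.
  assert (HBt := flow_in_B dx rho (t + 1) M X Hdx HM HS1 HB t ltac:(lra)).
  assert (Bu : in_h1 dx (U (X t))) by apply HBt; destruct Bu as [B1 B2].
  assert (Sq : forall v, in_l2 v ->
    norm_l2 dx v ^ 2 = dx * sumZ (fun j => Rabs (v j) ^ 2)).
  { intros v Bv; apply pow2_sqrt, Rmult_le_pos; [lra|exact (in_l2_psum v O Bv)]. }
  rewrite (Sq _ B1), (Sq _ B2).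
  rewrite <- Rmult_plus_distr_l.
  assert (A1 : forall v, in_l2 v -> asum (fun j => Rabs (v j) ^ 2)
      (sumZ (fun j => Rabs (v j) ^ 2))).
  { intros v Bv n; rewrite (psum_ext _ (fun j => Rabs (v j) ^ 2)).
    - apply psum_le_sumZ; [exact Bv|intros; apply pow2_ge_0].
    - intros; apply Rabs_pos_eq, pow2_ge_0. }
  rewrite <- (sumZ_plus _ _ _ _ (A1 _ B1) (A1 _ B2)).
  apply (Rmult_le_reg_l (/ dx)); [now apply Rinv_0_lt_compat|].
  rewrite <- Rmult_assoc, Rinv_l, Rmult_1_l by lra.
  apply sumZ_le_bound; [intros; apply Rplus_le_le_0_compat; apply pow2_ge_0|].
  intros n; apply (Rmult_le_reg_l dx); [easy|].
  rewrite <- Rmult_assoc, Rinv_r, Rmult_1_l by lra.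
  eapply Rle_trans; [|apply (De t n); lra]; apply Rmult_le_compat_l; [lra|].
  apply psum_le; intros j; rewrite !pow2_abs; apply (edens_parts dx (X t) j). }
assert (Kp := L2 (Dp dx (zeta (X t))) (fun j => proj1 (edens_parts dx (X t) j))).
assert (Kdh := L2 (hvec dx (X t)) ltac:(intros j; apply (edens_parts dx (X t) j))).
assert (Kr := L2 (rbar (X t)) ltac:(intros j; apply (edens_parts dx (X t) j))).
change (hvec dx (X t)) with (Dp dx (H (X t))) in Kdh.
unfold norm_E, norm_V; lra.
Qed.

Theorem theorem5p7 :
  exists C : R -> R -> R -> R -> R,
  forall (dx rho : R) (X0 : state),
    0 < dx -> 0 <= rho -> in_B dx X0 ->
    exists X : R -> state,
      global_solution dx rho X0 X /\
      (forall X' : R -> state, global_solution dx rho X0 X' ->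
         forall t : R, 0 <= t -> X' t = X t) /\
      (cumulative_energy dx X0 ->
         forall t : R, 0 < t ->
           norm_E dx (X t)
             <= C t (Hinfty X0) rho (norm_linf (zeta X0)) * norm_E dx X0).
Proof.
exists growth; intros dx rho X0 Hdx Hrho HB.
destruct (global_flow dx rho X0 Hdx Hrho HB) as (X & E0 & HS & HN).
exists X; split; [split; [exact HS|split; [exact E0|split]]|split].
- now apply (flow_C1 dx rho).
- intros t Ht; destruct (HN (t + 1)) as [M HM].
  apply (flow_in_B dx rho (t + 1) M X); auto; [|now rewrite E0|lra].
  intros s Hs; apply HS; lra.
- intros X' G; now apply (global_solution_unique dx rho X0 X X').
- rewrite <- E0 in *; intros HC; now apply (flow_growth dx rho X).
Qed.
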